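(* Let $\mathbb{G}$ be a homogeneous group of homogeneous dimension $Q$ and $|\cdot|$ a homogeneous quasi-norm. Let $1<\gamma<\infty$ and $\max\{1,\gamma-1\}<p<\infty$. Then for all $f\in C_0^\infty(\mathbb{G}\setminus\{0\})$ and all $R>0$, $$\left\|\frac{f-f_R}{|x|^{\frac{Q}{p}}\left(\log\frac{R}{|x|}\right)^{\frac{\gamma}{p}}}\right\|_{L^p(\mathbb{G})}\leq\frac{p}{\gamma-1}\left\|\frac{\mathcal{R}f}{|x|^{\frac{Q-p}{p}}\left(\log\frac{R}{|x|}\right)^{\frac{\gamma-p}{p}}}\right\|_{L^p(\mathbb{G})},$$ where $f_R(x)=f\!\left(R\frac{x}{|x|}\right)$, and the constant $\frac{p}{\gamma-1}$ is optimal. (Here $(\log\frac{R}{|x|})^{s}$ is understood as $|\log\frac{R}{|x|}|^{s}$.)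
   Context: A homogeneous group is a connected simply connected Lie group $\mathbb{G}$ with dilations $x\mapsto\lambda x$ induced by $D_\lambda=\mathrm{Exp}(A\ln\lambda)$ on its Lie algebra ($A$ diagonalisable with positive eigenvalues, $D_\lambda$ Lie algebra automorphisms), and homogeneous dimension $Q=\mathrm{Tr}\,A$. A homogeneous quasi-norm is a continuous nonnegative function $|\cdot|$, vanishing only at $0$, with $|x^{-1}|=|x|$, $|\lambda x|=\lambda|x|$. For $x\neq0$, $R\frac{x}{|x|}$ denotes the dilate by $R/|x|$ of $x$, i.e. the point $Ry$ where $x=|x|y$, $|y|=1$. Writing $x=ry$, $r=|x|$, $|y|=1$, the radial derivative is $\mathcal{R}f(x)=\frac{d}{dr}f(ry)$. Norms are with respect to Haar measure. *)

(* Defs.v *)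
(* A homogeneous group is modelled in
   exponential coordinates. *)
From HB Require Import structures.
From mathcomp Require Import all_boot all_order all_algebra.
From mathcomp Require Import all_classical all_reals all_analysis.
Set Implicit Arguments. Unset Strict Implicit. Unset Printing Implicit Defensive.
Import Order.TTheory GRing.Theory Num.Theory.
Import numFieldNormedType.Exports.
Local Open Scope classical_set_scope.
Local Open Scope ring_scope.

Section Defs.
Variable R : realType.

Fixpoint iterD (V W : normedModType R) (vs : seq V) (f : V -> W) : V -> W :=
  match vs with
  | [::] => f
  | v :: vs' => 'D_v (iterD vs' f)
  end.

Definition smooth (V W : normedModType R) (f : V -> W) : Prop :=
  forall (vs : seq V) (x : V), differentiable (iterD vs f) x.

(* Lebesgue integral on R^n of a nonnegative extended-real function,
   as an iterated integral of one-dimensional Lebesgue integrals (Tonelli). *)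
Fixpoint iint (n : nat) (g : (nat -> R) -> \bar R) : \bar R :=
  match n with
  | O => g (fun _ => 0)
  | n'.+1 => (\int[@lebesgue_measure R]_t
                iint n' (fun x => g (fun i => if i == n' then t else x i)))%E
  end.

(* integral w.r.t. Lebesgue measure on 'rV_N (= Haar measure in exponential coordinates) *)
Definition haar_int (N : nat) (F : 'rV[R]_N -> \bar R) : \bar R :=
  iint N (fun x => F (\row_(i < N) x i)).

Definition Lp_norm (N : nat) (p : R) (g : 'rV[R]_N -> R) : \bar R :=
  poweR (haar_int (fun x => (powR `|g x| p)%:E)) p^-1.

Definition dil (N : nat) (nu : 'I_N -> R) (l : R) (x : 'rV[R]_N) : 'rV[R]_N :=
  \row_(i < N) (powR l (nu i) * x 0 i).

Definition hom_dim (N : nat) (nu : 'I_N -> R) : R := \sum_(i < N) nu i.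

(* A homogeneous group in exponential coordinates: R^N with a smooth group law
   with identity 0, dilations with positive weights nu acting by group
   automorphisms, and Lebesgue measure as (left) Haar measure. *)
Definition homogeneous_group (N : nat) (nu : 'I_N -> R)
    (mul : 'rV[R]_N -> 'rV[R]_N -> 'rV[R]_N) (inv : 'rV[R]_N -> 'rV[R]_N) : Prop :=
  [/\ (forall i, 0 < nu i),
      [/\ (forall x y z, mul x (mul y z) = mul (mul x y) z),
          (forall x, mul 0 x = x /\ mul x 0 = x) &
          (forall x, mul (inv x) x = 0 /\ mul x (inv x) = 0)],
      smooth (fun xy : 'rV[R]_N * 'rV[R]_N => mul xy.1 xy.2) /\ smooth inv,
      (forall l x y, 0 < l -> dil nu l (mul x y) = mul (dil nu l x) (dil nu l y)) &
      (forall (g : 'rV[R]_N -> R) (y : 'rV[R]_N),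
          continuous g -> (forall x, 0 <= g x) ->
          (exists K, compact K /\ forall x, ~ K x -> g x = 0) ->
          haar_int (fun x => (g (mul y x))%:E) = haar_int (fun x => (g x)%:E))].

Definition homogeneous_quasi_norm (N : nat) (nu : 'I_N -> R)
    (inv : 'rV[R]_N -> 'rV[R]_N) (qn : 'rV[R]_N -> R) : Prop :=
  [/\ continuous qn,
      (forall x, 0 <= qn x),
      (forall x, qn x = 0 <-> x = 0),
      (forall x, qn (inv x) = qn x) &
      (forall l x, 0 < l -> qn (dil nu l x) = l * qn x)].

Definition Cc_inf_punct (N : nat) (f : 'rV[R]_N -> R) : Prop :=
  smooth f /\
  exists K : set 'rV[R]_N, [/\ compact K, ~ K 0 & forall x, ~ K x -> f x = 0].

Definition fR (N : nat) (nu : 'I_N -> R) (qn : 'rV[R]_N -> R)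
    (f : 'rV[R]_N -> R) (Rr : R) (x : 'rV[R]_N) : R :=
  f (dil nu (Rr / qn x) x).

(* radial derivative: d/dr f(r y) at r = |x|, where x = |x| y, |y| = 1 *)
Definition radial (N : nat) (nu : 'I_N -> R) (qn : 'rV[R]_N -> R)
    (f : 'rV[R]_N -> R) (x : 'rV[R]_N) : R :=
  derive1 (fun r : R => f (dil nu (r / qn x) x)) (qn x).

End Defs.

(* Main.v *)
Require Import Defs.
From HB Require Import structures.
From mathcomp Require Import all_boot all_order all_algebra.
From mathcomp Require Import all_classical all_reals all_analysis.
From mathcomp Require Import measurable_realfun.
From mathcomp Require Import ring lra.
Set Implicit Arguments. Unset Strict Implicit. Unset Printing Implicit Defensive.
Import Order.TTheory GRing.Theory Num.Theory.
Import numFieldNormedType.Exports.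
Local Open Scope classical_set_scope.
Local Open Scope ring_scope.

(** Every point off the hyperplane [x_N = 0] is uniquely the dilate by
    [u^(1/nu_N)] of a point whose last coordinate is [1] or [-1]. Integrating
    first along the dilation orbits reduces the inequality to one on the half
    line, in which [f - f_R] vanishes at the same point as
    [om u = log (|x| / R)], a function with derivative [v u = 1 / (nu_N u)].
    There Young's inequality bounds [(gamma-1)/p |h|^p |om|^(-gamma) v] by a
    multiple of [|h'|^p |om|^(p-gamma) v^(1-p)] up to the derivative of
    [|h|^p |om|^(1-gamma)], and the boundary terms vanish since
    [gamma - 1 < p].

    The constant is approached by truncating the extremal
    [(log (1/|x|))^((gamma-1)/p)] in a narrow cone around the last axis with
    the plateau function of [log log (1/|x|)]: both integrals grow like the
    length [2M] of the plateau, with ratio [(p/(gamma-1))^p], while the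
    transition zones contribute a bounded amount. *)

(** * Iterated integrals *)

(** The quasi-norm is only continuous: its unit sphere need not be a manifold, and $|x|$ may not be
    differentiable. On a single orbit both obstacles vanish, since there $|x|$ is a constant times a
    power of the parameter and the radial derivative is the Euler field over $|x|$. The hyperplanes
    $x_N = 1$ and $x_N = -1$ are cross-sections that carry Lebesgue measure. On an orbit the
    Jacobian times $|x|^{-Q}$ is a multiple of $1/u$, so that $Q$ does not enter the constant.

    The same lack of smoothness shapes the test function. It cannot be a function of $|x|$, so it is
    built from $\log(1/x_N)$, in a cone so narrow that this agrees with $\nu_N \log(R/|x|)$ up to a
    factor close to 1 on the support. The support stays inside $|x| < R$, hence $f_R = 0$.

    Young's inequality is an equality along $h = w^{(\gamma-1)/p}$ for $w = |\log(|x|/R)|$, and for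
    this $h$ both integrands are multiples of $dw/w = d(\log w)$. This is why the truncation is done
    on the scale of $\log\log$, where a plateau of length $2M$ contributes a multiple of $2M$ to
    each side. *)

Section iterated_integral.
Context {R : realType}.
Local Notation mu := (@lebesgue_measure R).

(** Convertible with the update performed inside [iint], so that unfolding [iint] exposes it. *)
Definition upd (n : nat) (t : R) (x : nat -> R) : nat -> R :=
  fun i => if i == n then t else x i.

(* Measurability of a function of a parameter and of a sequence of real
   coordinates, tested on all measurable parametrisations of its arguments;
   this makes it stable under substitutions, for any number of coordinates. *)
Definition cyl_measurable d0 (S0 : measurableType d0)
    (g : S0 -> (nat -> R) -> \bar R) : Prop :=
  forall d (S : measurableType d) (a : S -> S0) (phi : S -> nat -> R),
    measurable_fun setT a -> (forall i, measurable_fun setT (phi ^~ i)) ->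
    measurable_fun setT (fun s => g (a s) (phi s)).

Lemma measurable_upd d (S : measurableType d) n (t : S -> R) (phi : S -> nat -> R) :
  measurable_fun setT t -> (forall i, measurable_fun setT (phi ^~ i)) ->
  forall i, measurable_fun setT (fun s => upd n (t s) (phi s) i).
Proof. by move=> mt mphi i; rewrite /upd; case: eqP. Qed.

Lemma cyl_measurable_upd d0 (S0 : measurableType d0) n (g : S0 -> (nat -> R) -> \bar R) :
  cyl_measurable g ->
  cyl_measurable (fun (st : S0 * measurableTypeR R) x => g st.1 (upd n st.2 x)).
Proof.
move=> mg d S a phi ma mphi; apply: mg; first exact: measurableT_comp.
by apply: measurable_upd => //; exact: measurableT_comp.
Qed.

Lemma cyl_measurable_upd1 d0 (S0 : measurableType d0) n (t : R)
    (g : S0 -> (nat -> R) -> \bar R) :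
  cyl_measurable g -> cyl_measurable (fun s x => g s (upd n t x)).
Proof.
move=> mg d S a phi ma mphi; apply: (mg _ _ a) => //.
exact: (@measurable_upd _ _ _ (cst t)).
Qed.

Lemma iint_ge0 n (g : (nat -> R) -> \bar R) :
  (forall x, 0 <= g x)%E -> (0 <= iint n g)%E.
Proof.
elim: n g => [|n IH] g g0 //=; apply: integral_ge0 => t _; exact: IH.
Qed.

Lemma iint0 n : iint n (fun _ : nat -> R => 0%E) = 0%E.
Proof. by elim: n => //= n ->; rewrite integral0. Qed.

(** The outermost coordinate joins the parameter, which is why the induction ranges over all
    parameter spaces; Tonelli's theorem then integrates it out again. *)
Lemma measurable_iint d0 (S0 : measurableType d0) n (g : S0 -> (nat -> R) -> \bar R) :
  cyl_measurable g -> (forall s x, 0 <= g s x)%E ->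
  measurable_fun setT (fun s => iint n (g s)).
Proof.
elim: n d0 S0 g => [|n IH] d0 S0 g mg g0 /=; first exact: (mg _ _ id).
pose h (st : S0 * measurableTypeR R) := iint n (fun x => g st.1 (upd n st.2 x)).
have mh : measurable_fun setT h by apply: IH => //; exact: cyl_measurable_upd.
have h0 st : (0 <= h st)%E by exact: iint_ge0.
exact: (@measurable_fun_fubini_tonelli_F _ _ _ _ _ mu h mh h0).
Qed.

Lemma measurable_iint_upd n (g : (nat -> R) -> \bar R) :
  cyl_measurable (fun _ : unit => g) -> (forall x, 0 <= g x)%E ->
  measurable_fun setT (fun t : measurableTypeR R => iint n (fun x => g (upd n t x))).
Proof.
move=> mg g0; apply: measurable_iint => // d S a phi ma mphi.
by apply: (mg _ _ (cst tt)) => //; exact: measurable_upd.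
Qed.

Lemma le_iint n (f g : (nat -> R) -> \bar R) :
  cyl_measurable (fun _ : unit => f) -> cyl_measurable (fun _ : unit => g) ->
  (forall x, 0 <= f x <= g x)%E -> (iint n f <= iint n g)%E.
Proof.
move=> mf mg fg.
have f0 x : (0 <= f x)%E by case/andP: (fg x).
have g0 x : (0 <= g x)%E by case/andP: (fg x) => /le_trans; apply.
elim: n f g mf mg fg f0 g0 => [|n IH] f g mf mg fg f0 g0 /=.
  by case/andP: (fg (fun=> 0)).
apply: ge0_le_integral => //.
- by move=> t _; exact: iint_ge0.
- exact: measurable_iint_upd.
- exact: measurable_iint_upd.
- move=> t _; apply: IH => //.
  + exact: (cyl_measurable_upd1 n t mf).
  + exact: (cyl_measurable_upd1 n t mg).
Qed.

Lemma iintZ n (k : R) (g : (nat -> R) -> \bar R) : 0 <= k ->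
  cyl_measurable (fun _ : unit => g) -> (forall x, 0 <= g x)%E ->
  iint n (fun x => k%:E * g x)%E = (k%:E * iint n g)%E.
Proof.
move=> k0; elim: n g => [|n IH] g mg g0 //=.
rewrite -ge0_integralZl//; last 2 first.
- exact: measurable_iint_upd.
- by move=> t _; exact: iint_ge0.
by apply: eq_integral => t _; apply: IH => //; exact: (cyl_measurable_upd1 n t mg).
Qed.

(** Tonelli's theorem, applied to one coordinate at a time: the outermost coordinate is exchanged
    with [s], the induction hypothesis handles the others. *)
Lemma iint_integral_swap d0 (S0 : measurableType d0)
    (m : {sigma_finite_measure set S0 -> \bar R}) n (g : S0 -> (nat -> R) -> \bar R) :
  cyl_measurable g -> (forall s x, 0 <= g s x)%E ->
  (\int[m]_s iint n (g s) = iint n (fun x => \int[m]_s g s x))%E.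
Proof.
elim: n g => [|n IH] g mg g0 //=.
pose h (st : S0 * measurableTypeR R) := iint n (fun x => g st.1 (upd n st.2 x)).
have mh : measurable_fun setT h.
  by apply: measurable_iint => //; exact: cyl_measurable_upd.
have h0 st : (0 <= h st)%E by exact: iint_ge0.
rewrite (@fubini_tonelli _ _ _ _ _ m mu h mh h0).
by apply: eq_integral => t _; apply: IH => //; exact: (cyl_measurable_upd1 n t mg).
Qed.

(** By uniqueness of Lebesgue measure: [c] times its image under multiplication by [c] has the right
    value on half-open intervals. Only measurability of [f] is asked, as the Hardy integrands are
    singular. *)
Lemma ge0_integral_scale (c : R) (f : R -> \bar R) : 0 < c ->
  measurable_fun setT f -> (forall x, 0 <= f x)%E ->
  (\int[mu]_x f x = c%:E * \int[mu]_x f (c * x)%R)%E.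
Proof.
move=> c0 mf f0.
have mc : measurable_fun setT (fun x : measurableTypeR R => c * x : measurableTypeR R).
  exact: measurable_funM.
have c0' : (0 <= c%:E)%E by rewrite lee_fin ltW.
have mufE (A : set R) : measurable A ->
    mu A = mscale (NngNum (ltW c0)) (pushforward mu (fun x : measurableTypeR R => c * x : measurableTypeR R)) A.
  move=> mA; apply: lebesgue_measure_unique => // _ [[a b]] _ <-.
  transitivity (c%:E * mu ((fun x : R => (c * x)%R) @^-1` `]a, b]))%E; last by [].
  have -> : (fun x : R => c * x) @^-1` `]a, b] = `](a / c), (b / c)]%classic.
    apply/seteqP; split => x /=; rewrite !in_itv/= ltr_pdivrMr// ler_pdivlMr//;
      by rewrite [x * c]mulrC.
  rewrite !lebesgue_measure_itv/= !lte_fin ltr_pM2r ?invr_gt0//.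
  case: ifP => ab; last by rewrite mule0.
  by rewrite -!EFinD -EFinM mulrBr !(mulrCA c) divff ?gt_eqF// !mulr1.
rewrite (eq_measure_integral (mscale (NngNum (ltW c0)) (pushforward mu (fun x : measurableTypeR R => c * x : measurableTypeR R)))); last first.
  by move=> A mA _; exact: mufE.
by rewrite ge0_integral_mscale//= ge0_integral_pushforward.
Qed.

Lemma iint_scale n (c : nat -> R) (g : (nat -> R) -> \bar R) :
  (forall i, 0 < c i) ->
  cyl_measurable (fun _ : unit => g) -> (forall x, 0 <= g x)%E ->
  iint n g = ((\prod_(i < n) c i)%R%:E * iint n (fun x => g (fun i => c i * x i)%R))%E.
Proof.
move=> c0; elim: n g => [|n IH] g mg g0 /=.
  rewrite big_ord0 mul1e; congr g; apply/funext => i; by rewrite mulr0.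
have P0 : 0 <= \prod_(i < n) c i by apply: prodr_ge0 => i _; exact/ltW.
have mgc : cyl_measurable (fun _ : unit => fun x => g (fun i => c i * x i)).
  move=> d S a phi ma mphi; apply: (mg _ _ a) => // i; exact: measurable_funM.
rewrite (ge0_integral_scale (c0 n)); last 2 first.
- exact: (measurable_iint_upd n mg g0).
- by move=> t; exact: iint_ge0.
rewrite big_ord_recr/= mulrC EFinM -muleA; congr (_ * _)%E.
rewrite -ge0_integralZl//; last 2 first.
- exact: (measurable_iint_upd n mgc).
- by move=> t _; exact: iint_ge0.
apply: eq_integral => t _; rewrite IH//; last exact: (cyl_measurable_upd1 n _ mg).
congr (_ * iint n _)%E; apply/funext => x; congr g; apply/funext => i.
by case: eqP => // ->.
Qed.

(** Cubes are the comparison sets in the optimality part, for finiteness of the right side and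
    positivity of the left side. *)
Lemma iint_box n (K : R) (A : set R) : 0 <= K -> measurable A ->
  iint n (fun x => (K * \prod_(i < n) \1_A (x i))%:E) = (K%:E * mu A ^+ n)%E.
Proof.
move=> + mA; elim: n K => [|n IH] K K0; first by rewrite /= big_ord0 mulr1 mule1.
have m0 : (0 <= mu A ^+ n)%E by exact: expe_ge0.
rewrite expeS; transitivity (\int[mu]_t (K%:E * (\1_A t)%:E * mu A ^+ n))%E.
  apply: eq_integral => t _; rewrite -EFinM -IH ?mulr_ge0//.
  congr iint; apply/funext => x; congr EFin.
  rewrite big_ord_recr/= eqxx mulrA mulrAC; congr (_ * _ * _).
  by apply: eq_bigr => i _; rewrite ltn_eqF.
rewrite ge0_integralZr//.
- rewrite ge0_integralZl//; last exact/measurable_EFinP.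
  by rewrite integral_indic// setIT muleA.
- apply: emeasurable_funM => //; exact/measurable_EFinP.
- by move=> t _; rewrite mule_ge0// lee_fin.
Qed.

End iterated_integral.

(** * Continuous functions of a row with measurable coordinates *)

Section measurable_row.
Context {R : realType} (N : nat) d (S : measurableType d).
Variables (h : 'rV[R]_N -> R) (phi : 'I_N -> S -> R).
Hypotheses (ch : continuous h) (mphi : forall i, measurable_fun setT (phi i)).

Let grid (k : nat) (z : 'rV[int]_N) : 'rV[R]_N := \row_i ((z 0 i)%:~R / k.+1%:R).

Let code k s : 'rV[int]_N := \row_i Num.floor (phi i s * k.+1%:R).

Let measurable_code k z : measurable [set s | code k s = z].
Proof.
have -> : [set s | code k s = z] =
    \bigcap_(i in [set: 'I_N]) (setT `&` (fun s => phi i s * k.+1%:R) @^-1` `[(z 0 i)%:~R, (z 0 i + 1)%:~R[).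
  apply/seteqP; split => s /=.
    move=> <- i _; split => //=.
    by rewrite in_itv/= mxE; apply/andP; split; [exact: floor_le|exact: floorD1_gt].
  move=> H; apply/rowP => i; rewrite mxE; case: (H i I) => _ /=.
  by rewrite in_itv/= => /floor_def.
apply: fin_bigcap_measurable => // i _.
have : measurable_fun setT (fun s => phi i s * k.+1%:R) by exact: measurable_funM.
by apply.
Qed.

(* [h] is the pointwise limit of its values on the grids of mesh [1/(k+1)],
   each of which is a countably-valued function of [s]. *)
Lemma measurable_fun_row : measurable_fun setT (fun s => h (\row_i phi i s)).
Proof.
pose hk (k : nat) s := h (grid k (code k s)).
apply: (@measurable_fun_cvg _ _ _ _ hk) => [k|s _].
  move=> _ Y mY; rewrite setTI.
  have -> : hk k @^-1` Y = \bigcup_(z : 'rV[int]_N)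
     [set s | code k s = z /\ Y (h (grid k z))].
    apply/seteqP; split => s /=; first by move=> Ys; exists (code k s).
    by case=> z _ [<-].
  apply: countable_bigcupT_measurable => [|z]; first exact: countableP.
  have [Yz|Yz] := pselect (Y (h (grid k z))).
    rewrite (_ : [set _ | _] = [set s | code k s = z]); first exact: measurable_code.
    by apply/seteqP; split => s //= -[].
  rewrite (_ : [set _ | _] = set0)//.
  by apply/seteqP; split => s //= -[].
apply: (@continuous_cvg _ _ _ _ _ _ h); first exact: ch.
apply/cvgrPdist_le => e e0; near=> k.
rewrite /Num.norm/= mx_normrE; apply: bigmax_le => [|[i j] _]; first exact: ltW.
rewrite !mxE/= ler_norml.
have k0 : (0 : R) < k.+1%:R by rewrite ltr0n.
have ke : k.+1%:R^-1 <= e by apply: ltW; near: k; exact: near_infty_natSinv_lt (PosNum e0).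
have [f1 f2] : (Num.floor (phi j s * k.+1%:R))%:~R <= phi j s * k.+1%:R /\
    phi j s * k.+1%:R < (Num.floor (phi j s * k.+1%:R))%:~R + 1.
  by split; [exact: floor_le|rewrite -[1]/(1%:~R) -intrD; exact: floorD1_gt].
have : 0 <= phi j s - (Num.floor (phi j s * k.+1%:R))%:~R / k.+1%:R <= k.+1%:R^-1.
  rewrite subr_ge0 ler_pdivrMr// f1/= lerBlDr -[X in _ <= X + _]div1r -mulrDl.
  by rewrite ler_pdivlMr// addrC ltW.
case/andP => g1 g2; rewrite (le_trans g2 ke) andbT (le_trans _ g1)// oppr_le0.
exact: ltW.
Unshelve. all: by end_near. Qed.

End measurable_row.

(** * The one-dimensional Hardy inequality *)

Section powR_calculus.
Context {R : realType}.
Implicit Types (p q x : R).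

Lemma continuous_powR_gt0 q x : 0 < x -> {for x, continuous (fun y => y `^ q)}.
Proof.
move=> x0; apply: differentiable_continuous; apply/derivable1_diffP.
by apply: derivable_powR; rewrite in_itv/= x0.
Qed.

Lemma continuous_normr_powR q : 0 < q -> continuous (fun y : R => `|y| `^ q).
Proof.
move=> q0 x; have [->|x0] := eqVneq x 0.
  rewrite /continuous_at normr0 powR0 ?gt_eqF//; apply/cvgrPdist_lt => e e0.
  have eq0 : 0 < e `^ q^-1 by rewrite powR_gt0.
  have H : \forall y \near (0:R), `|y| < e `^ q^-1.
    near=> y; rewrite -[y]subr0 distrC; near: y.
    exact: nbhsx_ballx eq0.
  near=> y; rewrite sub0r normrN ger0_norm ?powR_ge0//.
  have -> : e = (e `^ q^-1) `^ q by rewrite -powRrM mulVf ?gt_eqF// powRr1// ltW.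
  apply: gt0_ltr_powR => //; rewrite ?nnegrE ?powR_ge0//.
apply: (@continuous_comp _ _ _ (@Num.norm _ R) (fun y => y `^ q)).
  exact: norm_continuous.
by apply: continuous_powR_gt0; rewrite normr_gt0.
Unshelve. all: by end_near. Qed.

Lemma near_sgr x : x != 0 -> \forall y \near x, Num.sg y = Num.sg x.
Proof.
move=> x0; have [x0'|x0'] := ltP 0 x.
  by apply: filterS (lt_nbhsr x0') => y y0; rewrite !gtr0_sg.
have xn : x < 0 by rewrite lt_neqAle x0.
by apply: filterS (lt_nbhsl xn) => y y0; rewrite !ltr0_sg.
Qed.

Lemma continuous_sgr_powR q : 0 < q -> continuous (fun y : R => Num.sg y * `|y| `^ q).
Proof.
move=> q0 x; have [->|x0] := eqVneq x 0.
  rewrite /continuous_at sgr0 mul0r; apply/norm_cvg0P.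
  have := continuous_normr_powR q0 (x := 0).
  rewrite /continuous_at normr0 powR0 ?gt_eqF//; apply: cvg_trans.
  apply: near_eq_cvg; near=> y; rewrite normrM normr_sg.
  have [->|] := eqVneq y 0; first by rewrite normr0 powR0 ?gt_eqF// mul0r.
  by rewrite mul1r ger0_norm ?powR_ge0.
have : (Num.sg x * `|y| `^ q) @[y --> x] --> Num.sg x * `|x| `^ q.
  by apply: cvgMr; exact: continuous_normr_powR.
apply: cvg_trans; apply: near_eq_cvg.
by apply: filterS (near_sgr x0) => y /= ->.
Unshelve. all: by end_near. Qed.

(** At 0 the difference quotient has absolute value $|h|^{p-1}$, which tends to 0 because $p > 1$;
    elsewhere the sign is locally constant. *)
Lemma is_derive_normr_powR p x : 1 < p ->
  is_derive x 1 (fun y : R => `|y| `^ p) (p * (Num.sg x * `|x| `^ (p - 1))).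
Proof.
move=> p1; have p0 : 0 < p by exact: lt_trans p1.
have q0 : 0 < p - 1 by rewrite subr_gt0.
have [->|x0] := eqVneq x 0.
  rewrite sgr0 mul0r mulr0.
  have H : (fun h : R => h^-1 *: (((fun y : R => `|y| `^ p) \o shift (0:R)) (h *: (1:R)) - `|0 : R| `^ p))
      @ 0^' --> (0 : R).
    apply/norm_cvg0P.
    have := (continuous_withinNx _ _).1 (continuous_normr_powR q0 (x := 0)).
    rewrite normr0 powR0 ?gt_eqF//.
    apply: cvg_trans; apply: near_eq_cvg; near=> h => /=.
    have h0 : h != 0 by near: h; exact: nbhs_dnbhs_neq.
    rewrite powR0 ?gt_eqF// subr0 addr0 /GRing.scale/= mulr1 normrM normfV.
    rewrite (ger0_norm (powR_ge0 _ _)) -(mulr_powRB1 (normr_ge0 h) p0) mulrA.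
    by rewrite mulVf ?mul1r// normr_eq0.
  by apply: DeriveDef; [apply/cvg_ex; exists 0|exact/cvg_lim].
have dn : is_derive x 1 (fun y : R => Num.sg x * y) (Num.sg x).
  by have := is_deriveZ (Num.sg x) (is_derive_id x (1:R)); rewrite /GRing.scale/= mulr1.
have sx0 : 0 < Num.sg x * x by rewrite -normrEsg normr_gt0.
have := is_derive1_comp (is_derive1_powR p sx0) dn.
rewrite -normrEsg mulrAC -mulrA => /(near_eq_is_derive _); apply.
apply: filterS (near_sgr x0) => y /= <-; by rewrite -normrEsg.
Unshelve. all: by end_near. Qed.
End powR_calculus.

Section hardy_pointwise.
Context {R : realType}.
Implicit Types (p g l : R).

(** Young's inequality for $c^{-1} b$ and $c\,a^{p-1}$ with $c = l^{(p-1)/p}$. Equality holds at $b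
    = l a$; the weight [l] is there to place the equality case where the extremal needs it. *)
Lemma young_powR p l a b : 1 < p -> 0 < l -> 0 <= a -> 0 <= b ->
  p * (a `^ (p - 1) * b) <= (p - 1) * l * a `^ p + l `^ (1 - p) * b `^ p.
Proof.
move=> p1 l0 a0 b0.
have p0 : 0 < p by exact: lt_trans p1.
have q0 : 0 < p - 1 by rewrite subr_gt0.
have pn0 : p != 0 by rewrite gt_eqF.
have qn0 : p - 1 != 0 by rewrite gt_eqF.
have ln0 : l != 0 by rewrite gt_eqF.
pose c := l `^ ((p - 1) / p).
have cV : l `^ ((1 - p) / p) = c^-1 by rewrite /c -powRN -mulNr opprB.
have c0 : c != 0 by rewrite gt_eqF// powR_gt0.
have conj : p^-1 + (p / (p - 1))^-1 = 1.
  by rewrite invf_div -{1}[p^-1]mul1r -mulrDl addrC subrK divff.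
have := @conjugate_powR _ (c^-1 * b) (c * a `^ (p - 1)) p (p / (p - 1)) _ _ p0 _ conj.
have -> : c^-1 * b * (c * a `^ (p - 1)) = a `^ (p - 1) * b by field.
rewrite -cV mulr_ge0 ?powR_ge0// mulr_ge0 ?powR_ge0// divr_gt0// => /(_ isT isT isT).
rewrite !powRM ?powR_ge0// -!powRrM.
rewrite (_ : (1 - p) / p * p = 1 - p); last by rewrite mulfVK.
rewrite (_ : (p - 1) / p * (p / (p - 1)) = 1); last by rewrite mulrA mulfVK// divff.
rewrite (_ : (p - 1) * (p / (p - 1)) = p); last by rewrite mulrC mulfVK.
rewrite (powRr1 (ltW l0)) => H.
have := ler_wpM2l (ltW p0) H; move/le_trans; apply.
rewrite le_eqVlt; apply/orP; left; apply/eqP; field.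
by rewrite pn0 qn0.
Qed.

(* The weights are those of the substitution [w = |log|], [v = |w'|]. *)
Lemma hardy_pointwise p g (h d w v : R) : 1 < p -> 1 < g -> 0 <= h -> 0 < w -> 0 < v ->
  (g - 1) / p * (h `^ p * w `^ (- g) * v) + p * (h `^ (p - 1) * `|d| * w `^ (1 - g))
   <= ((g - 1) / p) `^ (1 - p) * (`|d| `^ p * w `^ (p - g) * v `^ (1 - p))
      + (g - 1) * (h `^ p * w `^ (- g) * v).
Proof.
move=> p1 g1 h0 w0 v0; set l := (g - 1) / p.
have p0 : 0 < p by exact: lt_trans p1.
have pn0 : p != 0 by rewrite gt_eqF.
have vn0 : v != 0 by rewrite gt_eqF.
have wn0 : w != 0 by rewrite gt_eqF.
have l0 : 0 < l by rewrite divr_gt0// subr_gt0.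
have gE : g - 1 = p * l by rewrite /l mulrC mulfVK.
clearbody l.
(* Equality in this instance means $|d| = l h v / w$. As $v = |w'|$, this is solved by $h = w^l$
   with $l = (\gamma-1)/p$, the extremal used for optimality. *)
have := @young_powR p l h (`|d| * w / v) p1 l0 h0.
rewrite !mulr_ge0 ?invr_ge0 ?(ltW w0) ?(ltW v0)// => /(_ isT) Y.
have W0 : 0 <= w `^ (- g) * v by rewrite mulr_ge0 ?powR_ge0// ltW.
have {Y} := ler_wpM2r W0 Y.
have -> : w `^ (1 - g) = w `^ (- g) * w.
  by rewrite powRD ?wn0 ?implybT// powRr1 ?ltW// mulrC.
have -> : w `^ (p - g) = w `^ p * w `^ (- g) by rewrite powRD ?wn0 ?implybT.
have -> : v `^ (1 - p) = v / v `^ p by rewrite powRB ?vn0 ?implybT// powRr1// ltW.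
rewrite !powRM ?mulr_ge0 ?invr_ge0 ?(ltW w0) ?(ltW v0)//.
have -> : v^-1 `^ p = (v `^ p)^-1.
  by rewrite -powR_inv1 ?ltW// -powRrM mulN1r powRN.
have vp0 : v `^ p != 0 by rewrite gt_eqF// powR_gt0.
move: (h `^ (p - 1)) (h `^ p) (w `^ (- g)) (l `^ (1 - p)) (`|d| `^ p) (w `^ p) (v `^ p) vp0.
move=> A B C D E F G G0 H.
rewrite gE -subr_ge0; rewrite -subr_ge0 in H; apply: le_trans H _.
rewrite le_eqVlt; apply/orP; left; apply/eqP; field.
by rewrite vn0 G0.
Qed.

End hardy_pointwise.

Section hardy_line.
Context {R : realType}.
Local Notation mu := (@lebesgue_measure R).
Variables (p g : R).
Hypotheses (p1 : 1 < p) (g1 : 1 < g).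
Let l := (g - 1) / p.

Let p0 : 0 < p. Proof. exact: lt_trans p1. Qed.
Let l0 : 0 < l. Proof. by rewrite divr_gt0// subr_gt0. Qed.

Definition hardyL (h w v : R -> R) u := `|h u| `^ p * w u `^ (- g) * v u.
Definition hardyR (dh w v : R -> R) u := `|dh u| `^ p * w u `^ (p - g) * v u `^ (1 - p).

Lemma hardyL_ge0 h w v u : 0 <= v u -> 0 <= hardyL h w v u.
Proof. by move=> v0; rewrite !mulr_ge0 ?powR_ge0. Qed.

Lemma hardyR_ge0 dh w v u : 0 <= hardyR dh w v u.
Proof. by rewrite !mulr_ge0 ?powR_ge0. Qed.

Section segment.
Variables (s a b : R) (h dh w v : R -> R).
Hypotheses (s1 : s = 1 \/ s = -1) (ab : a < b).
Hypothesis hh : forall u, u \in `[a, b] -> is_derive u 1 h (dh u).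
Hypothesis hw : forall u, u \in `[a, b] -> is_derive u 1 w (s * v u).
Hypothesis w0 : forall u, u \in `[a, b] -> 0 < w u.
Hypothesis v0 : forall u, u \in `[a, b] -> 0 < v u.
Hypothesis cdh : forall u, u \in `[a, b] -> {for u, continuous dh}.
Hypothesis cv : forall u, u \in `[a, b] -> {for u, continuous v}.

(** The boundary function of the integration by parts. The sign [s] is the direction in which [w]
    varies, so that [v] is positive on both sides of the zero of the logarithm; in [s * dPhi] the
    derivative of the weight contributes exactly [- (g - 1) * hardyL]. *)
Let Phi u := `|h u| `^ p * w u `^ (1 - g).
Let dPhi u := p * (Num.sg (h u) * `|h u| `^ (p - 1)) * dh u * w u `^ (1 - g) +
              `|h u| `^ p * ((1 - g) * w u `^ (- g) * (s * v u)).

Let is_derive_Phi u : u \in `[a, b] -> is_derive u 1 Phi (dPhi u).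
Proof.
move=> uab.
have d1 := is_derive1_comp (is_derive_normr_powR (h u) p1) (hh uab).
have d2 := is_derive1_comp (is_derive1_powR (1 - g) (w0 uab)) (hw uab).
have := is_deriveM d1 d2.
rewrite /GRing.scale/= (_ : 1 - g - 1 = - g); last by lra.
by move=> H; apply: (is_derive_eq H); rewrite /dPhi /=; ring.
Qed.

Let ch u : u \in `[a, b] -> {for u, continuous h}.
Proof.
move=> /hh[+ _] => /derivable1_diffP; exact: differentiable_continuous.
Qed.

Let cw u : u \in `[a, b] -> {for u, continuous w}.
Proof.
move=> /hw[+ _] => /derivable1_diffP; exact: differentiable_continuous.
Qed.

Let cwp q u : u \in `[a, b] -> {for u, continuous (fun x => w x `^ q)}.
Proof.
move=> uab; apply: (@continuous_comp _ _ _ w (fun y => y `^ q)); first exact: cw.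
exact/continuous_powR_gt0/w0.
Qed.

Let chp u : u \in `[a, b] -> {for u, continuous (fun x => `|h x| `^ p)}.
Proof.
move=> uab; apply: (@continuous_comp _ _ _ h (fun y => `|y| `^ p)); first exact: ch.
exact: continuous_normr_powR.
Qed.

Let cdPhi u : u \in `[a, b] -> {for u, continuous dPhi}.
Proof.
move=> uab; have q0 : 0 < p - 1 by rewrite subr_gt0.
apply: cvgD; last first.
  apply: cvgM; first exact: chp.
  apply: cvgM; first by apply: cvgMr; exact: cwp.
  by apply: cvgMr; exact: cv.
apply: cvgM; last exact: cwp.
apply: cvgM; last exact: cdh.
apply: cvgMr.
apply: (@continuous_comp _ _ _ h (fun y => Num.sg y * `|y| `^ (p - 1))); first exact: ch.
exact: continuous_sgr_powR.
Qed.

Lemma continuous_hardyL u : u \in `[a, b] -> {for u, continuous (hardyL h w v)}.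
Proof.
move=> uab; apply: cvgM; last exact: cv.
by apply: cvgM; [exact: chp|exact: cwp].
Qed.

Lemma continuous_hardyR u : u \in `[a, b] -> {for u, continuous (hardyR dh w v)}.
Proof.
move=> uab; apply: cvgM; last first.
  apply: (@continuous_comp _ _ _ v (fun y => y `^ (1 - p))); first exact: cv.
  exact/continuous_powR_gt0/v0.
apply: cvgM; last exact: cwp.
apply: (@continuous_comp _ _ _ dh (fun y => `|y| `^ p)); first exact: cdh.
exact: continuous_normr_powR.
Qed.

Let hardy_Phi u : u \in `[a, b] ->
  l * hardyL h w v u + s * dPhi u <= l `^ (1 - p) * hardyR dh w v u.
Proof.
move=> uab.
have := hardy_pointwise (dh u) p1 g1 (normr_ge0 (h u)) (w0 uab) (v0 uab).
rewrite -/l -/(hardyL h w v u) -/(hardyR dh w v u) => H.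
have ss : s * s = 1 by case: s1 => ->; rewrite ?mulrNN mulr1.
have sn : `|s| = 1 by case: s1 => ->; rewrite ?normrN normr1.
have -> : s * dPhi u = s * (p * (Num.sg (h u) * `|h u| `^ (p - 1)) * dh u * w u `^ (1 - g)) -
     (g - 1) * hardyL h w v u.
  rewrite /dPhi /hardyL mulrDr; congr (_ + _).
  rewrite (_ : s * (_ * _) = s * s * (`|h u| `^ p * ((1 - g) * w u `^ (- g) * v u))); last by ring.
  by rewrite ss; ring.
rewrite addrA lerBlDr; apply: le_trans H; rewrite lerD2l.
apply: le_trans (ler_norm _) _; rewrite !normrM sn mul1r (ger0_norm (ltW p0)).
rewrite !(ger0_norm (powR_ge0 _ _)) -!mulrA ler_pM2l// !mulrA.
rewrite ler_wpM2r ?powR_ge0// ler_wpM2r// ler_piMl ?powR_ge0//.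
by rewrite normr_sg; case: (_ != 0).
Qed.

Let integrable_seg (f : R -> R) : (forall u, u \in `[a, b] -> {for u, continuous f}) ->
  mu.-integrable `[a, b] (EFin \o f).
Proof.
move=> cf; apply: continuous_compact_integrable; first exact: segment_compact.
by apply: continuous_in_subspaceT => u; rewrite inE => /= uab; exact: cf.
Qed.

Lemma hardy_segment :
  (l%:E * \int[mu]_(u in `[a, b]) (hardyL h w v u)%:E <=
   (l `^ (1 - p))%:E * \int[mu]_(u in `[a, b]) (hardyR dh w v u)%:E +
   (s * (Phi a - Phi b))%:E)%E.
Proof.
have iL := integrable_seg continuous_hardyL.
have iR := integrable_seg continuous_hardyR.
have idP := integrable_seg cdPhi.
have FTC : (\int[mu]_(u in `[a, b]) (dPhi u)%:E = (Phi b)%:E - (Phi a)%:E)%E.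
  apply: continuous_FTC2 => //.
  - by apply: continuous_in_subspaceT => u; rewrite inE => /= uab; exact: cdPhi.
  - have cPhi u : u \in `[a, b] -> {for u, continuous Phi}.
      move=> uab; apply: differentiable_continuous; apply/derivable1_diffP.
      by have [] := is_derive_Phi uab.
    split.
    + move=> u uab; have [|//] := @is_derive_Phi u.
      exact: subset_itv_oo_cc uab.
    + apply: cvg_at_right_filter; apply: cPhi; rewrite in_itv/= lexx ltW//.
    + apply: cvg_at_left_filter; apply: cPhi; rewrite in_itv/= lexx ltW//.
  - move=> u uab; rewrite derive1E; have [|//] := @is_derive_Phi u.
    exact: subset_itv_oo_cc uab.
have : (\int[mu]_(u in `[a, b]) (l%:E * (hardyL h w v u)%:E + s%:E * (dPhi u)%:E) <=
        \int[mu]_(u in `[a, b]) ((l `^ (1 - p))%:E * (hardyR dh w v u)%:E))%E.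
  apply: le_integral => //.
  - by apply: integrableD => //; apply: integrableZl.
  - by apply: integrableZl.
  - by move=> u; rewrite inE/= => uab; rewrite -!EFinM -EFinD lee_fin hardy_Phi.
rewrite integralD//; [|exact: integrableZl..].
rewrite !integralZl// FTC -EFinB -EFinM => H.
rewrite -[X in (X <= _)%E](@subeK _ _ (s * (Phi b - Phi a))%:E)//.
rewrite (_ : s * (Phi a - Phi b) = - (s * (Phi b - Phi a))); last by ring.
rewrite EFinN addeAC leeD2r//.
Qed.

End segment.

Let K := (p / (g - 1)) `^ p.

(** Dividing the segment inequality by [l] turns its factor $l^{1-p}$ into $l^{-p}$, the [p]-th
    power of the claimed constant. *)
Let KE : l^-1 * l `^ (1 - p) = K.
Proof.
have ln0 : l != 0 by rewrite gt_eqF.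
rewrite powRB ?ln0 ?implybT// powRr1 ?(ltW l0)// mulKf// /K -[p / _]invf_div -/l.
by rewrite -[l^-1]powR_inv1 ?(ltW l0)// -powRrM mulN1r powRN.
Qed.

(* Integrating over an exhaustion by segments keeps the inequality as long as
   the boundary terms vanish in the limit. *)
Lemma hardy_exhaustion (s : R) (D : set R) (a b e : nat -> R) (h dh w v : R -> R) :
  s = 1 \/ s = -1 -> open D -> D = \bigcup_k `[a k, b k]%classic ->
  {homo (fun k => `[a k, b k]%classic) : n m / (n <= m)%N >-> (n <= m)%O} ->
  (forall k, a k < b k) ->
  (forall u, D u -> is_derive u 1 h (dh u)) ->
  (forall u, D u -> is_derive u 1 w (s * v u)) ->
  (forall u, D u -> 0 < w u) -> (forall u, D u -> 0 < v u) ->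
  (forall u, D u -> {for u, continuous dh}) -> (forall u, D u -> {for u, continuous v}) ->
  e k @[k --> \oo] --> 0 ->
  (forall k, s * (`|h (a k)| `^ p * w (a k) `^ (1 - g) -
                  `|h (b k)| `^ p * w (b k) `^ (1 - g)) <= e k) ->
  (\int[mu]_(u in D) (hardyL h w v u)%:E <=
   K%:E * \int[mu]_(u in D) (hardyR dh w v u)%:E)%E.
Proof.
move=> s1 oD DE nd ab hh hw w0 v0 cdh cv e0 Pe.
have sub k u : u \in `[a k, b k] -> D u by rewrite DE => uab; exists k.
have mD : measurable D by exact: open_measurable.
have cL u : D u -> {for u, continuous (hardyL h w v)}.
  rewrite DE => -[k _ /= uk]; apply: (@continuous_hardyL s (a k) (b k) h dh w v) => //.
  - by move=> x /sub; exact: hh.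
  - by move=> x /sub; exact: hw.
  - by move=> x /sub; exact: w0.
  - by move=> x /sub; exact: cv.
have cR u : D u -> {for u, continuous (hardyR dh w v)}.
  rewrite DE => -[k _ /= uk]; apply: (@continuous_hardyR s (a k) (b k) dh w v) => //.
  - by move=> x /sub; exact: hw.
  - by move=> x /sub; exact: w0.
  - by move=> x /sub; exact: v0.
  - by move=> x /sub; exact: cdh.
  - by move=> x /sub; exact: cv.
have mL : measurable_fun D (EFin \o hardyL h w v).
  apply/measurable_EFinP; apply: open_continuous_measurable_fun => // u.
  by rewrite inE => Du; exact: cL.
have mR : measurable_fun D (EFin \o hardyR dh w v).
  apply/measurable_EFinP; apply: open_continuous_measurable_fun => // u.
  by rewrite inE => Du; exact: cR.
have sub' k : `[a k, b k]%classic `<=` D by move=> u /sub.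
set IL := (\int[mu]_(u in D) _)%E; set IR := (\int[mu]_(u in D) _)%E.
have IR0 : (0 <= IR)%E by apply: integral_ge0 => u _; rewrite lee_fin hardyR_ge0.
suff : (l%:E * IL <= (l `^ (1 - p))%:E * IR)%E.
  move=> H; have := lee_wpmul2l (_ : 0 <= (l^-1)%:E)%E H.
  rewrite lee_fin invr_ge0 (ltW l0) => /(_ isT).
  by rewrite !muleA -!EFinM mulVf ?gt_eqF// mul1e KE.
(* An infinite right side leaves nothing to prove; a finite one can be added to the vanishing error
   [e k] in the limit. *)
have [->|IRy] := eqVneq IR +oo%E.
  by rewrite gt0_muley ?leey// lte_fin powR_gt0.
have IRfin : IR \is a fin_num by rewrite ge0_fin_numE// ltey.
have cvL : (l%:E * \int[mu]_(u in `[a k, b k]) (hardyL h w v u)%:E)%E @[k --> \oo] -->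
    (l%:E * IL)%E.
  apply: cvgeZl => //; rewrite /IL DE.
  apply: ge0_nondecreasing_set_cvg_integral => //.
    by move=> k; apply: measurable_funS mL => //; exact: sub'.
  by move=> k u /sub Du; rewrite lee_fin hardyL_ge0// ltW// v0.
have cvR : ((l `^ (1 - p))%:E * IR + (e k)%:E)%E @[k --> \oo] --> ((l `^ (1 - p))%:E * IR)%E.
  rewrite -[X in _ --> X]adde0; apply: cvgeD => //.
  - by rewrite fin_num_adde_defl.
  - exact: cvg_cst.
  - by apply: cvg_EFin => //; exact: nearW.
apply: (lee_cvg_to cvL cvR); apply: nearW => k.
apply: le_trans (@hardy_segment s (a k) (b k) h dh w v _ _ _ _ _ _ _ _) _ => //.
- by move=> x /sub; exact: hh.
- by move=> x /sub; exact: hw.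
- by move=> x /sub; exact: w0.
- by move=> x /sub; exact: v0.
- by move=> x /sub; exact: cdh.
- by move=> x /sub; exact: cv.
apply: leeD; last by rewrite lee_fin.
rewrite lee_wpmul2l ?lee_fin ?powR_ge0//.
apply: ge0_subset_integral => //; first by move=> u _; rewrite lee_fin hardyR_ge0.
Qed.

(** Write the term as $|h/\omega|^p\,|\omega|^{p+1-\gamma}$. Both functions vanish at [u0] and [om]
    has nonzero derivative, so the quotient tends to [d / v]; the second factor tends to 0 precisely
    because $\gamma - 1 < p$. *)
Lemma hardy_boundary_cvg (u0 : R) (h om : R -> R) (d v : R) (t : nat -> R) :
  g - 1 < p -> is_derive u0 1 h d -> is_derive u0 1 om v -> v != 0 ->
  h u0 = 0 -> om u0 = 0 ->
  (forall k, om (t k + u0) != 0) -> (forall k, t k != 0) -> t k @[k --> \oo] --> 0 ->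
  (`|h (t k + u0)| `^ p * `|om (t k + u0)| `^ (1 - g)) @[k --> \oo] --> (0 : R).
Proof.
move=> gp dh dom v0 h0 om0 omt t0 tt.
have quot (f : R -> R) (df : R) : is_derive u0 1 f df -> f u0 = 0 ->
    ((t k)^-1 * f (t k + u0)) @[k --> \oo] --> df.
  move=> [df1 <-] f0; have := (cvgr_dnbhsP _ 0 _).1 df1 t (conj t0 tt).
  apply: cvg_trans; apply: near_eq_cvg; apply: nearW => k /=.
  by rewrite f0 subr0 /GRing.scale/= mulr1.
have q0 : 0 < p + 1 - g by lra.
have com : {for u0, continuous om}.
  by case: dom => /derivable1_diffP + _; exact: differentiable_continuous.
have tu : (t k + u0) @[k --> \oo] --> u0.
  by rewrite -[X in _ --> X]add0r; apply: cvgD => //; exact: cvg_cst.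
have comt : om (t k + u0) @[k --> \oo] --> (0 : R).
  by rewrite -om0; exact: (continuous_cvg _ com tu).
have c1 : `|om (t k + u0)| `^ (p + 1 - g) @[k --> \oo] --> (0 : R).
  have -> : (0 : R) = `|0 : R| `^ (p + 1 - g) by rewrite normr0 powR0 ?gt_eqF.
  exact: (continuous_cvg _ (continuous_normr_powR q0 (x := 0)) comt).
have c2 : ((t k)^-1 * h (t k + u0)) / ((t k)^-1 * om (t k + u0)) @[k --> \oo] --> d / v.
  by apply: cvgM; [exact: quot|apply: cvgV => //; exact: quot].
have c3 : `|((t k)^-1 * h (t k + u0)) / ((t k)^-1 * om (t k + u0))| `^ p @[k --> \oo]
    --> `|d / v| `^ p.
  exact: (continuous_cvg _ (continuous_normr_powR p0 (x := d / v)) c2).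
rewrite -(mulr0 (`|d / v| `^ p)); apply: cvg_trans (cvgM c3 c1); apply: near_eq_cvg.
apply: nearW => k /=; move: (omt k) (t0 k) => ok tk.
rewrite [X in `|X|](_ : _ = h (t k + u0) / om (t k + u0)); last by field; rewrite ok.
rewrite normrM normfV powRM ?invr_ge0// -mulrA; congr (_ * _).
rewrite -[X in X `^ p]powR_inv1// -powRrM mulN1r -powRD; first by congr (_ `^ _); ring.
by rewrite normr_eq0 ok implybT.
Qed.

(** The offset 3 gives [tau k < 2^-1], so that the segments exhausting either side of [u0] are
    nondegenerate already for [k = 0]. *)
Let tau (k : nat) : R := k.+3%:R^-1.

Let tau_gt0 k : 0 < tau k. Proof. by rewrite invr_gt0 ltr0n. Qed.

Let tau_lt k : tau k < 2^-1.
Proof. by rewrite ltf_pV2 ?posrE ?ltr0n// ltr_nat. Qed.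

Let le_tau n m : (n <= m)%N -> tau m <= tau n.
Proof. by move=> nm; rewrite lef_pV2 ?posrE ?ltr0n// ler_nat !ltnS. Qed.

Let cvg_tau : tau k @[k --> \oo] --> 0.
Proof.
have := @cvg_harmonic R; rewrite -(cvg_shiftn 2); apply: cvg_trans.
by apply: near_eq_cvg; apply: nearW => k /=; rewrite addn2.
Qed.

Let near_tau (x : R) : 0 < x -> \forall k \near \oo, tau k <= x.
Proof.
by move=> x0; apply: filterS (cvgr_lt _ cvg_tau _ x0) => k /ltW.
Qed.

Lemma measurable_halfline (f : R -> R) :
  (forall u : R, 0 < u -> {for u, continuous f}) -> measurable_fun (`]0, +oo[%classic : set R) f.
Proof.
move=> cf; apply: open_continuous_measurable_fun; first exact: interval_open.
by move=> u /set_mem/=; rewrite in_itv/= andbT; exact: cf.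
Qed.

Section measurability.
Variables (D : set R) (h om v : R -> R).
Hypotheses (mh : measurable_fun D h) (mom : measurable_fun D om) (mv : measurable_fun D v).

Let mpow q (f : R -> R) : measurable_fun D f -> measurable_fun D (fun x => f x `^ q).
Proof. by move=> mf; apply: (measurableT_comp (measurable_powR q)). Qed.

Let mabs (f : R -> R) : measurable_fun D f -> measurable_fun D (fun x => `|f x|).
Proof. by move=> mf; apply: measurableT_comp. Qed.

Lemma measurable_hardyL : measurable_fun D (fun u => (hardyL h (fun u => `|om u|) v u)%:E).
Proof.
apply/measurable_EFinP; apply: measurable_funM => //; apply: measurable_funM => //.
- exact: (mpow p (mabs mh)).
- exact: (mpow (- g) (mabs mom)).
Qed.

Lemma measurable_hardyR : measurable_fun D (fun u => (hardyR h (fun u => `|om u|) v u)%:E).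
Proof.
apply/measurable_EFinP; apply: measurable_funM; last exact: mpow.
apply: measurable_funM.
- exact: (mpow p (mabs mh)).
- exact: (mpow (p - g) (mabs mom)).
Qed.

End measurability.

Lemma hardy_halfline (u0 : R) (h dh om v : R -> R) : 0 < u0 -> g - 1 < p ->
  (forall u : R, 0 < u -> is_derive u 1 h (dh u)) ->
  (forall u : R, 0 < u -> is_derive u 1 om (v u)) ->
  (forall u : R, 0 < u -> 0 < v u) ->
  (forall u : R, 0 < u -> {for u, continuous dh}) ->
  (forall u : R, 0 < u -> {for u, continuous v}) ->
  h u0 = 0 -> om u0 = 0 ->
  (forall u : R, u0 < u -> 0 < om u) -> (forall u : R, 0 < u < u0 -> om u < 0) ->
  (\int[mu]_(u in `]0%R, +oo[) (hardyL h (fun u => `|om u|) v u)%:E <=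
   K%:E * \int[mu]_(u in `]0%R, +oo[) (hardyR dh (fun u => `|om u|) v u)%:E)%E.
Proof.
move=> u00 gp hh hom v0 cdh cv h0 om0 omp omn.
pose D : set R := `]0%R, +oo[%classic; pose D1 : set R := `]0%R, u0[%classic; pose D2 : set R := `]u0, +oo[%classic.
have DP u : D u <-> 0 < u by rewrite /D/= in_itv/= andbT.
have D1P u : D1 u <-> 0 < u < u0 by rewrite /D1/= in_itv/=.
have D2P u : D2 u <-> u0 < u by rewrite /D2/= in_itv/= andbT.
have mD : measurable D by exact: measurable_itv.
have cont (f : R -> R) (df u : R) : is_derive u 1 f df -> {for u, continuous f}.
  by case=> /derivable1_diffP + _; exact: differentiable_continuous.
have mh : measurable_fun D h by apply: measurable_halfline => u /hh; exact: cont.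
have mom : measurable_fun D om by apply: measurable_halfline => u /hom; exact: cont.
have mdh : measurable_fun D dh by exact: measurable_halfline.
have mv : measurable_fun D v by exact: measurable_halfline.
have mL := measurable_hardyL mh mom mv.
have mR := measurable_hardyR mdh mom mv.
have splitD (f : R -> \bar R) : measurable_fun D f -> (forall u, D u -> (0 <= f u)%E) ->
    (\int[mu]_(u in D) f u = \int[mu]_(u in D1) f u + \int[mu]_(u in D2) f u)%E.
  move=> mf f0.
  have DE : D = D1 `|` `[u0, +oo[%classic.
    apply/seteqP; split => u /=; rewrite !in_itv/= !andbT.
      by move=> /DP up; case: (ltP u u0) => uu0; [left; apply/D1P; rewrite up|right].
    by case=> [/D1P/andP[? _]|uu0]; apply/DP => //; exact: lt_le_trans uu0.
  rewrite DE ge0_integral_setU//=.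
  - congr (_ + _)%E; apply/esym; apply: integral_itv_obnd_cbnd.
    by apply: measurable_funS mf => // u /D2P uu0; apply/DP; exact: lt_trans uu0.
  - exact: measurable_itv.
  - by rewrite -DE.
  - by move=> u uD; apply: f0; rewrite DE.
  - apply/disj_setPS => u [/D1P/andP[_ u1]] /=.
    by rewrite in_itv/= andbT leNgt u1.
rewrite !splitD//; [|by move=> u /DP /v0 vu; rewrite lee_fin ?hardyR_ge0 ?hardyL_ge0 ?ltW..].
rewrite ge0_muleDr; [|by apply: integral_ge0 => u _; rewrite lee_fin hardyR_ge0..].
have omt u : 0 < u -> u != u0 -> om u != 0.
  move=> u0' uu0; have [ltu|gtu|eu] := ltgtP u u0.
  - by rewrite lt_eqF// omn// u0'.
  - by rewrite gt_eqF// omp.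
  - by rewrite eu eqxx in uu0.
apply: leeD.
- have -> : (\int[mu]_(u in D1) (hardyL h (fun u => `|om u|) v u)%:E)%E =
      (\int[mu]_(u in D1) (hardyL h (fun u => - om u) v u)%:E)%E.
    apply: eq_integral => u /set_mem/D1P/omn ou; congr (EFin (_ * _ `^ _ * _)).
    by rewrite ltr0_norm.
  have -> : (\int[mu]_(u in D1) (hardyR dh (fun u => `|om u|) v u)%:E)%E =
      (\int[mu]_(u in D1) (hardyR dh (fun u => - om u) v u)%:E)%E.
    apply: eq_integral => u /set_mem/D1P/omn ou; congr (EFin (_ * _ `^ _ * _)).
    by rewrite ltr0_norm.
  pose t k := - (u0 * tau k).
  have t0 k : t k < 0 by rewrite oppr_lt0 mulr_gt0.
  have tk k : 0 < t k + u0.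
    have := tau_lt k; rewrite /t => tk; nra.
  (* With [s = -1] the boundary term at the end near 0 has a favourable sign and is discarded; only
     the one near [u0] must vanish. No decay of [h] at 0 is required, and indeed $f - f_R$ need not
     vanish near the origin. *)
  apply: (@hardy_exhaustion (-1) D1 (fun k => u0 * tau k) (fun k => t k + u0)
    (fun k => `|h (t k + u0)| `^ p * `|om (t k + u0)| `^ (1 - g))).
  + by right.
  + exact: interval_open.
  + apply/seteqP; split => u.
      move=> /D1P/andP[u1 u2].
      have x1 : 0 < u / u0 by rewrite divr_gt0.
      have x2 : 0 < 1 - u / u0 by rewrite subr_gt0 ltr_pdivrMr// mul1r.
      have [k _ /(_ k (leqnn k))[]] := filterI (near_tau x1) (near_tau x2).
      rewrite ler_pdivlMr// => k1 k2; exists k => //=; rewrite in_itv/= mulrC k1/=.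
      move: k2; rewrite lerBrDr -lerBrDl ler_pdivrMr// /t => k2; nra.
    move=> [k _] /=; rewrite in_itv/= => /andP[u1 u2]; apply/D1P.
    rewrite (lt_le_trans _ u1) ?mulr_gt0//= (le_lt_trans u2)//.
    by rewrite gtrDr.
  + move=> n m /le_tau nm; apply/subsetPset => u /=; rewrite !in_itv/= /t => /andP[u1 u2].
    by apply/andP; split; nra.
  + by move=> k; have := tau_lt k; rewrite /t => tk'; nra.
  + by move=> u /D1P/andP[/hh].
  + move=> u /D1P/andP[/hom dom _]; rewrite mulN1r; exact: is_deriveN.
  + by move=> u /D1P/omn; rewrite oppr_gt0.
  + by move=> u /D1P/andP[/v0].
  + by move=> u /D1P/andP[/cdh].
  + by move=> u /D1P/andP[/cv].
  + apply: (hardy_boundary_cvg gp (hh _ u00) (hom _ u00)) => //.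
    * by rewrite gt_eqF// v0.
    * by move=> k; rewrite omt// lt_eqF// gtrDr.
    * by move=> k; rewrite lt_eqF.
    * rewrite -oppr0; apply: cvgN; rewrite -[X in _ --> X](mulr0 u0).
      by apply: cvgMr; exact: cvg_tau.
  + move=> k; rewrite mulN1r opprB [`|om _|]ltr0_norm; last by rewrite omn// tk gtrDr t0.
    by rewrite gerBl mulr_ge0 ?powR_ge0.
- have -> : (\int[mu]_(u in D2) (hardyL h (fun u => `|om u|) v u)%:E)%E =
      (\int[mu]_(u in D2) (hardyL h om v u)%:E)%E.
    apply: eq_integral => u /set_mem/D2P/omp ou; congr (EFin (_ * _ `^ _ * _)).
    by rewrite gtr0_norm.
  have -> : (\int[mu]_(u in D2) (hardyR dh (fun u => `|om u|) v u)%:E)%E =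
      (\int[mu]_(u in D2) (hardyR dh om v u)%:E)%E.
    apply: eq_integral => u /set_mem/D2P/omp ou; congr (EFin (_ * _ `^ _ * _)).
    by rewrite gtr0_norm.
  pose t k := u0 * tau k.
  have t0 k : 0 < t k by rewrite mulr_gt0.
  have tk k : 0 < t k + u0 by rewrite addr_gt0.
  have kt n m : (n <= m)%N -> (n.+3%:R : R) <= m.+3%:R by rewrite ler_nat !ltnS.
  have D2gt0 u : D2 u -> 0 < u by move=> /D2P; exact: lt_trans.
  (* Now [w] increases, and the discarded boundary term is the one at infinity. *)
  apply: (@hardy_exhaustion 1 D2 (fun k => t k + u0) (fun k => u0 * k.+3%:R)
    (fun k => `|h (t k + u0)| `^ p * `|om (t k + u0)| `^ (1 - g))).
  + by left.
  + exact: interval_open.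
  + apply/seteqP; split => u.
      move=> /D2P u1.
      have x1 : 0 < u / u0 - 1 by rewrite subr_gt0 ltr_pdivlMr// mul1r.
      have x2 : 0 < u0 / u by rewrite divr_gt0// (lt_trans u00).
      have [k _ /(_ k (leqnn k))[]] := filterI (near_tau x1) (near_tau x2).
      rewrite lerBrDr ler_pdivlMr// => k1 k2; exists k => //=; rewrite in_itv/=.
      have up : 0 < u by exact: lt_trans u1.
      apply/andP; split; first by rewrite /t; nra.
      move: k2; rewrite ler_pdivlMr// /tau mulrC ler_pdivrMr// ltr0n//.
    move=> [k _] /=; rewrite in_itv/= => /andP[u1 u2]; apply/D2P.
    by rewrite (lt_le_trans _ u1)// ltrDr.
  + move=> n m nm; have := le_tau nm; have := kt _ _ nm => k1 k2.
    apply/subsetPset => u /=; rewrite !in_itv/= /t => /andP[u1 u2].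
    by apply/andP; split; nra.
  + move=> k; have := tau_lt k; rewrite /t => tk'.
    have : (3 : R) <= k.+3%:R by rewrite ler_nat.
    by move=> k3; nra.
  + by move=> u /D2gt0/hh.
  + by move=> u /D2gt0/hom; rewrite mul1r.
  + by move=> u /D2P/omp.
  + by move=> u /D2gt0/v0.
  + by move=> u /D2gt0/cdh.
  + by move=> u /D2gt0/cv.
  + apply: (hardy_boundary_cvg gp (hh _ u00) (hom _ u00)) => //.
    * by rewrite gt_eqF// v0.
    * by move=> k; rewrite omt// gt_eqF// ltrDr.
    * by move=> k; rewrite gt_eqF.
    * rewrite -[X in _ --> X](mulr0 u0).
      by apply: cvgMr; exact: cvg_tau.
  + move=> k; rewrite mul1r [`|om _|]gtr0_norm; last by rewrite omp// ltrDr.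
    by rewrite gerBl mulr_ge0 ?powR_ge0.
Qed.

End hardy_line.

(** * Integration along dilation orbits *)

Section dilations.
Context {R : realType} (N : nat) (nu : 'I_N -> R).
Hypothesis nu0 : forall i, 0 < nu i.
Implicit Types (x : 'rV[R]_N) (f : 'rV[R]_N -> R).

(** The generator of the dilations. Unlike [radial] it does not involve the quasi-norm, hence it is
    continuous for smooth [f]; [radialE] relates the two. *)
Definition euler f x : R := \sum_i nu i * x 0 i * 'D_(delta_mx 0 i) f x.

Lemma dil_dil a b x : 0 <= a -> 0 <= b -> dil nu a (dil nu b x) = dil nu (a * b) x.
Proof.
by move=> a0 b0; apply/rowP => i; rewrite !mxE powRM// mulrA.
Qed.

Lemma dil1 x : dil nu 1 x = x.
Proof. by apply/rowP => i; rewrite !mxE powR1 mul1r. Qed.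

Lemma dilx0 a : dil nu a 0 = 0.
Proof. by apply/rowP => i; rewrite !mxE mulr0. Qed.

Lemma is_derive_comp_row f (c : R -> 'rV[R]_N) (dc : 'I_N -> R) (u : R) :
  differentiable f (c u) ->
  (forall i, is_derive u 1 (fun t => c t 0 i) (dc i)) ->
  is_derive u 1 (f \o c) (\sum_i dc i * 'D_(delta_mx 0 i) f (c u)).
Proof.
move=> df dcu.
have dc1 : derivable c u 1.
  by apply/derivable_mxP => i j; rewrite ord1; have [] := dcu j.
have dcE : 'D_1 c u = \row_i dc i.
  rewrite derive_mx//; apply/rowP => i; rewrite !mxE; by have [_ <-] := dcu i.
have difc : differentiable c u by exact/derivable1_diffP.
apply: DeriveDef.
  by apply/derivable1_diffP; exact: differentiable_comp.
rewrite deriveE; last exact: differentiable_comp.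
rewrite [LHS](_ : _ = 'd f (c u) ('d c u 1)); last by rewrite diff_comp.
rewrite -(deriveE _ difc) dcE.
rewrite {1}(row_sum_delta (\row_i dc i)) linear_sum/=.
apply: eq_bigr => i _; rewrite linearZ/= mxE deriveE//.
Qed.

(** The dilations form a one-parameter group in $\log\rho$, so [rho] enters through its logarithmic
    derivative only. *)
Lemma is_derive_dil f x (rho : R -> R) (drho u : R) :
  (forall y, differentiable f y) -> is_derive u 1 rho drho -> 0 < rho u ->
  is_derive u 1 (fun t => f (dil nu (rho t) x))
    (drho / rho u * euler f (dil nu (rho u) x)).
Proof.
move=> df dr r0.
have := @is_derive_comp_row f (fun t => dil nu (rho t) x)
  (fun i => drho / rho u * (nu i * dil nu (rho u) x 0 i)) u (df _).
rewrite (_ : \sum_i _ = drho / rho u * euler f (dil nu (rho u) x)); last first.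
  by rewrite /euler mulr_sumr; apply: eq_bigr => i _; rewrite !mulrA.
apply => i.
have d1 := is_derive1_comp (is_derive1_powR (nu i) r0) dr.
have := is_deriveZ (x 0 i) d1; rewrite /GRing.scale/=.
rewrite (_ : (fun t => dil nu (rho t) x 0 i) = x 0 i \*: (powR (R:=R) ^~ (nu i) \o rho)); last first.
  by apply/funext => t; rewrite !mxE/= /GRing.scale/= mulrC.
move=> H; apply: (is_derive_eq H); rewrite !mxE.
have rn0 : rho u != 0 by rewrite gt_eqF.
have -> : rho u `^ (nu i - 1) = rho u `^ nu i / rho u.
  by rewrite powRB ?rn0 ?implybT// powRr1 ?ltW.
by field.
Qed.

Lemma cvg_row T (F : set_system T) {FF : Filter F} (c : T -> 'rV[R]_N) (l : 'rV[R]_N) :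
  (forall i, c t 0 i @[t --> F] --> l 0 i) -> c t @[t --> F] --> l.
Proof.
move=> H; apply/cvgrPdist_le => e e0.
have : \forall t \near F, forall i, `|l 0 i - c t 0 i| <= e.
  apply: filter_forall => i; move/cvgrPdist_le: (H i); exact.
apply: filterS => t Ht; rewrite /Num.norm/= mx_normrE.
apply: bigmax_le => [|[i j] _]; first exact: ltW.
by rewrite !mxE/= ord1; exact: Ht.
Qed.

Lemma continuous_euler f : smooth f -> continuous (euler f).
Proof.
move=> sf; apply: continuous_big => [|i _ x]; first exact: add_continuous.
apply: (@continuousM _ _ (fun y : 'rV[R]_N => nu i * y 0 i) ('D_(delta_mx 0 i) f)).
  apply: (@continuousM _ _ (cst (nu i)) (fun y : 'rV[R]_N => y 0 i)).
    exact: cst_continuous.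
  exact: coord_continuous.
by apply: differentiable_continuous; exact: (sf [:: delta_mx 0 i]).
Qed.

Lemma radialE qn f x : (forall y, differentiable f y) -> (forall y, 0 <= qn y) ->
  (forall y, qn y = 0 <-> y = 0) -> radial nu qn f x = euler f x / qn x.
Proof.
move=> df q0 qz; rewrite /radial derive1E.
(* The origin is fixed by every dilation, so there the curve is constant, and the Euler field
   vanishes as well. *)
have [->|x0] := eqVneq x 0.
  rewrite (_ : (fun r => _) = cst (f 0)); last by apply/funext => r; rewrite dilx0.
  rewrite derive_cst /euler big1 ?mul0r// => i _; by rewrite mxE mulr0 mul0r.
have qx : 0 < qn x.
  by rewrite lt_neqAle q0 andbT eq_sym; apply: contra_neq x0 => /qz.
have dr : is_derive (qn x) 1 (fun r : R => r / qn x) (qn x)^-1.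
  rewrite (_ : (fun r => _) = (qn x)^-1 \*: id); last first.
    by apply/funext => r; rewrite /= /GRing.scale/= mulrC.
  by apply: is_derive_eq; rewrite /GRing.scale/= mulr1.
have := @is_derive_dil f x _ _ _ df dr; rewrite divff ?gt_eqF// ltr01 => /(_ isT)[_ ->].
by rewrite dil1 divr1 mulrC.
Qed.

End dilations.

(** * Polar coordinates with the last coordinate as radius *)

Section polar_coordinates.
Context {R : realType} (n : nat) (nu : 'I_n.+1 -> R).
Hypothesis nu0 : forall i, 0 < nu i.
Local Notation mu := (@lebesgue_measure R).
Local Notation nm := (nu ord_max).
Local Notation Q := (hom_dim nu).

(* [\row_i upd n s z i] is the point with last coordinate [s] and first
   coordinates [z]; [ray s z u] is the point of its dilation orbit with last
   coordinate [s * u]. *)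
Definition ray (s : R) (z : nat -> R) (u : R) : 'rV[R]_n.+1 :=
  dil nu (u `^ nm^-1) (\row_i upd n s z i).

Let rayseq (s : R) (z : nat -> R) (u : R) : nat -> R :=
  fun i => (u `^ nm^-1) `^ nu (inord i) * upd n s z i.

Let rayE s z u : ray s z u = \row_i rayseq s z u i.
Proof. by apply/rowP => i; rewrite !mxE /rayseq inord_val. Qed.

Lemma continuous_ray s z (u : R) : 0 < u -> {for u, continuous (ray s z)}.
Proof.
move=> up; apply: cvg_row => i.
have rE t : ray s z t 0 i = (t `^ nm^-1) `^ nu i * upd n s z i by rewrite !mxE.
have H : (t `^ nm^-1) `^ nu i * upd n s z i @[t --> u] -->
    (u `^ nm^-1) `^ nu i * upd n s z i.
  apply: cvgM; last exact: cvg_cst.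
  apply: (@continuous_comp _ _ _ (fun t : R => t `^ nm^-1) (fun t : R => t `^ nu i)).
    exact: continuous_powR_gt0.
  by apply: continuous_powR_gt0; rewrite powR_gt0.
have {}H : ray s z t 0 i @[t --> u] --> (u `^ nm^-1) `^ nu i * upd n s z i.
  by apply: cvg_trans H; apply: near_eq_cvg; apply: nearW => t; rewrite rE.
exact: (eq_ind _ (fun l : R => ray s z t 0 i @[t --> u] --> l) H _ (esym (rE u))).
Qed.

Lemma ge0_integral_halves (G : R -> \bar R) : measurable_fun setT G ->
  (forall t, 0 <= G t)%E ->
  (\int[mu]_t G t = \int[mu]_(t in `]0%R, +oo[) G t + \int[mu]_(t in `]0%R, +oo[) G (- t)%R)%E.
Proof.
move=> mG G0.
have mGN : measurable_fun setT (fun t : R => G (- t)).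
  by apply: measurableT_comp => //; exact: oppr_measurable.
have E : [set: R] = `]-oo, 0%R]%classic `|` `]0%R, +oo[%classic.
  apply/seteqP; split => // t _ /=; rewrite !in_itv/= andbT.
  by case: (leP t 0); [left|right].
rewrite E ge0_integral_setU//=; last 2 first.
- by rewrite -E.
- apply/disj_setPS => t [] /=; rewrite !in_itv/= andbT => t0.
  by rewrite ltNge t0.
rewrite addeC; congr (_ + _)%E.
rewrite integral_itv_obnd_cbnd; last exact: measurable_funTS.
rewrite ge0_integration_by_substitution0//.
by apply: eq_integral => t _; rewrite opprK.
Qed.

Variable F : 'rV[R]_n.+1 -> \bar R.
Hypotheses (mF : cyl_measurable (fun _ : unit => fun x => F (\row_i x i)))
  (F0 : forall x, (0 <= F x)%E).

(** The Jacobian of the dilation by $u^{1/\nu_N}$ on a slice: each coordinate other than the last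
    contributes $u^{\nu_i/\nu_N}$, and their weights add up to $Q - \nu_N$. *)
Let jac (u : R) := u `^ ((Q - nm) / nm).

Let cyl_ray s : cyl_measurable (fun (u : measurableTypeR R) z => F (ray s z u)).
Proof.
move=> d S a phi ma mphi; under eq_fun do rewrite rayE.
refine (mF (a := fun=> tt) (phi := fun t => rayseq s (phi t) (a t)) _ _) => // i.
rewrite /rayseq; apply: measurable_funM.
  apply: (measurableT_comp (measurable_powR _)).
  exact: (measurableT_comp (measurable_powR _)).
exact: (@measurable_upd _ _ _ _ (cst s)).
Qed.

Let slice_scale s u : 0 < u -> s = 1 \/ s = -1 ->
  iint n (fun x => F (\row_i upd n (s * u) x i)) =
  iint n (fun z => (jac u)%:E * F (ray s z u))%E.
Proof.
move=> u0 s1.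
have mslice : cyl_measurable (fun _ : unit => fun x => F (\row_i upd n (s * u) x i)).
  move=> d S a phi ma mphi; refine (mF (a := fun=> tt) (phi := fun t => upd n (s * u) (phi t)) _ _) => //.
  exact: (@measurable_upd _ _ _ _ (cst (s * u))).
pose c i := (u `^ nm^-1) `^ nu (inord i).
have c0 i : 0 < c i by rewrite !powR_gt0.
rewrite (iint_scale n c0 mslice)// iintZ ?powR_ge0//; last first.
  move=> d S a phi ma mphi; exact: (@cyl_ray s _ _ (cst u)).
congr (_%:E * iint n _)%E.
  have un0 : u != 0 by rewrite gt_eqF.
  rewrite /c /jac /hom_dim big_ord_recr/= addrK.
  under eq_bigr do rewrite -powRrM.
  rewrite -(@big_morph R R (powR u) 1 *%R 0 +%R) ?powRr0//; last first.
    by move=> x y; rewrite powRD ?un0 ?implybT.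
  rewrite mulr_suml; congr (_ `^ _); apply: eq_bigr => i _.
  rewrite mulrC; congr (nu _ / _); apply/val_inj => /=.
  by rewrite inordK// ltnS ltnW.
apply/funext => x; congr F; apply/rowP => i; rewrite !mxE /c /upd.
have [ie|ie] := eqVneq (nat_of_ord i) n; last by rewrite inord_val.
have -> : i = ord_max by exact/val_inj.
by rewrite -powRrM mulVf ?gt_eqF// powRr1 ?(ltW u0)// mulrC.
Qed.

(** The indicator extends the integrand by 0 to the whole line, where [iint_integral_swap] applies
    with Lebesgue measure itself. *)
Let fib s (u : measurableTypeR R) (z : nat -> R) : \bar R :=
  ((\1_(`]0%R, +oo[%classic : set R) u * jac u)%:E * F (ray s z u))%E.

Let fib_ge0 s u z : (0 <= fib s u z)%E.
Proof. by rewrite mule_ge0// lee_fin mulr_ge0 ?powR_ge0. Qed.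

Let cyl_fib s : cyl_measurable (fib s).
Proof.
move=> d S a phi ma mphi; apply: emeasurable_funM; last exact: cyl_ray.
apply/measurable_EFinP; apply: measurable_funM.
  have m1 : measurable_fun setT (\1_(`]0%R, +oo[%classic : set (measurableTypeR R)) :
      measurableTypeR R -> R) by exact: measurable_indic.
  exact: (measurableT_comp m1 ma).
exact: (measurableT_comp (measurable_powR _)).
Qed.

Let integral_fib s z : (\int[mu]_u fib s u z =
  \int[mu]_(u in `]0%R, +oo[) ((jac u)%:E * F (ray s z u)))%E.
Proof.
rewrite [RHS]integral_mkcond; apply: eq_integral => u _; rewrite patchE /fib indicE.
by case: ifPn => uD; rewrite ?mul1r ?mul0r ?mul0e.
Qed.

Lemma cyl_measurable_fibre s : cyl_measurable (fun _ : unit => fun z =>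
  \int[mu]_(u in `]0%R, +oo[) ((u `^ ((Q - nm) / nm))%:E * F (ray s z u)))%E.
Proof.
move=> d S a phi ma mphi; under eq_fun do rewrite -integral_fib.
pose G (x : S * measurableTypeR R) := fib s x.2 (phi x.1).
have mG : measurable_fun setT G.
  refine (@cyl_fib s _ _ snd (fun x => phi x.1) _ _) => // i.
  exact: (measurableT_comp (mphi i) measurable_fst).
have G0 x : (0 <= G x)%E by exact: fib_ge0.
exact: (@measurable_fun_fubini_tonelli_F _ _ _ _ _ mu G mG G0).
Qed.

(** Split by the sign of the last coordinate, which [iint] integrates outermost, rescale each slice
    to $x_N = 1$ or $x_N = -1$, and exchange the integrals. The hyperplane $x_N = 0$ is absorbed as
    a null set. *)
Lemma haar_int_polar :
  haar_int F =
  (iint n (fun z => \int[mu]_(u in `]0%R, +oo[) ((u `^ ((Q - nm) / nm))%:E * F (ray 1 z u))) +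
   iint n (fun z => \int[mu]_(u in `]0%R, +oo[) ((u `^ ((Q - nm) / nm))%:E * F (ray (-1) z u))))%E.
Proof.
have swap s : s = 1 \/ s = -1 ->
   (\int[mu]_(u in `]0%R, +oo[) iint n (fun x => F (\row_i upd n (s * u)%R x i)) =
    iint n (fun z => \int[mu]_(u in `]0%R, +oo[) ((jac u)%:E * F (ray s z u))))%E.
  move=> s1.
  transitivity (\int[mu]_u iint n (fib s u))%E.
    rewrite integral_mkcond; apply: eq_integral => u _; rewrite patchE.
    case: ifPn => [/set_mem/=|uD].
      rewrite in_itv/= andbT => u0; rewrite slice_scale//; congr iint.
      apply/funext => z; rewrite /fib indicE mem_set ?mul1r//=.
      by rewrite in_itv/= u0.
    rewrite (_ : fib s u = fun=> 0%E); last first.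
      by apply/funext => z; rewrite /fib indicE (negbTE uD) mul0r mul0e.
    by rewrite iint0.
  rewrite iint_integral_swap//.
  by congr iint; apply/funext => z; exact: integral_fib.
rewrite /haar_int /=.
rewrite (@ge0_integral_halves (fun t => iint n (fun x => F (\row_i upd n t x i)))).
- rewrite -(swap 1 (or_introl erefl)) -(swap (-1) (or_intror erefl)).
  congr (_ + _)%E; apply: eq_integral => u _; first by rewrite mul1r.
  by rewrite mulN1r.
- exact: (measurable_iint_upd n mF).
- by move=> t; exact: iint_ge0.
Qed.

End polar_coordinates.

(** * The inequality on one orbit and its integration over all orbits *)

Section fibre_inequality.
Context {R : realType} (n : nat) (nu : 'I_n.+1 -> R) (qn : 'rV[R]_n.+1 -> R) (p g : R).
Hypothesis nu0 : forall i, 0 < nu i.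
Hypotheses (cqn : continuous qn) (qn_ge0 : forall x, 0 <= qn x)
  (qn_eq0 : forall x, qn x = 0 <-> x = 0)
  (qn_dil : forall l x, 0 < l -> qn (dil nu l x) = l * qn x).
Hypotheses (p1 : 1 < p) (g1 : 1 < g) (gp : g - 1 < p).
Local Notation mu := (@lebesgue_measure R).
Local Notation nm := (nu ord_max).
Local Notation Q := (hom_dim nu).

Let p0 : 0 < p. Proof. exact: lt_trans p1. Qed.
Let pn0 : p != 0. Proof. by rewrite gt_eqF. Qed.
Let nmn0 : nm != 0. Proof. by rewrite gt_eqF. Qed.

Variables (f : 'rV[R]_n.+1 -> R) (Rr : R).
Hypotheses (sf : smooth f) (Rr0 : 0 < Rr).

Definition hardy_lhs (x : 'rV[R]_n.+1) : R := (f x - fR nu qn f Rr x) /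
  (powR (qn x) (Q / p) * powR `|ln (Rr / qn x)| (g / p)).

Definition hardy_rhs (x : 'rV[R]_n.+1) : R := radial nu qn f x /
  (powR (qn x) ((Q - p) / p) * powR `|ln (Rr / qn x)| ((g - p) / p)).

Let df x : differentiable f x. Proof. exact: (sf [::]). Qed.
Let cf : continuous f. Proof. by move=> x; exact: differentiable_continuous. Qed.

Let normr_div_powR (a b c r s : R) : 0 <= b -> 0 <= c ->
  `|a / (b `^ (r / p) * c `^ (s / p))| `^ p = `|a| `^ p * (b `^ (- r) * c `^ (- s)).
Proof.
move=> b0 c0; rewrite normrM normfV normrM !(ger0_norm (powR_ge0 _ _)).
rewrite invfM -!powRN !powRM ?mulr_ge0 ?powR_ge0// -!powRrM.
by congr (_ * (_ `^ _ * _ `^ _)); rewrite -mulNr mulfVK.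
Qed.

Lemma hardy_lhsE x : `|hardy_lhs x| `^ p =
  `|f x - fR nu qn f Rr x| `^ p * (qn x `^ (- Q) * `|ln (Rr / qn x)| `^ (- g)).
Proof. by rewrite normr_div_powR. Qed.

Lemma hardy_rhsE x : `|hardy_rhs x| `^ p =
  `|euler nu f x / qn x| `^ p * (qn x `^ (p - Q) * `|ln (Rr / qn x)| `^ (p - g)).
Proof. by rewrite /hardy_rhs radialE// normr_div_powR// !opprB. Qed.

Section cyl.
Context d (S : measurableType d) (phi : S -> nat -> R).
Hypothesis mphi : forall i, measurable_fun setT (phi ^~ i).

Let mrow (h : 'rV[R]_n.+1 -> R) : continuous h ->
  measurable_fun setT (fun s => h (\row_i phi s i)).
Proof.
by move=> ch; apply: (@measurable_fun_row _ _ _ _ h (fun i s => phi s i)).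
Qed.

Let mpow (h : S -> R) (r : R) : measurable_fun setT h ->
  measurable_fun setT (fun s => h s `^ r).
Proof. by move=> mh; exact: (measurableT_comp (measurable_powR r) mh). Qed.

Let mnorm (h : S -> R) : measurable_fun setT h -> measurable_fun setT (fun s => `|h s|).
Proof. by move=> mh; apply: measurableT_comp. Qed.

Let mRq : measurable_fun setT (fun s => Rr / qn (\row_i phi s i)).
Proof.
apply: measurable_funM => //.
under eq_fun do rewrite -powR_inv1//.
exact/mpow/mrow.
Qed.

Let mlnRq (r : R) : measurable_fun setT (fun s => `|ln (Rr / qn (\row_i phi s i))| `^ r).
Proof.
apply: mpow; apply: mnorm.
exact: (measurableT_comp (@measurable_ln R)).
Qed.

Lemma measurable_hardy_lhs : measurable_fun setT (fun s => (`|hardy_lhs (\row_i phi s i)| `^ p)%:E).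
Proof.
apply/measurable_EFinP; under eq_fun do rewrite hardy_lhsE.
apply: measurable_funM; last first.
  by apply: measurable_funM; [exact/mpow/mrow|exact: mlnRq].
apply: mpow; apply: mnorm.
apply: measurable_funB; first exact: mrow.
(* [fR] may be discontinuous at the origin, but it is the continuous [f] evaluated at a row whose
   coordinates are measurable. *)
rewrite /fR /dil.
under eq_fun do (under eq_mx do rewrite mxE).
apply: (@measurable_fun_row _ _ _ _ f
  (fun i s => (Rr / qn (\row_i phi s i)) `^ nu i * phi s i)) => // i.
by apply: measurable_funM => //; exact: mpow.
Qed.

Lemma measurable_hardy_rhs : measurable_fun setT (fun s => (`|hardy_rhs (\row_i phi s i)| `^ p)%:E).
Proof.
apply/measurable_EFinP; under eq_fun do rewrite hardy_rhsE.
apply: measurable_funM; last first.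
  by apply: measurable_funM; [exact/mpow/mrow|exact: mlnRq].
apply: mpow; apply: mnorm.
apply: measurable_funM; first by apply: mrow; exact: continuous_euler.
under eq_fun do rewrite -powR_inv1//.
exact/mpow/mrow.
Qed.

End cyl.

Lemma cyl_hardy_lhs : cyl_measurable (fun _ : unit => fun x =>
  (`|hardy_lhs (\row_i x i)| `^ p)%:E).
Proof. by move=> d S a phi ma mphi; exact: measurable_hardy_lhs. Qed.

Lemma cyl_hardy_rhs : cyl_measurable (fun _ : unit => fun x =>
  (`|hardy_rhs (\row_i x i)| `^ p)%:E).
Proof. by move=> d S a phi ma mphi; exact: measurable_hardy_rhs. Qed.

Section fibre.
Variables (s : R) (z : nat -> R).
Hypothesis s0 : s != 0.

Let c := qn (\row_i upd n s z i).

Lemma ray_norm_gt0 : 0 < c.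
Proof.
rewrite lt_neqAle qn_ge0 andbT eq_sym; apply: contra_neq s0 => /qn_eq0/rowP/(_ ord_max).
by rewrite !mxE /upd eqxx.
Qed.
Let c0 := ray_norm_gt0.

Lemma qn_ray u : 0 < u -> qn (ray nu s z u) = u `^ nm^-1 * c.
Proof. by move=> u0; rewrite qn_dil// powR_gt0. Qed.

Definition ray_log (u : R) := nm^-1 * ln u - ln (Rr / c).
(** The parameter at which the orbit crosses $|x| = R$; along the whole orbit $f_R$ equals the value
    of [f] at this point. *)
Definition ray_base := (Rr / c) `^ nm.
Let om := ray_log.
Let v (u : R) := (nm * u)^-1.
Let u0 := ray_base.
Let u00 : 0 < u0. Proof. by rewrite powR_gt0// divr_gt0. Qed.
Definition ray_diff (u : R) := f (ray nu s z u) - f (ray nu s z u0).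
Definition ray_der (u : R) := euler nu f (ray nu s z u) * v u.

Lemma ln_ray u : 0 < u -> `|ln (Rr / qn (ray nu s z u))| = `|om u|.
Proof.
move=> up; rewrite qn_ray// -normrN; congr `|_|; rewrite /om /ray_log.
have upn : 0 < u `^ nm^-1 by rewrite powR_gt0.
rewrite !ln_div ?posrE ?mulr_gt0// lnM ?posrE// ln_powR; ring.
Qed.

Lemma fR_ray u : 0 < u -> fR nu qn f Rr (ray nu s z u) = f (ray nu s z u0).
Proof.
move=> up; rewrite /fR qn_ray// /ray dil_dil//.
- have upn : u `^ nm^-1 != 0 by rewrite gt_eqF// powR_gt0.
  congr (f (dil _ _ _)); rewrite /u0 /ray_base -powRrM mulfV// powRr1.
    by field; rewrite upn gt_eqF.
  by rewrite divr_ge0// ltW.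
- by rewrite divr_ge0 ?mulr_ge0 ?powR_ge0 ?ltW.
- exact: powR_ge0.
Qed.

(** The powers of [u] coming from $Q$ cancel: up to a factor depending on the orbit only, what
    remains is $du/u$, the measure for which the problem is the same on every orbit. *)
Let jac_norm u : 0 < u ->
  u `^ ((Q - nm) / nm) * qn (ray nu s z u) `^ (- Q) = nm * c `^ (- Q) * v u.
Proof.
move=> up; have un0 : u != 0 by rewrite gt_eqF.
rewrite qn_ray// powRM ?powR_ge0 ?ltW// -powRrM mulrA -powRD ?un0 ?implybT//.
rewrite (_ : (Q - nm) / nm + nm^-1 * - Q = -1); last by field.
by rewrite powR_inv1 ?ltW// /v; field; rewrite un0 nmn0.
Qed.

Lemma fibre_lhs u : 0 < u ->
  u `^ ((Q - nm) / nm) * `|hardy_lhs (ray nu s z u)| `^ p =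
  nm * c `^ (- Q) * hardyL p g ray_diff (fun u => `|om u|) v u.
Proof.
move=> up; rewrite hardy_lhsE fR_ray// ln_ray//.
rewrite /hardyL -/(ray_diff u) mulrCA [X in _ * X]mulrA jac_norm//; ring.
Qed.

Lemma fibre_rhs u : 0 < u ->
  u `^ ((Q - nm) / nm) * `|hardy_rhs (ray nu s z u)| `^ p =
  nm * c `^ (- Q) * hardyR p g ray_der (fun u => `|om u|) v u.
Proof.
move=> up; rewrite hardy_rhsE ln_ray//.
have q0 : 0 < qn (ray nu s z u) by rewrite qn_ray// mulr_gt0// powR_gt0.
have v0 : 0 < v u by rewrite invr_gt0 mulr_gt0.
rewrite normrM normfV powRM ?invr_ge0// (ger0_norm (ltW q0)).
set q := qn _ in q0 *; set E := `|euler _ _ _| `^ p.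
(* The division by $|x|$ in the radial derivative lowers the weight $|x|^{p-Q}$ to $|x|^{-Q}$, so
   that [jac_norm] serves this side too. *)
have qE : q^-1 `^ p * q `^ (p - Q) = q `^ (- Q).
  have qn0 : q != 0 by rewrite gt_eqF.
  rewrite -[q^-1]powR_inv1 ?(ltW q0)// -powRrM mulN1r -powRD ?qn0 ?implybT//.
  by rewrite addrA addNr add0r.
transitivity (u `^ ((Q - nm) / nm) * q `^ (- Q) * (E * `|om u| `^ (p - g))).
  by rewrite -qE; ring.
rewrite jac_norm//.
rewrite /hardyR /ray_der normrM (gtr0_norm v0) powRM ?(ltW v0)//.
have -> : v u `^ (1 - p) = v u / v u `^ p.
  by rewrite powRB ?(gt_eqF v0) ?implybT// powRr1 ?(ltW v0).
rewrite -/E; have : v u `^ p != 0 by rewrite gt_eqF// powR_gt0.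
by move=> vp; field.
Qed.

Let drho (u : R) : 0 < u -> is_derive u 1 (fun t : R => t `^ nm^-1) (u `^ nm^-1 * v u).
Proof.
move=> up; have un0 : u != 0 by rewrite gt_eqF.
apply: (is_derive_eq (is_derive1_powR nm^-1 up)).
by rewrite powRB ?un0 ?implybT// powRr1 ?ltW// /v; field; rewrite un0 nmn0.
Qed.

Lemma ray_diff_derive (u : R) : 0 < u -> is_derive u 1 ray_diff (ray_der u).
Proof.
move=> up; have rp : 0 < u `^ nm^-1 by rewrite powR_gt0.
have H := is_derive_dil nu (\row_i upd n s z i) df (drho up) rp.
have H2 := is_deriveB H (is_derive_cst (f (ray nu s z u0)) u 1).
apply: (is_derive_eq H2); rewrite subr0 /ray_der mulrC; congr (_ * _).
by rewrite mulrAC divff ?mul1r// gt_eqF.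
Qed.

Lemma ray_log_derive (u : R) : 0 < u -> is_derive u 1 om (v u).
Proof.
move=> up; have un0 : u != 0 by rewrite gt_eqF.
have H := is_deriveB (is_deriveZ nm^-1 (is_derive1_ln up)) (is_derive_cst (ln (Rr / c)) u 1).
by apply: (is_derive_eq H); rewrite subr0 /GRing.scale/= /v invfM.
Qed.

Lemma measurable_ray_log : measurable_fun (`]0, +oo[%classic : set R) om.
Proof.
apply: measurable_halfline => u up; apply: differentiable_continuous.
by apply/derivable1_diffP; have [] := ray_log_derive up.
Qed.

Lemma fibre_hardy :
  (\int[mu]_(u in `]0%R, +oo[) ((u `^ ((Q - nm) / nm))%:E * (`|hardy_lhs (ray nu s z u)| `^ p)%:E) <=
   ((p / (g - 1)) `^ p)%:E *
   \int[mu]_(u in `]0%R, +oo[) ((u `^ ((Q - nm) / nm))%:E * (`|hardy_rhs (ray nu s z u)| `^ p)%:E))%E.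
Proof.
have v0 u : 0 < u -> 0 < v u by move=> up; rewrite invr_gt0 mulr_gt0.
have cv (u : R) : 0 < u -> {for u, continuous v}.
  move=> up; apply: (@continuousV _ _ (fun x : R => nm * x)); first by rewrite gt_eqF// mulr_gt0.
  by apply: (@continuousM _ _ (cst nm) id); [exact: cst_continuous|].
have cder (u : R) : 0 < u -> {for u, continuous ray_der}.
  move=> up; apply: (@continuousM _ _ (fun t => euler nu f (ray nu s z t)) v); last exact: cv.
  apply: (@continuous_comp _ _ _ (ray nu s z) (euler nu f)); first exact: continuous_ray.
  exact: continuous_euler.
have cont (k : R -> R) (dk u : R) : is_derive u 1 k dk -> {for u, continuous k}.
  by case=> /derivable1_diffP + _; exact: differentiable_continuous.
have mh := measurable_halfline (fun u up => cont _ _ _ (ray_diff_derive up)).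
have mom := measurable_ray_log.
have mL := measurable_hardyL p g mh mom (measurable_halfline cv).
have mR := measurable_hardyR p g (measurable_halfline cder) mom (measurable_halfline cv).
have K0 : 0 <= nm * c `^ (- Q) by rewrite mulr_ge0 ?powR_ge0// ltW.
have DP u : u \in (`]0%R, +oo[%classic : set R) -> 0 < u.
  by move=> /set_mem/=; rewrite in_itv/= andbT.
have EL : (\int[mu]_(u in `]0%R, +oo[) ((u `^ ((Q - nm) / nm))%:E *
    (`|hardy_lhs (ray nu s z u)| `^ p)%:E) = \int[mu]_(u in `]0%R, +oo[)
    ((nm * c `^ (- Q))%:E * (hardyL p g ray_diff (fun u => `|om u|%R) v u)%:E))%E.
  by apply: eq_integral => u /DP up; rewrite -!EFinM; congr EFin; exact: fibre_lhs.
have ER : (\int[mu]_(u in `]0%R, +oo[) ((u `^ ((Q - nm) / nm))%:E *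
    (`|hardy_rhs (ray nu s z u)| `^ p)%:E) = \int[mu]_(u in `]0%R, +oo[)
    ((nm * c `^ (- Q))%:E * (hardyR p g ray_der (fun u => `|om u|%R) v u)%:E))%E.
  by apply: eq_integral => u /DP up; rewrite -!EFinM; congr EFin; exact: fibre_rhs.
refine (eq_ind_r (fun x => (x <= _)%E) _ EL).
refine (eq_ind_r (fun x => (_ <= _ * x)%E) _ ER).
rewrite !ge0_integralZl//; last 2 first.
- by move=> u _; rewrite lee_fin hardyR_ge0.
- by move=> u /mem_set/DP/v0 vu; rewrite lee_fin hardyL_ge0// ltW.
rewrite muleCA lee_wpmul2l//.
have omE u : om u = nm^-1 * (ln u - ln u0).
  by rewrite /om /ray_log /u0 /ray_base ln_powR mulrBr mulKf.
apply: (@hardy_halfline _ p g p1 g1 u0) => //.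
- exact: ray_diff_derive.
- exact: ray_log_derive.
- by rewrite /ray_diff subrr.
- by rewrite omE subrr mulr0.
- move=> u uu0; have up : 0 < u by exact: lt_trans uu0.
  by rewrite omE mulr_gt0 ?invr_gt0// subr_gt0 ltr_ln ?posrE.
- move=> u /andP[up uu0].
  by rewrite omE pmulr_rlt0 ?invr_gt0// subr_lt0 ltr_ln ?posrE.
Qed.

End fibre.

Lemma hardy_haar_int :
  (haar_int (fun x => (`|hardy_lhs x| `^ p)%:E) <=
   ((p / (g - 1)) `^ p)%:E * haar_int (fun x => (`|hardy_rhs x| `^ p)%:E))%E.
Proof.
have K0 : 0 <= (p / (g - 1)) `^ p by exact: powR_ge0.
have ge0 (h : 'rV[R]_n.+1 -> R) x : (0 <= (`|h x| `^ p)%:E)%E by rewrite lee_fin powR_ge0.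
have fge0 (h : 'rV[R]_n.+1 -> R) s z : (0 <= \int[mu]_(u in `]0%R, +oo[)
    ((u `^ ((Q - nm) / nm))%:E * (`|h (ray nu s z u)| `^ p)%:E))%E.
  by apply: integral_ge0 => u _; rewrite mule_ge0// lee_fin powR_ge0.
have mL := cyl_measurable_fibre nu cyl_hardy_lhs (ge0 hardy_lhs).
have mR := cyl_measurable_fibre nu cyl_hardy_rhs (ge0 hardy_rhs).
rewrite (haar_int_polar nu0 cyl_hardy_lhs)// (haar_int_polar nu0 cyl_hardy_rhs)//.
rewrite ge0_muleDr; [|exact: iint_ge0..].
have half s : s != 0 -> (iint n (fun z => \int[mu]_(u in `]0%R, +oo[)
      ((u `^ ((Q - nm) / nm))%:E * (`|hardy_lhs (ray nu s z u)| `^ p)%:E)) <=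
    ((p / (g - 1)) `^ p)%:E * iint n (fun z => \int[mu]_(u in `]0%R, +oo[)
      ((u `^ ((Q - nm) / nm))%:E * (`|hardy_rhs (ray nu s z u)| `^ p)%:E)))%E.
  move=> s0; rewrite -iintZ//; apply: le_iint => //.
    move=> d S a phi ma mphi; apply: emeasurable_funM => //.
    exact: (mR _ _ _ a).
  by move=> z; rewrite fge0/=; exact: fibre_hardy.
by apply: leeD; apply: half; rewrite ?oppr_eq0 oner_neq0.
Qed.

End fibre_inequality.

(** * Smooth functions and plateaus *)

Section smooth_on.
Context {R : realType}.
Implicit Types (O : set R) (f g : R -> R).

Definition smooth_on O f : Prop :=
  forall (k : nat) (x : R), O x -> derivable (derive1n k f) x 1.

Lemma derive1_eq_on O f g : open O -> (forall x, O x -> f x = g x) ->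
  (forall x, O x -> (derive1 f) x = (derive1 g) x).
Proof.
move=> oO fg x Ox; rewrite !derive1E; apply: near_eq_derive.
by apply: filterS (open_nbhs_nbhs (conj oO Ox)) => y /fg.
Qed.

Lemma derivable_eq_on O f g x : open O -> (forall y, O y -> f y = g y) -> O x ->
  derivable f x 1 -> derivable g x 1.
Proof.
move=> oO fg Ox; apply: near_eq_derivable.
by apply: filterS (open_nbhs_nbhs (conj oO Ox)) => y /fg.
Qed.

Lemma smooth_on_eq O f g : open O -> (forall x, O x -> f x = g x) ->
  smooth_on O f -> smooth_on O g.
Proof.
move=> oO fg sf k x Ox.
have H : forall y, O y -> derive1n k f y = derive1n k g y.
  elim: k => [//|k IH] y Oy; rewrite !derive1nS; exact: derive1_eq_on IH y Oy.
exact: (derivable_eq_on oO H Ox (sf k x Ox)).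
Qed.

Lemma smooth_onS O f : (forall x, O x -> derivable f x 1) ->
  smooth_on O (derive1 f) -> smooth_on O f.
Proof.
move=> df sf [|k] x Ox; first exact: df.
by rewrite derive1Sn; exact: sf.
Qed.

Lemma smooth_on_derive1 O f : smooth_on O f -> smooth_on O (derive1 f).
Proof. by move=> sf k x Ox; rewrite -derive1Sn; exact: sf. Qed.

(** Coinduction: if the derivative of each member of a class agrees on [O] with another member, all
    members are smooth. Closed formulas for higher derivatives are thereby avoided. *)
Lemma smooth_on_coind (P : (R -> R) -> Prop) O : open O ->
  (forall f, P f -> exists2 h, P h & forall x : R, O x -> is_derive x 1 f (h x)) ->
  forall f, P f -> smooth_on O f.
Proof.
move=> oO Pd f Pf k; elim: k f Pf => [|k IH] f Pf x Ox.
  by have [h _ /(_ x Ox)[]] := Pd _ Pf.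
have [h Ph fh] := Pd _ Pf; rewrite derive1Sn.
have E : forall y, O y -> h y = (derive1 f) y.
  by move=> y Oy; rewrite derive1E; have [_ ->] := fh y Oy.
have Ek : forall y, O y -> derive1n k h y = derive1n k (derive1 f) y.
  elim: (k) => [//|j IHj] y Oy; rewrite !derive1nS; exact: derive1_eq_on IHj y Oy.
exact: (derivable_eq_on oO Ek Ox (IH _ Ph x Ox)).
Qed.

(** Syntactic, because the derivative of a term is again a term: [smooth_on_coind] then yields sums,
    products and compositions at once, with no Leibniz or Faa di Bruno formula. The outer function
    of a composition may be any smooth function, as its derivative is again one. *)
Inductive smooth_term O : (R -> R) -> Prop :=
| ST_cst c : smooth_term O (fun=> c)
| ST_id : smooth_term O id
| ST_add f g : smooth_term O f -> smooth_term O g -> smooth_term O (fun x => f x + g x)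
| ST_mul f g : smooth_term O f -> smooth_term O g -> smooth_term O (fun x => f x * g x)
| ST_comp (O' : set R) (h f : R -> R) : smooth_on O' h -> (forall x, O x -> O' (f x)) ->
    smooth_term O f -> smooth_term O (fun x => h (f x)).

Lemma smooth_term_on O f : open O -> smooth_term O f -> smooth_on O f.
Proof.
move=> oO; apply: smooth_on_coind => //{}f.
elim=> [c||f1 f2 _ [d1 T1 D1] _ [d2 T2 D2]|f1 f2 S1 [d1 T1 D1] S2 [d2 T2 D2]
       |O' h f1 sh hO S1 [d1 T1 D1]].
- by exists (fun=> 0) => [|x _]; [exact: ST_cst|exact: is_derive_cst].
- by exists (fun=> 1) => [|x _]; [exact: ST_cst|exact: is_derive_id].
- exists (fun x => d1 x + d2 x); first exact: ST_add.
  by move=> x Ox; exact: is_deriveD (D1 x Ox) (D2 x Ox).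
- exists (fun x => f1 x * d2 x + f2 x * d1 x).
    by apply: ST_add; apply: ST_mul.
  move=> x Ox; exact: is_deriveM (D1 x Ox) (D2 x Ox).
- exists (fun x => (derive1 h) (f1 x) * d1 x).
    exact: ST_mul (ST_comp (smooth_on_derive1 sh) hO S1) T1.
  move=> x Ox; apply: is_derive1_comp (D1 x Ox).
  by rewrite derive1E; apply: derivableP; exact: (sh 0%N _ (hO x Ox)).
Qed.

Lemma smooth_onU O1 O2 f : smooth_on O1 f -> smooth_on O2 f -> smooth_on (O1 `|` O2) f.
Proof. by move=> s1 s2 k x [/s1|/s2]; apply. Qed.

Lemma smooth_on_powR a : smooth_on [set x | 0 < x] (fun x : R => x `^ a).
Proof.
apply: (@smooth_on_coind (fun f => exists c a, f = fun x => c * x `^ a)).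
- exact: open_gt.
- move=> _ [c [b ->]]; exists (fun x => c * b * x `^ (b - 1)); first by exists (c * b), (b - 1).
  move=> x x0; have := is_deriveZ c (is_derive1_powR b x0).
  by rewrite /GRing.scale/= mulrA.
- by exists 1, a; apply/funext => x; rewrite mul1r.
Qed.

Lemma smooth_on_ln : smooth_on [set x | 0 < x] (@ln R).
Proof.
have dln (x : R) : 0 < x -> is_derive x 1 (@ln R) x^-1 by exact: is_derive1_ln.
apply: smooth_onS => [x /dln[]//|].
apply: (smooth_on_eq _ _ (@smooth_on_powR (-1))); first exact: open_gt.
by move=> x x0; rewrite powR_inv1 ?ltW// derive1E; have [_ ->] := dln x x0.
Qed.

(** Two open sets cover the line: [O], and the complement of the segment, where [f] vanishes. *)
Lemma smooth_on_support O (a b : R) f : open O -> (forall x, a <= x <= b -> O x) ->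
  (forall x, ~ (a <= x <= b) -> f x = 0) -> smooth_on O f -> smooth_on setT f.
Proof.
move=> oO abO f0 sf.
have oC : open (~` `[a, b]%classic : set R) by apply: closed_openC; exact: interval_closed.
have sC : smooth_on (~` `[a, b]%classic) f.
  apply: (smooth_on_eq (f := fun=> 0)) => //.
    by move=> x /= nab; rewrite f0// => xab; apply: nab; rewrite in_itv/=.
  exact: smooth_term_on (ST_cst _ _).
have := smooth_onU sf sC; rewrite (_ : O `|` _ = setT)//.
apply/seteqP; split => // x _; have [xab|nab] := pselect (a <= x <= b).
  by left; exact: abO.
by right => /=; rewrite in_itv/=.
Qed.

End smooth_on.

(** * Smooth functions of several variables *)

Section smooth_row.
Context {R : realType} (N : nat).
Local Notation V := 'rV[R]_N.

(** The same device in several variables, closed under directional derivatives. The outer function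
    of a composition must be smooth on the whole line, which forces the cutoffs of the test function
    to be defined globally. *)
Inductive smooth_fun : (V -> R) -> Prop :=
| SF_cst c : smooth_fun (fun=> c)
| SF_coord i : smooth_fun (fun x => x 0 i)
| SF_add f g : smooth_fun f -> smooth_fun g -> smooth_fun (fun x => f x + g x)
| SF_mul f g : smooth_fun f -> smooth_fun g -> smooth_fun (fun x => f x * g x)
| SF_comp h f : smooth_on setT h -> smooth_fun f -> smooth_fun (fun x => h (f x)).

Lemma smooth_fun_diff f : smooth_fun f -> forall x, differentiable f x.
Proof.
elim=> [c|i|f1 f2 _ D1 _ D2|f1 f2 _ D1 _ D2|h f1 sh _ D1] x.
- exact: differentiable_cst.
- exact: differentiable_coord.
- exact: differentiableD.
- exact: differentiableM.
- apply: (@differentiable_comp _ _ _ _ f1 h) => //.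
  by apply/derivable1_diffP; exact: (sh 0%N).
Qed.

Lemma smooth_fun_derive f v : smooth_fun f -> smooth_fun ('D_v f).
Proof.
elim=> [c|i|f1 f2 S1 T1 S2 T2|f1 f2 S1 T1 S2 T2|h f1 sh S1 T1].
- rewrite (_ : 'D_v _ = fun=> 0); first exact: SF_cst.
  by apply/funext => x; exact: derive_cst.
- rewrite (_ : 'D_v _ = fun=> v 0 i); first exact: SF_cst.
  apply/funext => x; have dI : derivable (id : V -> V) x v by exact: derivable_id.
  have /rowP/(_ i) := derive_mx dI.
  by rewrite derive_id mxE => <-.
- rewrite (_ : 'D_v _ = fun x => 'D_v f1 x + 'D_v f2 x); first exact: SF_add.
  apply/funext => x; apply: deriveD; apply: diff_derivable; exact: smooth_fun_diff.
- rewrite (_ : 'D_v _ = fun x => f1 x * 'D_v f2 x + f2 x * 'D_v f1 x).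
    by apply: SF_add; apply: SF_mul.
  apply/funext => x; apply: deriveM; apply: diff_derivable; exact: smooth_fun_diff.
- rewrite (_ : 'D_v _ = fun x => (derive1 h) (f1 x) * 'D_v f1 x).
    exact: SF_mul (SF_comp (smooth_on_derive1 sh) S1) T1.
  apply/funext => x.
  have dh : derivable h (f1 x) 1 by exact: (sh 0%N).
  have dh' : differentiable h (f1 x) by exact/derivable1_diffP.
  have d1 := smooth_fun_diff S1 x.
  rewrite deriveE; last exact: (@differentiable_comp _ _ _ _ f1 h).
  rewrite (@diff_comp _ _ _ _ f1 h)//= deriv1E// deriveE// /GRing.scale/= mulrC//.
Qed.

Lemma smooth_fun_smooth f : smooth_fun f -> smooth f.
Proof.
move=> sf vs x; apply: smooth_fun_diff.
by elim: vs => //= v vs; exact: smooth_fun_derive.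
Qed.

Lemma smooth_fun_prod n (F : 'I_n -> V -> R) : (forall i, smooth_fun (F i)) ->
  smooth_fun (fun x => \prod_(i < n) F i x).
Proof.
elim: n F => [|n IH] F sF.
  rewrite (_ : (fun x => _) = fun=> 1); first exact: SF_cst.
  by apply/funext => x; rewrite big_ord0.
rewrite (_ : (fun x => _) = fun x => \prod_(i < n) F (widen_ord (leqnSn n) i) x * F ord_max x).
  by apply: SF_mul => //; exact: IH.
by apply/funext => x; rewrite big_ord_recr.
Qed.

End smooth_row.

(** * Smooth steps and plateaus on the line *)

Section plateau.
Context {R : realType}.

Lemma is_derive_mulr (f g : R -> R) (x df dg : R) :
  is_derive x 1 f df -> is_derive x 1 g dg ->
  is_derive x 1 (fun y => f y * g y) (f x * dg + g x * df).
Proof. exact: is_deriveM. Qed.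

(** For [k = 0] the classical function $e^{-1/t}$; the powers of $1/t$ make the linear span of the
    family closed under differentiation. *)
Definition flat (k : nat) (t : R) : R := if 0 < t then t^-1 ^+ k * expR (- t^-1) else 0.

Lemma flat_ge0 k t : 0 <= flat k t.
Proof.
rewrite /flat; case: ifP => // t0.
by rewrite mulr_ge0 ?expR_ge0// exprn_ge0// invr_ge0 ltW.
Qed.

(** From $e^s \ge s^{k+1}/(k+1)!$ at $s = 1/t$. It gives differentiability at 0, where the right
    difference quotient of [flat k] is [flat k.+1]. *)
Lemma flat_le k t : 0 < t -> flat k t <= k.+1`!%:R * t.
Proof.
move=> t0; rewrite /flat t0 expRN.
have tV0 : 0 < t^-1 by rewrite invr_gt0.
have := expR_ge1Dxn k (ltW tV0); rewrite -lerBrDl => /le_trans H.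
have {H} := H _ (_ : _ <= expR t^-1); rewrite gerBl => /(_ ler01).
rewrite ler_pdivrMr ?ltr0n ?fact_gt0// => H.
rewrite ler_pdivrMr ?expR_gt0//.
have -> : t^-1 ^+ k = t * t^-1 ^+ k.+1.
  by rewrite exprS mulrA mulfV ?gt_eqF// mul1r.
by rewrite -mulrA mulrCA [_%:R * _]mulrC ler_pM2l.
Qed.

Lemma flat_derive k (t : R) :
  is_derive t 1 (flat k) (flat k.+2 t - k%:R * flat k.+1 t).
Proof.
have [t0|t0|->] := ltgtP t 0.
- have -> : flat k.+2 t - k%:R * flat k.+1 t = 0.
    by rewrite /flat ltNge (ltW t0)/= mulr0 subr0.
  apply: (near_eq_is_derive _ (is_derive_cst 0 t 1)).
  by apply: filterS (lt_nbhsl t0) => y y0; rewrite /flat ltNge (ltW y0).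
- have tn0 : t != 0 by rewrite gt_eqF.
  have dV : is_derive t 1 (fun x : R => x^-1) (- t ^- 2).
    by have := is_deriveV tn0 (is_derive_id t (1 : R)); rewrite /GRing.scale/= mulr1.
  have dN : is_derive t 1 (fun x : R => - x^-1) (t ^- 2).
    by have := is_deriveN dV; rewrite opprK.
  have dE := is_derive1_comp (f := expR) (g := fun x : R => - x^-1) (is_derive_expR _) dN.
  have H := is_deriveM (is_deriveX k dV) dE.
  apply: (near_eq_is_derive (f := fun x : R => x^-1 ^+ k * expR (- x^-1))).
    by apply: filterS (lt_nbhsr t0) => y y0; rewrite /flat y0.
  rewrite (_ : (fun x : R => _) = [eta GRing.inv] ^+ k * (expR \o (fun x : R => - x^-1))); last first.
    by apply/funext => x; rewrite !fctE.
  apply: (is_derive_eq H); rewrite /flat t0 /GRing.scale/= !fctE.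
  case: k {H} => [|k] /=; rewrite ?exprS ?expr0 ?mulr0n; field; exact: tn0.
- rewrite {2 3}/flat ltxx mulr0 subr0.
  have H : (fun h : R => h^-1 *: ((flat k \o shift (0:R)) (h *: (1:R)) - flat k 0)) @ 0^' --> (0 : R).
    apply/cvgrPdist_le => e e0.
    have c0 : (0 : R) < k.+2`!%:R by rewrite ltr0n fact_gt0.
    have ec : 0 < e / k.+2`!%:R by rewrite divr_gt0.
    have nbhs0_lt_norm : \forall h \near (0 : R), `|h| < e / k.+2`!%:R.
      near=> h; rewrite -[h]subr0 distrC; near: h; exact: nbhsx_ballx.
    near=> h.
    have h0 : h != 0 by near: h; exact: nbhs_dnbhs_neq.
    have he : `|h| < e / k.+2`!%:R.
      by near: h; apply: nbhs_dnbhs; exact: nbhs0_lt_norm.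
    rewrite sub0r normrN /= {2}/flat ltxx subr0 addr0 /GRing.scale/= mulr1.
    rewrite /flat; case: ifPn => hp; last by rewrite mulr0 normr0 ltW.
    have -> : h^-1 * (h^-1 ^+ k * expR (- h^-1)) = flat k.+1 h by rewrite /flat hp exprS mulrA.
    rewrite ger0_norm ?flat_ge0// (le_trans (flat_le _ hp))//.
    by rewrite mulrC -ler_pdivlMr// ltW// -(gtr0_norm hp).
  by apply: DeriveDef; [apply/cvg_ex; exists 0|exact/cvg_lim].
Unshelve. all: by end_near. Qed.

Inductive flat_span : (R -> R) -> Prop :=
| FS_flat c k : flat_span (fun t => c * flat k t)
| FS_add f g : flat_span f -> flat_span g -> flat_span (fun t => f t + g t).

Lemma smooth_flat k : smooth_on setT (flat k).
Proof.
apply: (@smooth_on_coind _ flat_span); first exact: openT.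
  move=> f0; elim=> [c j|f g _ [f' Sf Df] _ [g' Sg Dg]].
    exists (fun t => c * flat j.+2 t + - (c * j%:R) * flat j.+1 t).
      by apply: FS_add; exact: FS_flat.
    move=> t _; have := is_deriveZ c (flat_derive j t).
    by move=> H; apply: (is_derive_eq H); rewrite /GRing.scale/=; ring.
  exists (fun t => f' t + g' t); first exact: FS_add.
  by move=> t _; exact: is_deriveD (Df t I) (Dg t I).
have -> : flat k = fun t => 1 * flat k t by apply/funext => t; rewrite mul1r.
exact: FS_flat.
Qed.

(** The inverse is written as the power $-1$ to make this a [smooth_term] over [smooth_on_powR]. The
    denominator is positive since [t] or [1 - t] is. *)
Definition step (t : R) : R := flat 0 t * (flat 0 t + flat 0 (1 - t)) `^ (-1).

Let flat0_gt0 t : 0 < t -> 0 < flat 0 t.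
Proof. by move=> t0; rewrite /flat t0 expr0 mul1r expR_gt0. Qed.

Let flat0_eq0 t : t <= 0 -> flat 0 t = 0.
Proof. by move=> t0; rewrite /flat ltNge t0. Qed.

Let den_gt0 t : 0 < flat 0 t + flat 0 (1 - t).
Proof.
have [t0|t0] := ltP 0 t; first by rewrite ltr_pwDl ?flat0_gt0 ?flat_ge0.
by rewrite flat0_eq0// add0r flat0_gt0// subr_gt0 (le_lt_trans t0).
Qed.

Lemma step_eq0 t : t <= 0 -> step t = 0.
Proof. by move=> t0; rewrite /step flat0_eq0// mul0r. Qed.

Lemma step_eq1 t : 1 <= t -> step t = 1.
Proof.
move=> t1; rewrite /step [flat 0 (1 - t)]flat0_eq0 ?subr_le0// addr0.
have t0 : 0 < t by exact: lt_le_trans t1.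
by rewrite powR_inv1 ?flat_ge0// divff// gt_eqF// flat0_gt0.
Qed.

Lemma step_ge0 t : 0 <= step t.
Proof. by rewrite mulr_ge0 ?flat_ge0 ?powR_ge0. Qed.

Lemma step_le1 t : step t <= 1.
Proof.
by rewrite /step powR_inv1 ?(ltW (den_gt0 t))// ler_pdivrMr// mul1r lerDl flat_ge0.
Qed.

Let ST_onem O : smooth_term O (fun x : R => 1 - x).
Proof.
have := ST_add (ST_cst O 1) (ST_mul (ST_cst O (-1)) (ST_id O)).
by rewrite (_ : (fun x => _) = (fun x : R => 1 - x))//; apply/funext => x; rewrite mulN1r.
Qed.

Lemma smooth_step : smooth_on setT step.
Proof.
apply: smooth_term_on; first exact: openT.
have S0 := ST_comp (@smooth_flat 0) (fun x _ => I) (ST_id setT).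
have S1 := ST_comp (@smooth_flat 0) (fun x _ => I) (ST_onem setT).
exact: ST_mul S0 (ST_comp (@smooth_on_powR R (-1)) (fun x _ => den_gt0 x) (ST_add S0 S1)).
Qed.

Lemma step_derive (t : R) : is_derive t 1 step (derive1 step t).
Proof. by rewrite derive1E; apply: derivableP; exact: (smooth_step (k := 0)). Qed.

Lemma step_derive_bound : exists2 B : R, 0 <= B & forall t, `|derive1 step t| <= B.
Proof.
have c : continuous (derive1 step).
  move=> t; apply: differentiable_continuous; apply/derivable1_diffP.
  exact: (smooth_step (k := 1)).
have cn : {within `[0, 1], continuous (fun t => `|derive1 step t|)}.
  apply: continuous_subspaceT => t; apply: continuous_comp; first exact: c.
  exact: norm_continuous.
have [x _ xmax] := EVT_max ler01 cn.
exists `|derive1 step x|; first exact: normr_ge0.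
move=> t.
have [t0|t0] := ltP t 0.
  rewrite derive1E (@near_eq_derive _ _ _ _ (cst (0 : R))) ?derive_cst ?normr0//.
  by apply: filterS (lt_nbhsl t0) => y y0; rewrite step_eq0// ltW.
have [t1|t1] := ltP 1 t.
  rewrite derive1E (@near_eq_derive _ _ _ _ (cst (1 : R))) ?derive_cst ?normr0//.
  by apply: filterS (lt_nbhsr t1) => y y0; rewrite step_eq1// ltW.
by apply: xmax; rewrite in_itv/= t0.
Qed.

Lemma step_exists : exists (st dst : R -> R) (B : R),
  [/\ smooth_on setT st, forall t : R, is_derive t 1 st (dst t),
      0 <= B /\ (forall t, `|dst t| <= B), forall t, 0 <= st t <= 1 &
      (forall t, t <= 0 -> st t = 0) /\ (forall t, 1 <= t -> st t = 1)].
Proof.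
have [B B0 HB] := step_derive_bound.
exists step, (derive1 step), B; split.
- exact: smooth_step.
- exact: step_derive.
- by split.
- by move=> t; rewrite step_ge0 step_le1.
- by split; [exact: step_eq0|exact: step_eq1].
Qed.

(** [B] is chosen before [M]: the two transitions are a translate and a reflected translate of one
    step, so a longer plateau does not make them steeper. This keeps their cost bounded as [M]
    grows. *)
Lemma plateau_exists : exists (pl dpl : R -> R -> R) (B : R),
  [/\ forall M, smooth_on setT (pl M),
      forall M y : R, is_derive y 1 (pl M) (dpl M y),
      0 <= B /\ (forall M y, `|dpl M y| <= B),
      forall M y, 0 <= pl M y <= 1 &
      [/\ forall M y, `|y| <= M -> pl M y = 1, forall M y, M + 1 <= `|y| -> pl M y = 0,
          forall M y, `|y| < M -> dpl M y = 0 & forall M y, M + 1 < `|y| -> dpl M y = 0]].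
Proof.
have [st [dst [B [Sst Dst [B0 HB] st01 [st0 st1]]]]] := step_exists.
have st_ge0 t : 0 <= st t by case/andP: (st01 t).
have st_le1 t : st t <= 1 by case/andP: (st01 t).
pose pl (M y : R) := st (M + 1 - y) * st (M + 1 + y).
pose dpl (M y : R) := st (M + 1 - y) * dst (M + 1 + y) - st (M + 1 + y) * dst (M + 1 - y).
have pl_eq1 M y : `|y| <= M -> pl M y = 1.
  by rewrite ler_norml /pl => /andP[a b]; rewrite !st1 ?mulr1//; lra.
have pl_eq0 M y : M + 1 <= `|y| -> pl M y = 0.
  move=> yM; rewrite /pl; have [y0|y0] := leP 0 y.
    by rewrite (st0 (M + 1 - y)) ?mul0r// subr_le0 -(ger0_norm y0).
  by rewrite mulrC (st0 (M + 1 + y)) ?mul0r// -[y]opprK subr_le0 -(ltr0_norm y0).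
have Dpl (M y : R) : is_derive y 1 (pl M) (dpl M y).
  have d1 : is_derive y 1 (fun x : R => M + 1 - x) (-1).
    have := is_deriveB (is_derive_cst (M + 1) y 1) (is_derive_id y (1 : R)).
    by rewrite sub0r.
  have d2 : is_derive y 1 (fun x : R => M + 1 + x) 1.
    have := is_deriveD (is_derive_cst (M + 1) y 1) (is_derive_id y (1 : R)).
    by rewrite add0r.
  have D1 : is_derive y 1 (fun x => st (M + 1 - x)) (dst (M + 1 - y) * -1).
    exact: is_derive1_comp (Dst _) d1.
  have D2 : is_derive y 1 (fun x => st (M + 1 + x)) (dst (M + 1 + y) * 1).
    exact: is_derive1_comp (Dst _) d2.
  apply: (is_derive_eq (is_derive_mulr D1 D2)).
  by rewrite /dpl mulr1 mulrN1 mulrN.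
exists pl, dpl, (B + B); split.
- move=> M; apply: smooth_term_on; first exact: openT.
  have S1 : smooth_term setT (fun x : R => M + 1 - x).
    have := ST_add (ST_cst setT (M + 1)) (ST_mul (ST_cst setT (-1)) (ST_id setT)).
    by rewrite (_ : (fun x => _) = (fun x : R => M + 1 - x))//; apply/funext => x; rewrite mulN1r.
  have S2 := ST_add (ST_cst setT (M + 1)) (ST_id setT).
  exact: ST_mul (ST_comp Sst (fun x _ => I) S1) (ST_comp Sst (fun x _ => I) S2).
- exact: Dpl.
- split=> [|M y]; first exact: addr_ge0.
  rewrite (le_trans (ler_normB _ _))// !normrM !(ger0_norm (st_ge0 _)).
  by apply: lerD; rewrite (le_trans (ler_piMl _ (st_le1 _)))// ?normr_ge0.
- by move=> M y; rewrite mulr_ge0//= mulr_ile1.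
- split; [exact: pl_eq1|exact: pl_eq0| |]; move=> M y yM; have [_ <-] := Dpl M y.
    rewrite (@near_eq_derive _ _ _ _ (cst (1 : R))) ?derive_cst//.
    have H : \forall x \near `|y|, x < M by exact: lt_nbhsl.
    have H2 : \forall x \near y, `|x| < M by exact: (@norm_continuous _ _ y _ H).
    by apply: filterS H2 => x /ltW xM; rewrite pl_eq1.
  rewrite (@near_eq_derive _ _ _ _ (cst (0 : R))) ?derive_cst//.
  have H : \forall x \near `|y|, M + 1 < x by exact: lt_nbhsr.
  have H2 : \forall x \near y, M + 1 < `|x| by exact: (@norm_continuous _ _ y _ H).
  by apply: filterS H2 => x /ltW xM; rewrite pl_eq0.
Qed.

End plateau.

Lemma powR_comparable {R : realType} (th s x r : R) : 1 <= th -> 0 < s -> 0 < x ->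
  s <= th * x -> x <= th * s -> x `^ r <= th `^ `|r| * s `^ r.
Proof.
move=> th1 s0 x0 sx xs; have th0 : 0 < th by exact: lt_le_trans th1.
have [r0|r0] := leP 0 r.
  rewrite ger0_norm// -(powRM _ (ltW th0) (ltW s0)).
  by apply: ge0_ler_powR => //; rewrite nnegrE ?mulr_ge0 ?(ltW x0) ?(ltW th0) ?(ltW s0).
rewrite ltr0_norm// -[r in x `^ r]opprK -[r in s `^ r]opprK (powRN x) (powRN s).
have xp : 0 < x `^ (- r) by rewrite powR_gt0.
have sp : 0 < s `^ (- r) by rewrite powR_gt0.
rewrite -[leLHS]mul1r ler_pdivlMr// mulrAC ler_pdivrMr// mul1r -(powRM _ (ltW th0) (ltW x0)).
have r1 : 0 <= - r by rewrite oppr_ge0 ltW.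
by apply: ge0_ler_powR => //; rewrite nnegrE ?mulr_ge0 ?(ltW x0) ?(ltW th0) ?(ltW s0).
Qed.

(** * Optimality *)

Section profile.
Context {R : realType}.
Local Notation mu := (@lebesgue_measure R).
Variables (pl dpl : R -> R -> R) (B : R).
Hypothesis pl_smooth : forall M, smooth_on setT (pl M).
Hypothesis pl_derive : forall M y : R, is_derive y 1 (pl M) (dpl M y).
Hypothesis dpl_bound : forall M y, `|dpl M y| <= B.
Hypothesis pl_bound : forall M y, 0 <= pl M y <= 1.
Hypothesis pl_eq1 : forall M y, `|y| <= M -> pl M y = 1.
Hypothesis pl_eq0 : forall M y, M + 1 <= `|y| -> pl M y = 0.
Hypothesis dpl_in : forall M y, `|y| < M -> dpl M y = 0.
Hypothesis dpl_out : forall M y, M + 1 < `|y| -> dpl M y = 0.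
Variables (nm p g : R).
Hypotheses (nm0 : 0 < nm) (p1 : 1 < p) (g1 : 1 < g).

Let p0 : 0 < p. Proof. exact: lt_trans p1. Qed.
Let nmn0 : nm != 0. Proof. by rewrite gt_eqF. Qed.
Variable al : R.
Hypotheses (al0 : 0 < al) (alE : al * p = g - 1).

(* On an orbit whose point [u = 1] has quasi-norm [R], [slog u = log (R / |x|)];
   [uexp] inverts [ln \o slog]. *)
Definition slog (u : R) : R := - nm^-1 * ln u.
Definition uexp (y : R) : R := expR (- (nm * expR y)).
Let v (u : R) := (nm * u)^-1.

Lemma uexp_gt0 y : 0 < uexp y. Proof. exact: expR_gt0. Qed.

Lemma uexp_lt1 y : uexp y < 1.
Proof. by rewrite expR_lt1 oppr_lt0 mulr_gt0 ?expR_gt0. Qed.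

Lemma le_uexp x y : (uexp x <= uexp y) = (y <= x).
Proof. by rewrite ler_expR lerN2 ler_pM2l// ler_expR. Qed.

Lemma slog_gt0 u : 0 < u < 1 -> 0 < slog u.
Proof.
by move=> u01; rewrite /slog mulNr -mulrN mulr_gt0 ?invr_gt0// oppr_gt0 ln_lt0.
Qed.

Lemma slog_uexp y : slog (uexp y) = expR y.
Proof. by rewrite /slog /uexp expRK mulrNN mulKf. Qed.

Lemma uexpK u : 0 < u < 1 -> uexp (ln (slog u)) = u.
Proof.
move=> u01; rewrite /uexp lnK ?posrE ?slog_gt0// /slog mulNr mulrN opprK mulVKf//.
by rewrite lnK// posrE; case/andP: u01.
Qed.

Lemma uexp_itv a b u : (uexp b <= u <= uexp a) = (0 < u < 1) && (a <= ln (slog u) <= b).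
Proof.
apply/idP/idP => [/andP[bu ua]|/andP[u01 /andP[au ub]]].
  have u01 : 0 < u < 1.
    by rewrite (lt_le_trans (uexp_gt0 b))//= (le_lt_trans ua)// uexp_lt1.
  by rewrite u01/= -(le_uexp _ a) -(le_uexp b) uexpK// ua bu.
by rewrite -(uexpK u01) !le_uexp ub au.
Qed.

Lemma slog_derive (u : R) : 0 < u -> is_derive u 1 slog (- v u).
Proof.
move=> u0; have H := is_deriveZ (- nm^-1) (is_derive1_ln u0).
by apply: (is_derive_eq H); rewrite /GRing.scale/= mulNr /v invfM.
Qed.

(** Near 0 and near 1 the double logarithm is large in absolute value, so the plateau function
    already vanishes there and the extension by 0 is smooth. *)
Definition cutoff (M : R) (z : R -> R) (u : R) : R :=
  if 0 < u < 1 then pl M (ln (slog u)) * z u else 0.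

Let O : set R := `]0, 1[%classic.
Let oO : open O. Proof. exact: interval_open. Qed.
Let OP u : O u = (0 < u < 1). Proof. by rewrite /O/= in_itv. Qed.

Let ST_slog : smooth_term O slog.
Proof.
have lnS : smooth_term O (fun u => ln u).
  by apply: (ST_comp smooth_on_ln) (ST_id O) => x; rewrite OP => /andP[].
exact: (ST_mul (ST_cst O (- nm^-1)) lnS).
Qed.

Lemma cutoff_eq0 M z u : ~ (uexp (M + 1) <= u <= uexp (- (M + 1))) -> cutoff M z u = 0.
Proof.
rewrite /cutoff uexp_itv; case: ifP => //= u01 nb; rewrite pl_eq0 ?mul0r//.
by rewrite leNgt; apply/negP => /ltW; rewrite ler_norml.
Qed.

Lemma smooth_cutoff M z : smooth_term O z -> smooth_on setT (cutoff M z).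
Proof.
move=> sz; apply: (@smooth_on_support _ O (uexp (M + 1)) (uexp (- (M + 1)))) => //.
- by move=> x; rewrite uexp_itv OP => /andP[].
- by move=> x; exact: cutoff_eq0.
apply: (smooth_on_eq (f := fun u => pl M (ln (slog u)) * z u)) => //.
  by move=> x; rewrite OP /cutoff => ->.
apply: smooth_term_on => //.
have S1 : smooth_term O (fun u => ln (slog u)).
  by apply: (ST_comp smooth_on_ln) ST_slog => x; rewrite OP; exact: slog_gt0.
refine (ST_mul (f := fun u => pl M (ln (slog u))) _ sz).
exact: (ST_comp (pl_smooth (M := M)) (fun x _ => Logic.I) S1).
Qed.

Definition profile (M : R) : R -> R := cutoff M (fun u => slog u `^ al).
(** With [M + 1] in place of [M], the plateau covers the whole support of [profile M], where
    $|\log\mathrm{slog}\,u| \le M + 1$; this is what [invpowE] needs. *)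
Definition invpow (M a : R) : R -> R := cutoff (M + 1) (fun u => u `^ (- a)).

Lemma smooth_profile M : smooth_on setT (profile M).
Proof.
apply: smooth_cutoff; apply: (ST_comp (@smooth_on_powR R al)) ST_slog => x.
by rewrite OP; exact: slog_gt0.
Qed.

Lemma smooth_invpow M a : smooth_on setT (invpow M a).
Proof.
apply: smooth_cutoff; apply: (ST_comp (@smooth_on_powR R (- a))) (ST_id O) => x.
by rewrite OP => /andP[].
Qed.

Lemma profile_neq0 M u : profile M u != 0 -> uexp (M + 1) <= u <= uexp (- (M + 1)).
Proof.
by move=> /eqP pn0; apply/negPn/negP => /negP nb; apply: pn0; exact: cutoff_eq0.
Qed.

Lemma invpowE M a u : profile M u != 0 -> invpow M a u = u `^ (- a).
Proof.
move=> /profile_neq0; rewrite uexp_itv => /andP[u01 nb].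
by rewrite /invpow /cutoff u01 pl_eq1 ?mul1r// ler_norml.
Qed.

(** In the variable $y = \log \mathrm{slog}\,u$ the profile is $e^{\alpha y}$ times the plateau, and
    $dy/du = -v/\mathrm{slog}\,u$. *)
Definition dprofile (M u : R) : R := if 0 < u < 1 then
  - (v u * slog u `^ (al - 1) * (al * pl M (ln (slog u)) + dpl M (ln (slog u)))) else 0.

Lemma profile_derive M (u : R) : 0 < u -> is_derive u 1 (profile M) (dprofile M u).
Proof.
move=> u0; rewrite /dprofile; case: ifPn => [u01|].
  have s0 := slog_gt0 u01; have sn0 : slog u != 0 by rewrite gt_eqF.
  have ds := slog_derive u0.
  have d1 : is_derive u 1 (fun x => slog x `^ al) (al * slog u `^ (al - 1) * - v u).
    exact: (is_derive1_comp (is_derive1_powR al s0) ds).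
  have d2 : is_derive u 1 (fun x => ln (slog x)) ((slog u)^-1 * - v u).
    exact: (is_derive1_comp (is_derive1_ln s0) ds).
  have d3 : is_derive u 1 (fun x => pl M (ln (slog x)))
      (dpl M (ln (slog u)) * ((slog u)^-1 * - v u)).
    exact: (is_derive1_comp (pl_derive M _) d2).
  have H := is_derive_mulr d3 d1.
  have E : - (v u * slog u `^ (al - 1) * (al * pl M (ln (slog u)) + dpl M (ln (slog u)))) =
     pl M (ln (slog u)) * (al * slog u `^ (al - 1) * - v u) +
     slog u `^ al * (dpl M (ln (slog u)) * ((slog u)^-1 * - v u)).
    rewrite powRB ?sn0 ?implybT// powRr1 ?(ltW s0)//.
    move: (slog u) sn0 (v u) (slog u `^ al) (dpl M (ln (slog u))) (pl M (ln (slog u))) (al).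
    move=> e en0 d c b a k.
    by field.
  rewrite E; apply: (near_eq_is_derive _ H).
  have nO : nbhs u O by apply: open_nbhs_nbhs; split => //; rewrite OP.
  by apply: filterS nO => x; rewrite OP /profile /cutoff => ->.
rewrite u0/= -leNgt => u1.
apply: (near_eq_is_derive _ (is_derive_cst 0 u 1)).
have u2 : uexp (- (M + 1)) < u by exact: lt_le_trans (uexp_lt1 _) u1.
apply: filterS (lt_nbhsr u2) => x xu; rewrite /profile cutoff_eq0//.
by move=> /andP[_]; rewrite leNgt xu.
Qed.

(** The density of $|dy|$ for $y = \log \mathrm{slog}\,u$, so that its integrals are lengths of
    intervals in [y]. *)
Let w (u : R) := v u * slog u `^ (-1).

Lemma integral_profile_weight a b : a < b ->
  (\int[mu]_(u in `]0%R, +oo[) (w u * \1_(`[uexp b, uexp a]%classic : set R) u)%:E = (b - a)%:E)%E.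
Proof.
move=> ab.
have ub : uexp b < uexp a by rewrite ltNge le_uexp -ltNge.
have seg u : u \in `[uexp b, uexp a] -> 0 < u < 1.
  by rewrite in_itv/= uexp_itv => /andP[].
have sub : `[uexp b, uexp a]%classic `<=` (`]0%R, +oo[%classic : set R).
  by move=> u /seg/andP[u0 _] /=; rewrite in_itv/= u0.
transitivity (\int[mu]_(u in `[uexp b, uexp a]) (w u)%:E)%E.
  rewrite -{2}(setIidr sub) integral_mkcondr; apply: eq_integral => u _.
  by rewrite patchE indicE; case: ifPn => _; rewrite ?mulr1 ?mulr0.
have dF (u : R) : 0 < u < 1 -> is_derive u 1 (fun x => - ln (slog x)) (w u).
  move=> u01; have s0 := slog_gt0 u01; have u0 : 0 < u by case/andP: u01.
  have d2 : is_derive u 1 (fun x => ln (slog x)) ((slog u)^-1 * - v u).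
    exact: (is_derive1_comp (is_derive1_ln s0) (slog_derive u0)).
  by apply: (is_derive_eq (is_deriveN d2)); rewrite mulrN opprK mulrC /w powR_inv1 ?(ltW s0).
have cF (u : R) : 0 < u < 1 -> {for u, continuous (fun x => - ln (slog x))}.
  by move=> /dF[/derivable1_diffP + _]; exact: differentiable_continuous.
have cw (u : R) : 0 < u < 1 -> {for u, continuous w}.
  move=> u01; have s0 := slog_gt0 u01; have u0 : 0 < u by case/andP: u01.
  apply: continuousM.
    apply: (@continuousV _ _ (fun x : R => nm * x)); first by rewrite gt_eqF// mulr_gt0.
    by apply: (@continuousM _ _ (cst nm) id); [exact: cst_continuous|].
  apply: (@continuous_comp _ _ _ slog (fun x : R => x `^ (-1))); last exact: continuous_powR_gt0.
  by have [/derivable1_diffP + _] := slog_derive u0; exact: differentiable_continuous.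
rewrite (continuous_FTC2 (F := fun x => - ln (slog x)) ub).
- by rewrite !slog_uexp !expRK -EFinB; congr EFin; lra.
- by apply: continuous_in_subspaceT => u; rewrite inE => /seg; exact: cw.
- split.
  + by move=> u /subset_itv_oo_cc/seg/dF[].
  + apply: cvg_at_right_filter; apply: cF; apply: seg; by rewrite in_itv/= lexx ltW.
  + apply: cvg_at_left_filter; apply: cF; apply: seg; by rewrite in_itv/= lexx ltW.
- by move=> u /subset_itv_oo_cc/seg/dF[_ <-]; rewrite derive1E.
Qed.

(** [om] stands for the logarithm on an orbit of the cone whose point [u = 1] has quasi-norm merely
    close to [R]; the exact extremal belongs to [slog], and [th] bounds the discrepancy on the
    support. *)
Variables (M th : R) (om : R -> R).
Hypotheses (M0 : 0 < M) (th1 : 1 <= th).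
Hypothesis om_slog : forall u, uexp (M + 1) <= u <= uexp (- (M + 1)) ->
  [/\ 0 < `|om u|, slog u <= th * `|om u| & `|om u| <= th * slog u].

Let th0 : 0 < th. Proof. exact: lt_le_trans th1. Qed.

Let I a b (u : R) : R := \1_(`[uexp b, uexp a]%classic : set R) u.

Let IE a b u : I a b u = ((uexp b <= u <= uexp a)%R : bool)%:R.
Proof.
rewrite /I indicE; congr (nat_of_bool _)%:R.
by apply/idP/idP => [/set_mem|ub]; [rewrite /= in_itv|rewrite mem_set//= in_itv].
Qed.

(** On the plateau, [slog] in place of [om] would give $\mathrm{slog}^{\alpha p - \gamma}\,v$, which
    is [w u] because $\alpha p = \gamma - 1$. Passing to [om] costs $\theta^{-\gamma}$. *)
Lemma profile_hardyL u : 0 < u ->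
  th `^ (- g) * (w u * I (- M) M u) <= hardyL p g (profile M) (fun u => `|om u|) v u.
Proof.
move=> u0; have v0 : 0 < v u by rewrite invr_gt0 mulr_gt0.
rewrite IE; case: (boolP (_ <= _ <= _)) => [|_]; last first.
  by rewrite !mulr0 hardyL_ge0// ltW.
rewrite uexp_itv => /andP[u01 yM]; rewrite mulr1.
have s0 := slog_gt0 u01; have sn0 : slog u != 0 by rewrite gt_eqF.
have ub : uexp (M + 1) <= u <= uexp (- (M + 1)).
  by rewrite uexp_itv u01/=; case/andP: yM => y1 y2; apply/andP; split; lra.
have [om0 so os] := om_slog ub.
rewrite /hardyL /profile /cutoff u01 pl_eq1 ?ler_norml// mul1r.
rewrite (ger0_norm (powR_ge0 _ _)) -powRrM alE.
have := powR_comparable (- g) th1 om0 s0 os so.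
have g0 : 0 < g by exact: lt_trans g1.
rewrite normrN (gtr0_norm g0) => H.
have -> : w u = slog u `^ (g - 1) * slog u `^ (- g) * v u.
  rewrite -powRD ?sn0 ?implybT// (_ : g - 1 - g = -1); last by ring.
  by rewrite mulrC.
rewrite mulrA ler_pM2r// mulrCA ler_pM2l ?powR_gt0//.
by rewrite powRN mulrC ler_pdivrMr ?powR_gt0// mulrC.
Qed.

(** Again all powers of [slog] combine to the exponent $-1$. The remaining factor $|\alpha\,pl +
    dpl|$ is $\alpha$ inside the plateau, at most $\alpha + B$ in the transitions and 0 beyond;
    passing to [om] costs $\theta^{|p-\gamma|} \le \theta^{p+\gamma}$. *)
Lemma profile_hardyR u : 0 < u ->
  hardyR p g (dprofile M) (fun u => `|om u|) v u <=
  th `^ (p + g) * (al `^ p * (w u * I (- M) M u) +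
    (al + B) `^ p * (w u * I M (M + 1) u + w u * I (- (M + 1)) (- M) u)).
Proof.
move=> u0; have v0 : 0 < v u by rewrite invr_gt0 mulr_gt0.
have vn0 : v u != 0 by rewrite gt_eqF.
rewrite /hardyR /dprofile; case: ifPn => [u01|nu01]; last first.
  rewrite normr0 powR0 ?gt_eqF// !mul0r !IE !uexp_itv (negbTE nu01)/= !mulr0.
  by rewrite addr0 mulr0 addr0 mulr0.
have s0 := slog_gt0 u01; have sn0 : slog u != 0 by rewrite gt_eqF.
have w0 : 0 < w u by rewrite mulr_gt0 ?powR_gt0.
have B0 : 0 <= B by exact: le_trans (dpl_bound 0 0).
set y := ln (slog u); set E := al * pl M y + dpl M y.
have EP : `|E| `^ p <= al `^ p * I (- M) M u +
    (al + B) `^ p * (I M (M + 1) u + I (- (M + 1)) (- M) u).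
  rewrite !IE !uexp_itv u01/= -/y.
  have [yM|yM] := ltP `|y| M.
    have -> : -M <= y <= M by rewrite -ler_norml ltW.
    rewrite /E dpl_in// pl_eq1 ?(ltW yM)// !mulr1 addr0 (gtr0_norm al0) lerDl.
    by rewrite mulr_ge0 ?powR_ge0// addr_ge0.
  have [yM1|yM1] := leP `|y| (M + 1); last first.
    rewrite /E dpl_out// pl_eq0 ?(ltW yM1)// mulr0 addr0 normr0 powR0 ?gt_eqF//.
    by rewrite addr_ge0// mulr_ge0 ?powR_ge0// addr_ge0.
  have EB : `|E| `^ p <= (al + B) `^ p.
    rewrite ge0_ler_powR ?nnegrE ?(ltW p0) ?addr_ge0 ?(ltW al0)//.
    rewrite (le_trans (ler_normD _ _))// lerD// normrM (gtr0_norm al0).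
    by rewrite ler_piMr ?(ltW al0)//; case/andP: (pl_bound M y) => a b; rewrite ger0_norm.
  apply: (le_trans EB); rewrite -[leLHS]add0r lerD ?mulr_ge0 ?powR_ge0//.
  rewrite ler_peMr ?powR_ge0//.
  move: yM yM1; rewrite ler_norml; case: (ler0P y) => y0 yM /andP[y1 y2].
    by rewrite y1 (_ : y <= - M) ?lerDr//; lra.
  by rewrite yM y2 lerDl.
have ub : `|y| <= M + 1 -> [/\ 0 < `|om u|, slog u <= th * `|om u| & `|om u| <= th * slog u].
  by move=> yM; apply: om_slog; rewrite uexp_itv u01/= -ler_norml.
have [yM1|yM1] := leP `|y| (M + 1); last first.
  have -> : E = 0 by rewrite /E dpl_out// pl_eq0 ?(ltW yM1)// mulr0 addr0.
  rewrite mulr0 oppr0 normr0 powR0 ?gt_eqF// !mul0r mulr_ge0 ?powR_ge0//.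
  have I0 a b : 0 <= I a b u by rewrite IE ler0n.
  have wI a b : 0 <= w u * I a b u by rewrite mulr_ge0 ?I0 ?(ltW w0).
  by apply: addr_ge0; apply: mulr_ge0; rewrite ?powR_ge0 ?addr_ge0 ?wI.
have [om0 so os] := ub yM1.
have H := powR_comparable (p - g) th1 s0 om0 so os.
have thE : th `^ `|p - g| <= th `^ (p + g).
  by rewrite ler_powR// (le_trans (ler_normB _ _))// !gtr0_norm// (lt_trans _ g1).
rewrite normrN !normrM (gtr0_norm v0) (ger0_norm (powR_ge0 _ _)).
have vs0 : 0 <= v u * slog u `^ (al - 1) by rewrite mulr_ge0 ?powR_ge0 ?(ltW v0).
rewrite (powRM _ vs0 (normr_ge0 _)) (powRM _ (ltW v0) (powR_ge0 _ _)) -powRrM.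
have -> : v u `^ (1 - p) = v u / v u `^ p.
  by rewrite powRB ?vn0 ?implybT// powRr1 ?(ltW v0).
have vp : v u `^ p != 0 by rewrite gt_eqF// powR_gt0.
have sE : slog u `^ ((al - 1) * p) * slog u `^ (p - g) = (slog u)^-1.
  rewrite -powRD ?sn0 ?implybT// (_ : (al - 1) * p + (p - g) = -1).
    by rewrite powR_inv1// ltW.
  by rewrite mulrBl alE mul1r; ring.
rewrite (_ : _ * _ * _ * _ * _ = v u * slog u `^ ((al - 1) * p) * `|E| `^ p * `|om u| `^ (p - g)); last first.
  move: (v u) (v u `^ p) vp (slog u `^ _) (`|E| `^ p) (`|om u| `^ _) => a b b0 c d e.
  by field.
apply: (@le_trans _ _ (v u * slog u `^ ((al - 1) * p) * `|E| `^ p *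
    (th `^ (p + g) * slog u `^ (p - g)))).
  rewrite ler_wpM2l ?mulr_ge0 ?powR_ge0 ?(ltW v0)// (le_trans H)//.
  by rewrite ler_wpM2r ?powR_ge0.
rewrite (_ : v u * _ * _ * _ = th `^ (p + g) * (w u * `|E| `^ p)); last first.
  rewrite /w powR_inv1 ?(ltW s0)// -sE; move: (v u) (slog u `^ _) (slog u `^ _) (`|E| `^ p) (th `^ _) => a b c d e.
  by ring.
rewrite ler_pM2l ?powR_gt0//.
have := ler_wpM2l (ltW w0) EP.
move/le_trans; apply; rewrite le_eqVlt; apply/orP; left; apply/eqP.
move: (w u) (I _ _ u) (I _ _ u) (I _ _ u) (al `^ p) ((al + B) `^ p) => a b c d e f.
by ring.
Qed.

Hypothesis mom : measurable_fun (`]0, +oo[%classic : set R) om.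

Let D : set R := `]0, +oo[%classic.
Let DP u : D u <-> 0 < u. Proof. by rewrite /D/= in_itv/= andbT. Qed.
Let mD : measurable D. Proof. exact: measurable_itv. Qed.

Lemma measurable_inv_scale : measurable_fun D (fun u => (nm * u)^-1).
Proof.
apply: measurable_halfline => u u0.
apply: (@continuousV _ _ (fun x : R => nm * x)); first by rewrite gt_eqF// mulr_gt0.
by apply: (@continuousM _ _ (cst nm) id); [exact: cst_continuous|].
Qed.

Let mw a b : measurable_fun D (fun u => (w u * I a b u)%:E).
Proof.
apply/measurable_EFinP; apply: measurable_funM; last exact: measurable_indic.
apply: measurable_funM; first exact: measurable_inv_scale.
apply: (measurableT_comp (measurable_powR _)).
apply: measurable_halfline => u u0.
by have [/derivable1_diffP + _] := slog_derive u0; exact: differentiable_continuous.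
Qed.

Let w_ge0 a b u : D u -> 0 <= w u * I a b u.
Proof.
by move=> /DP u0; rewrite !mulr_ge0 ?powR_ge0// invr_ge0 mulr_ge0 ?ltW.
Qed.

Lemma measurable_profile : measurable_fun D (profile M).
Proof.
apply: measurable_halfline => u u0.
have [/derivable1_diffP + _] := profile_derive M u0; exact: differentiable_continuous.
Qed.

Lemma measurable_dprofile : measurable_fun D (dprofile M).
Proof.
have : measurable_fun D (derive1 (profile M)).
  apply: measurable_halfline => u u0; apply: differentiable_continuous.
  by apply/derivable1_diffP; exact: (@smooth_profile M 1%N u Logic.I).
apply: eq_measurable_fun => u /set_mem/DP u0.
by rewrite derive1E; have [_ ->] := profile_derive M u0.
Qed.

Lemma profile_integral_hardyL :
  ((th `^ (- g) * (M + M))%:E <=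
   \int[mu]_(u in `]0%R, +oo[) (hardyL p g (profile M) (fun u => `|om u|) v u)%:E)%E.
Proof.
have MM : - M < M by rewrite (@lt_trans _ _ 0)// oppr_lt0.
have := integral_profile_weight MM; rewrite opprK => WE.
have T0 : (0 <= (th `^ (- g))%:E)%E by rewrite lee_fin powR_ge0.
rewrite EFinM -WE -ge0_integralZl//; [|exact: mw|by move=> u Du; rewrite lee_fin w_ge0].
apply: ge0_le_integral => //.
- by move=> u Du; rewrite -EFinM lee_fin mulr_ge0 ?powR_ge0 ?w_ge0.
- by apply: emeasurable_funM => //; exact: mw.
- exact: (measurable_hardyL p g measurable_profile mom measurable_inv_scale).
- by move=> u /DP u0; rewrite -EFinM lee_fin profile_hardyL.
Qed.

(** The plateau has length $2M$ in [y], and the summand with factor 2 comes from two transitions of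
    length 1. *)
Lemma profile_integral_hardyR :
  (\int[mu]_(u in `]0%R, +oo[) (hardyR p g (dprofile M) (fun u => `|om u|) v u)%:E <=
   (th `^ (p + g) * (al `^ p * (M + M) + (al + B) `^ p * 2))%:E)%E.
Proof.
have M1 : - M < M by rewrite (@lt_trans _ _ 0)// oppr_lt0.
have M2 : M < M + 1 by lra.
have M3 : - (M + 1) < - M by lra.
have W1 : (\int[mu]_(u in D) (w u * I (- M) M u)%:E = (M - - M)%:E)%E.
  exact: integral_profile_weight.
have W2 : (\int[mu]_(u in D) (w u * I M (M + 1) u)%:E = (M + 1 - M)%:E)%E.
  exact: integral_profile_weight.
have W3 : (\int[mu]_(u in D) (w u * I (- (M + 1)) (- M) u)%:E = (- M - - (M + 1))%:E)%E.
  exact: integral_profile_weight.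
have A0 : (0 <= (al `^ p)%:E)%E by rewrite lee_fin powR_ge0.
have B0 : (0 <= ((al + B) `^ p)%:E)%E by rewrite lee_fin powR_ge0.
have T0 : (0 <= (th `^ (p + g))%:E)%E by rewrite lee_fin powR_ge0.
have wE a b u : D u -> (0 <= (w u * I a b u)%:E)%E by move=> Du; rewrite lee_fin w_ge0.
have wsE u : D u -> (0 <= (w u * I M (M + 1) u)%:E + (w u * I (- (M + 1)) (- M) u)%:E)%E.
  by move=> Du; rewrite adde_ge0// wE.
pose G u : \bar R := ((th `^ (p + g))%:E * ((al `^ p)%:E * (w u * I (- M) M u)%:E +
    ((al + B) `^ p)%:E * ((w u * I M (M + 1) u)%:E + (w u * I (- (M + 1)) (- M) u)%:E)))%E.
have mG1 : measurable_fun D (fun u => (al `^ p)%:E * (w u * I (- M) M u)%:E)%E.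
  by apply: emeasurable_funM => //; exact: mw.
have mG2 : measurable_fun D (fun u => (w u * I M (M + 1) u)%:E + (w u * I (- (M + 1)) (- M) u)%:E)%E.
  by apply: emeasurable_funD; exact: mw.
have mG3 : measurable_fun D (fun u => ((al + B) `^ p)%:E *
    ((w u * I M (M + 1) u)%:E + (w u * I (- (M + 1)) (- M) u)%:E))%E.
  by apply: emeasurable_funM.
have mG4 := emeasurable_funD mG1 mG3.
apply: (@le_trans _ _ (\int[mu]_(u in D) G u)%E).
  apply: ge0_le_integral => //.
  - by move=> u _; rewrite lee_fin hardyR_ge0.
  - exact: (measurable_hardyR p g measurable_dprofile mom measurable_inv_scale).
  - by apply: emeasurable_funM.
  - move=> u /DP u0; have -> : G u = (th `^ (p + g) * (al `^ p * (w u * I (- M) M u) +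
      (al + B) `^ p * (w u * I M (M + 1) u + w u * I (- (M + 1)) (- M) u)))%:E by [].
    by rewrite lee_fin profile_hardyR.
have G1 u : D u -> (0 <= (al `^ p)%:E * (w u * I (- M) M u)%:E)%E.
  by move=> Du; rewrite mule_ge0// wE.
have G3 u : D u -> (0 <= ((al + B) `^ p)%:E *
    ((w u * I M (M + 1) u)%:E + (w u * I (- (M + 1)) (- M) u)%:E))%E.
  by move=> Du; rewrite mule_ge0// wsE.
have G4 u : D u -> (0 <= (al `^ p)%:E * (w u * I (- M) M u)%:E + ((al + B) `^ p)%:E *
    ((w u * I M (M + 1) u)%:E + (w u * I (- (M + 1)) (- M) u)%:E))%E.
  by move=> Du; rewrite adde_ge0// ?G1 ?G3.
have -> : (\int[mu]_(u in D) G u = (th `^ (p + g) * (al `^ p * (M - - M) + (al + B) `^ p *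
    (M + 1 - M + (- M - - (M + 1)))))%:E)%E.
  rewrite (ge0_integralZl mu mD mG4 G4 T0) (ge0_integralD mu mD G1 mG1 G3 mG3).
  rewrite (ge0_integralZl mu mD (mw _ _) (@wE _ _) A0) (ge0_integralZl mu mD mG2 wsE B0).
  rewrite (ge0_integralD mu mD (@wE _ _) (mw _ _) (@wE _ _) (mw _ _)).
  transitivity ((th `^ (p + g))%:E * ((al `^ p)%:E * (M - - M)%:E + ((al + B) `^ p)%:E *
    ((M + 1 - M)%:E + (- M - - (M + 1))%:E)))%E; last by [].
  by congr (_ * (_ * _ + _ * (_ + _)))%E; [exact: W1|exact: W2|exact: W3].
rewrite lee_fin opprK (_ : M + 1 - M = 1); last by ring.
by rewrite (_ : - M - - (M + 1) = 1) //; ring.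
Qed.

End profile.

(** * The test function and its two integrals *)

Section test_function.
Context {R : realType} (n : nat) (nu : 'I_n.+1 -> R) (qn : 'rV[R]_n.+1 -> R) (p g al : R).
Hypothesis nu0 : forall i, 0 < nu i.
Hypotheses (cqn : continuous qn) (qn_ge0 : forall x, 0 <= qn x)
  (qn_eq0 : forall x, qn x = 0 <-> x = 0)
  (qn_dil : forall l x, 0 < l -> qn (dil nu l x) = l * qn x).
Hypotheses (p1 : 1 < p) (g1 : 1 < g) (gp : g - 1 < p) (al0 : 0 < al) (alE : al * p = g - 1).
Local Notation mu := (@lebesgue_measure R).
Local Notation nm := (nu ord_max).
Local Notation Q := (hom_dim nu).
Local Notation base z := (\row_i upd n 1 z i : 'rV[R]_n.+1).

Variables (pl dpl : R -> R -> R) (B : R).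
Hypothesis pl_smooth : forall M, smooth_on setT (pl M).
Hypothesis pl_derive : forall M y : R, is_derive y 1 (pl M) (dpl M y).
Hypothesis dpl_bound : forall M y, `|dpl M y| <= B.
Hypothesis pl_bound : forall M y, 0 <= pl M y <= 1.
Hypothesis pl_eq1 : forall M y, `|y| <= M -> pl M y = 1.
Hypothesis pl_eq0 : forall M y, M + 1 <= `|y| -> pl M y = 0.
Hypothesis dpl_in : forall M y, `|y| < M -> dpl M y = 0.
Hypothesis dpl_out : forall M y, M + 1 < `|y| -> dpl M y = 0.

Variables (M th delta Rr : R).
Hypotheses (M0 : 0 < M) (th1 : 1 < th) (delta0 : 0 < delta) (Rr0 : 0 < Rr).
(** On the support of the profile [slog] is at least $e^{-(M+1)}$. This bound thus makes the
    logarithmic error of the base point at most the fraction $1 - \theta^{-1}$ of [slog]. *)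
Hypothesis box_log : forall z : nat -> R, (forall i : 'I_n, `|z i| <= delta) ->
  `|ln (Rr / qn (base z))| <= (1 - th^-1) * expR (- (M + 1)).

Let p0 : 0 < p. Proof. exact: lt_trans p1. Qed.
Let nm0 : 0 < nm. Proof. exact: nu0. Qed.
Let nmn0 : nm != 0. Proof. by rewrite gt_eqF. Qed.
Let th0 : 0 < th. Proof. exact: lt_trans th1. Qed.
Let v (u : R) := (nm * u)^-1.

Local Notation prof := (profile pl nm al M).
Local Notation dprof := (dprofile pl dpl nm al M).

(** The plateau with [M = 1], rescaled to be 1 up to [delta / 2] and 0 from [delta] on. *)
Definition bump (t : R) : R := pl 1 (2 / delta * t).
Definition bumps (z : nat -> R) : R := \prod_(i < n) bump (z i).
(* [invpow] is a globally smooth version of [u^(- nu_i / nu_N)] on the support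
   of [prof], so that the bumps depend only on the orbit of [x]. *)
Definition test_fun (x : 'rV[R]_n.+1) : R :=
  prof (x 0 ord_max) *
  \prod_(i < n) bump (x 0 (widen_ord (leqnSn n) i) *
                      invpow pl nm M (nu (widen_ord (leqnSn n) i) / nm) (x 0 ord_max)).
Local Notation f := test_fun.

Lemma bump_bound t : 0 <= bump t <= 1. Proof. exact: pl_bound. Qed.

Lemma bump_eq1 t : `|t| <= delta / 2 -> bump t = 1.
Proof.
move=> td; apply: pl_eq1; rewrite normrM gtr0_norm ?divr_gt0//.
by rewrite mulrAC ler_pdivrMr// mul1r mulrC -ler_pdivlMr.
Qed.

Lemma bump_neq0 t : bump t != 0 -> `|t| <= delta.
Proof.
apply: contraNT; rewrite -ltNge => td; apply/eqP; apply: pl_eq0.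
by rewrite normrM gtr0_norm ?divr_gt0// mulrAC ler_pdivlMr// -mulr2n ler_pM2l// ltW.
Qed.

Lemma bumps_bound z : 0 <= bumps z <= 1.
Proof.
apply/andP; split; first by apply: prodr_ge0 => i _; case/andP: (bump_bound (z i)).
by apply: prodr_ile1 => i _; exact: bump_bound.
Qed.

Lemma bumps_eq0 (z : nat -> R) : ~ (forall i : 'I_n, `|z i| <= delta) -> bumps z = 0.
Proof.
move=> /existsNP[i zi]; apply/eqP; rewrite prodf_seq_eq0; apply/hasP.
exists i; first exact: mem_index_enum.
by apply/negPn/negP => /bump_neq0.
Qed.

Lemma smooth_test_fun : smooth f.
Proof.
apply: smooth_fun_smooth; apply: SF_mul.
  exact: (SF_comp (smooth_profile pl_smooth pl_eq0 nm0 (al := al) (M := M)) (SF_coord ord_max)).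
apply: smooth_fun_prod => i.
have S1 : smooth_on setT bump.
  apply: smooth_term_on; first exact: openT.
  exact: (ST_comp (pl_smooth (M := 1)) (fun x _ => Logic.I) (ST_mul (ST_cst setT _) (ST_id setT))).
apply: (SF_comp S1); apply: (SF_mul (SF_coord _)).
have S2 : smooth_on setT (invpow pl nm M (nu (widen_ord (leqnSn n) i) / nm)).
  exact: smooth_invpow.
exact: (SF_comp S2 (SF_coord ord_max)).
Qed.

(** The profile keeps the last coordinate $u$ between two positive bounds below 1, hence away from
    the origin; on the support each other coordinate is at most $\delta\,u^{\nu_i/\nu_N} \le
    \delta$. *)
Lemma Cc_inf_test_fun : Cc_inf_punct f.
Proof.
split; first exact: smooth_test_fun.
pose A (i : 'I_n.+1) : set R := if i == ord_max then
   `[uexp nm (M + 1), uexp nm (- (M + 1))]%classic else `[- delta, delta]%classic.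
exists [set x : 'rV[R]_n.+1 | forall i, A i (x ord0 i)]; split.
- by apply: rV_compact => i; rewrite /A; case: ifP => _; exact: segment_compact.
- move=> /(_ ord_max); rewrite /A eqxx/= mxE in_itv/= => /andP[+ _].
  by rewrite leNgt uexp_gt0.
move=> x nK; apply/eqP; apply/negPn/negP => fx; apply: nK.
move: fx; rewrite /test_fun mulf_eq0 negb_or => /andP[px bx].
have ub := profile_neq0 pl_eq0 nm0 px.
have u01 : 0 < x 0 ord_max < 1 by move: ub; rewrite uexp_itv// => /andP[].
have u0 : 0 < x 0 ord_max by case/andP: u01.
move=> i; rewrite /A; case: ifPn => [/eqP->|ni] /=; first by rewrite in_itv.
have ilt : (i < n)%N.
  by rewrite ltn_neqAle -ltnS ltn_ord andbT; apply: contra ni => /eqP e; exact/eqP/val_inj.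
move: bx => /prodf_neq0/(_ (Ordinal ilt) isT)/bump_neq0.
rewrite (_ : widen_ord _ _ = i); last exact/val_inj.
rewrite (invpowE pl_eq1 pl_eq0 nm0 _ px) normrM (ger0_norm (powR_ge0 _ _)) powRN.
rewrite ler_pdivrMr ?powR_gt0// in_itv/= -ler_norml => /le_trans; apply.
rewrite ler_piMr ?(ltW delta0)//.
have <- : 1 `^ (nu i / nm) = 1 :> R by rewrite powR1.
apply: ge0_ler_powR; rewrite ?nnegrE ?(ltW u0)//.
  by rewrite divr_ge0 ?ltW.
by case/andP: u01 => _ /ltW.
Qed.

Lemma test_fun_ray z u : 0 < u -> f (ray nu 1 z u) = prof u * bumps z.
Proof.
move=> u0; rewrite /test_fun.
have -> : ray nu 1 z u 0 ord_max = u.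
  by rewrite !mxE /upd eqxx mulr1 -powRrM mulVf// powRr1 ?ltW.
have [->|pn0] := eqVneq (prof u) 0; first by rewrite !mul0r.
congr (_ * _); apply: eq_bigr => i _; congr bump.
rewrite (invpowE pl_eq1 pl_eq0 nm0 _ pn0) !mxE /upd/= ltn_eqF//.
rewrite -powRrM [nm^-1 * _]mulrC powRN mulrAC divff ?mul1r//.
by rewrite gt_eqF// powR_gt0.
Qed.

Lemma test_fun_rayN z u : 0 < u -> f (ray nu (-1) z u) = 0.
Proof.
move=> u0; rewrite /test_fun.
have -> : ray nu (-1) z u 0 ord_max = - u.
  by rewrite !mxE /upd eqxx -powRrM mulVf// powRr1 ?(ltW u0)// mulrN1.
have -> : prof (- u) = 0.
  by rewrite /profile /cutoff oppr_gt0 ltNge (ltW u0).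
by rewrite mul0r.
Qed.

Let sm := expR (- (M + 1)).
Let sm0 : 0 < sm. Proof. exact: expR_gt0. Qed.
Let thV : 0 < th^-1 < 1. Proof. by rewrite invr_gt0 th0/= invf_lt1. Qed.

(** This makes $f_R$ vanish. At the crossing with $|x| = R$ the value of [slog] is
    [- ln (Rr / qn (base z))], which is smaller than $e^{-(M+1)}$ by [box_log], so the crossing lies
    outside the support of the profile. *)
Lemma profile_base (z : nat -> R) : (forall i : 'I_n, `|z i| <= delta) ->
  prof (ray_base nu qn Rr 1 z) = 0.
Proof.
move=> zd; apply/eqP/negPn/negP => /(profile_neq0 pl_eq0 nm0).
rewrite uexp_itv// => /andP[u01 /andP[+ _]]; apply/negP; rewrite -ltNge.
have s0 := slog_gt0 nm0 u01.
have -> : slog nm (ray_base nu qn Rr 1 z) = - ln (Rr / qn (base z)).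
  by rewrite /slog /ray_base ln_powR mulrA mulNr mulVf// mulN1r.
have Lz := box_log zd.
have L1 : - ln (Rr / qn (base z)) < sm.
  apply: le_lt_trans (ler_norm _) _; rewrite normrN (le_lt_trans Lz)//.
  by rewrite gtr_pMl// ltrBlDr ltrDl; case/andP: thV.
have L0 : 0 < - ln (Rr / qn (base z)).
  by move: s0; rewrite /slog /ray_base ln_powR mulrA mulNr mulVf// mulN1r.
by rewrite -[ltRHS]expRK ltr_ln ?posrE ?expR_gt0.
Qed.

Lemma test_ray_diff z u : 0 < u ->
  ray_diff nu qn f Rr 1 z u = prof u * bumps z.
Proof.
move=> u0.
have b0 : 0 < ray_base nu qn Rr 1 z.
  rewrite powR_gt0// divr_gt0//; apply: ray_norm_gt0 => //; exact: oner_neq0.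
apply: (etrans (congr2 (fun a b : R => a - b) (test_fun_ray z u0) (test_fun_ray z b0))).
have [zd|zd] := pselect (forall i : 'I_n, `|z i| <= delta).
  by rewrite (profile_base zd) mul0r subr0.
by rewrite (bumps_eq0 zd) !mulr0 subr0.
Qed.

(** Read off from the restriction to the orbit, by uniqueness of the derivative; the Euler field of
    the full product is never expanded. *)
Lemma test_ray_der z u : 0 < u -> ray_der nu f 1 z u = dprof u * bumps z.
Proof.
move=> u0.
have [_ <-] := ray_diff_derive qn nu0 Rr smooth_test_fun 1 z u0.
rewrite (@near_eq_derive _ _ _ _ (fun x : R => prof x * bumps z)); last first.
  by apply: filterS (lt_nbhsr u0) => x x0; exact: test_ray_diff.
have D1 := profile_derive pl_derive pl_eq0 nm0 al M u0.
have [_ ->] := is_derive_mulr D1 (is_derive_cst (bumps z) u 1).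
by rewrite mulr0 add0r mulrC.
Qed.

Lemma test_ray_derN z u : 0 < u -> ray_der nu f (-1) z u = 0.
Proof.
move=> u0; have [_ <-] := ray_diff_derive qn nu0 Rr smooth_test_fun (-1) z u0.
rewrite (@near_eq_derive _ _ _ _ (cst (0 : R))) ?derive_cst//.
have b0 : 0 < ray_base nu qn Rr (-1) z.
  by rewrite powR_gt0// divr_gt0//; apply: ray_norm_gt0 => //; rewrite oppr_eq0 oner_neq0.
apply: filterS (lt_nbhsr u0) => x x0.
apply: (etrans (congr2 (fun a b : R => a - b) (test_fun_rayN z x0) (test_fun_rayN z b0))).
exact: subrr.
Qed.

Let om z := ray_log nu qn Rr 1 z.
Let one0 : (1 : R) != 0. Proof. exact: oner_neq0. Qed.

Lemma ray_log_slog (z : nat -> R) u : (forall i : 'I_n, `|z i| <= delta) ->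
  uexp nm (M + 1) <= u <= uexp nm (- (M + 1)) ->
  [/\ 0 < `|om z u|, slog nm u <= th * `|om z u| & `|om z u| <= th * slog nm u].
Proof.
move=> zd; rewrite uexp_itv// => /andP[u01 /andP[+ _]] => ly.
have s0 := slog_gt0 nm0 u01.
have sms : sm <= slog nm u.
  by rewrite -[leRHS](lnK (_ : slog nm u \in Num.pos)) ?posrE// ler_expR.
have Lz := box_log zd; set L := ln _ in Lz.
have omE : `|om z u| = `|slog nm u + L|.
  by rewrite -normrN; congr `|_|; rewrite /om /ray_log -/L /slog; ring.
have [t0 t1] : 0 < th^-1 /\ th^-1 < 1 by case/andP: thV.
have Ls : `|L| <= (1 - th^-1) * slog nm u.
  by rewrite (le_trans Lz)// ler_pM2l// subr_gt0.
have lo : th^-1 * slog nm u <= `|slog nm u + L|.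
  have := ler_norm (slog nm u + L); have := ler_norm (- L); rewrite normrN.
  by move: Ls; rewrite mulrBl mul1r => *; lra.
have hi : `|slog nm u + L| <= (2 - th^-1) * slog nm u.
  apply: le_trans (ler_normD _ _) _; rewrite (gtr0_norm s0).
  by move: Ls; rewrite !mulrBl mul1r => *; lra.
rewrite omE; split.
- by apply: lt_le_trans lo; rewrite mulr_gt0.
- by rewrite -ler_pdivrMl.
(* The inequality $2 - \theta^{-1} \le \theta$ amounts to $(\theta - 1)^2 \ge 0$. *)
- apply: (le_trans hi); rewrite ler_pM2r//.
  have thn0 : th != 0 by rewrite gt_eqF.
  rewrite -subr_ge0 (_ : th - (2 - th^-1) = (th - 1) ^+ 2 / th); last by field.
  by rewrite divr_ge0 ?sqr_ge0// ltW.
Qed.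

Let TL := th `^ (- g) * (M + M).
Let TR := th `^ (p + g) * (al `^ p * (M + M) + (al + B) `^ p * 2).

Let IL z := (\int[mu]_(u in `]0%R, +oo[) (hardyL p g prof (fun u => `|om z u|%R) v u)%:E)%E.
Let IR z := (\int[mu]_(u in `]0%R, +oo[) (hardyR p g dprof (fun u => `|om z u|%R) v u)%:E)%E.

Let TL_le (z : nat -> R) : (forall i : 'I_n, `|z i| <= delta) -> (TL%:E <= IL z)%E.
Proof.
move=> zd; apply: profile_integral_hardyL => //.
- by rewrite ltW.
- by move=> u; exact: ray_log_slog.
- exact: measurable_ray_log.
Qed.

Let le_TR (z : nat -> R) : (forall i : 'I_n, `|z i| <= delta) -> (IR z <= TR%:E)%E.
Proof.
move=> zd; apply: profile_integral_hardyR => //.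
- by rewrite ltW.
- by move=> u; exact: ray_log_slog.
- exact: measurable_ray_log.
Qed.

(** The factor shared by both integrals over an orbit; only the one-dimensional bounds [TL] and [TR]
    remain to be compared. *)
Let k z := nm * qn (base z) `^ (- Q) * bumps z `^ p.

Let k_ge0 z : 0 <= k z.
Proof. by rewrite /k !mulr_ge0 ?powR_ge0// ltW. Qed.

Let fibL s z := (\int[mu]_(u in `]0%R, +oo[) ((u `^ ((Q - nm) / nm))%:E *
  (`|hardy_lhs nu qn p g f Rr (ray nu s z u)| `^ p)%:E))%E.
Let fibR s z := (\int[mu]_(u in `]0%R, +oo[) ((u `^ ((Q - nm) / nm))%:E *
  (`|hardy_rhs nu qn p g f Rr (ray nu s z u)| `^ p)%:E))%E.

Let DP u : u \in (`]0%R, +oo[%classic : set R) -> 0 < u.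
Proof. by move=> /set_mem/=; rewrite in_itv/= andbT. Qed.

Let mprof : measurable_fun (`]0%R, +oo[%classic : set R) prof.
Proof. exact: (measurable_profile pl_derive). Qed.

Let mdprof : measurable_fun (`]0%R, +oo[%classic : set R) dprof.
Proof. exact: measurable_dprofile. Qed.

Let mv : measurable_fun (`]0%R, +oo[%classic : set R) v.
Proof. exact: measurable_inv_scale. Qed.

Let mom z : measurable_fun (`]0%R, +oo[%classic : set R) (om z).
Proof. exact: measurable_ray_log. Qed.

Let fibLE z : fibL 1 z = ((k z)%:E * IL z)%E.
Proof.
have mL := measurable_hardyL p g mprof (mom z) mv.
have L0 u : (`]0%R, +oo[%classic : set R) u ->
    (0 <= (hardyL p g prof (fun u => `|om z u|%R) v u)%:E)%E.
  by move=> /mem_set/DP u0; rewrite lee_fin hardyL_ge0// invr_ge0 mulr_ge0 ?ltW.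
have k0 : (0 <= (k z)%:E)%E by rewrite lee_fin.
apply: (etrans _ (ge0_integralZl mu (measurable_itv _) mL L0 k0)).
apply: eq_integral => u /DP u0; rewrite -!EFinM; congr EFin.
apply: (etrans (fibre_lhs g nu0 qn_ge0 qn_eq0 qn_dil p1 f Rr0 z one0 u0)).
have bz : 0 <= bumps z by case/andP: (bumps_bound z).
have -> : hardyL p g (ray_diff nu qn f Rr 1 z) (fun u => `|om z u|) v u =
   bumps z `^ p * hardyL p g prof (fun u => `|om z u|) v u.
  rewrite /hardyL (test_ray_diff z u0) normrM (powRM _ (normr_ge0 _) (normr_ge0 _)).
  by rewrite (ger0_norm bz) -!mulrA mulrCA.
by rewrite /k -!mulrA.
Qed.

Let fibRE z : fibR 1 z = ((k z)%:E * IR z)%E.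
Proof.
have mR := measurable_hardyR p g mdprof (mom z) mv.
have R0 u : (`]0%R, +oo[%classic : set R) u ->
    (0 <= (hardyR p g dprof (fun u => `|om z u|%R) v u)%:E)%E.
  by move=> _; rewrite lee_fin hardyR_ge0.
have k0 : (0 <= (k z)%:E)%E by rewrite lee_fin.
apply: (etrans _ (ge0_integralZl mu (measurable_itv _) mR R0 k0)).
apply: eq_integral => u /DP u0; rewrite -!EFinM; congr EFin.
apply: (etrans (fibre_rhs g nu0 qn_ge0 qn_eq0 qn_dil p1 smooth_test_fun Rr0 z one0 u0)).
have bz : 0 <= bumps z by case/andP: (bumps_bound z).
have -> : hardyR p g (ray_der nu f 1 z) (fun u => `|om z u|) v u =
   bumps z `^ p * hardyR p g dprof (fun u => `|om z u|) v u.
  rewrite /hardyR (test_ray_der z u0) normrM (powRM _ (normr_ge0 _) (normr_ge0 _)).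
  by rewrite (ger0_norm bz) -!mulrA mulrCA.
by rewrite /k -!mulrA.
Qed.

Let fibRN z : fibR (-1) z = 0%E.
Proof.
have N10 : (-1 : R) != 0 by rewrite oppr_eq0.
rewrite /fibR; apply: integral0_eq => u /mem_set/DP u0; rewrite -EFinM; congr EFin.
apply: (etrans (fibre_rhs g nu0 qn_ge0 qn_eq0 qn_dil p1 smooth_test_fun Rr0 z N10 u0)).
by rewrite /hardyR (test_ray_derN z u0) normr0 powR0 ?gt_eqF// !mul0r mulr0.
Qed.

Let k_out (z : nat -> R) : ~ (forall i : 'I_n, `|z i| <= delta) -> k z = 0.
Proof. by move=> /bumps_eq0 z0; rewrite /k z0 powR0 ?gt_eqF// mulr0. Qed.

Let fib_le C z : 0 <= C -> C * TR <= TL -> (C%:E * fibR 1 z <= fibL 1 z)%E.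
Proof.
move=> C0 CT; rewrite fibLE fibRE.
have [zd|/k_out->] := pselect (forall i : 'I_n, `|z i| <= delta); last first.
  by rewrite !mul0e mule0.
rewrite muleCA; apply: lee_wpmul2l; first by rewrite lee_fin.
apply: le_trans (TL_le zd); apply: (@le_trans _ _ (C%:E * TR%:E)%E).
  by apply: lee_wpmul2l; rewrite ?lee_fin ?le_TR.
by rewrite -EFinM lee_fin.
Qed.

Let ge0_pow (h : 'rV[R]_n.+1 -> R) x : (0 <= (`|h x| `^ p)%:E)%E.
Proof. by rewrite lee_fin powR_ge0. Qed.

Let cylL := cyl_hardy_lhs nu g cqn qn_ge0 p1 Rr smooth_test_fun.
Let cylR := cyl_hardy_rhs nu g cqn qn_ge0 qn_eq0 p1 Rr smooth_test_fun.
Let mfL := cyl_measurable_fibre nu cylL (ge0_pow _).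
Let mfR := cyl_measurable_fibre nu cylR (ge0_pow _).

Let fibL_ge0 s z : (0 <= fibL s z)%E.
Proof. by apply: integral_ge0 => u _; rewrite mule_ge0// lee_fin powR_ge0. Qed.
Let fibR_ge0 s z : (0 <= fibR s z)%E.
Proof. by apply: integral_ge0 => u _; rewrite mule_ge0// lee_fin powR_ge0. Qed.

Let HL := haar_int (fun x => (`|hardy_lhs nu qn p g f Rr x| `^ p)%:E).
Let HR := haar_int (fun x => (`|hardy_rhs nu qn p g f Rr x| `^ p)%:E).

Let HLE : HL = (iint n (fibL 1) + iint n (fibL (-1)))%E.
Proof. exact: (haar_int_polar nu0 cylL (ge0_pow _)). Qed.

Let HRE : HR = iint n (fibR 1).
Proof.
have E0 : iint n (fibR (-1)) = 0%E.
  by apply: (etrans _ (iint0 n)); congr iint; apply/funext => z; exact: fibRN.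
apply: (etrans (haar_int_polar nu0 cylR (ge0_pow _))).
apply: (etrans (congr1 (fun x => (iint n (fibR 1) + x)%E) E0)); exact: adde0.
Qed.

(** The comparison holds orbit by orbit where the last coordinate is positive. The other half
    contributes 0 to the right side and a nonnegative amount to the left side. In the application
    [C] is the [p]-th power of a candidate constant. *)
Lemma test_fun_le C : 0 <= C -> C * TR <= TL -> (C%:E * HR <= HL)%E.
Proof.
move=> C0 CT; have Z := iintZ n C0 (@mfR 1) (fibR_ge0 1).
have H1 : (C%:E * iint n (fibR 1) <= iint n (fibL 1))%E.
  apply: (eq_ind _ (fun x => (x <= iint n (fibL 1))%E) _ _ Z).
  apply: le_iint; [|exact: (@mfL 1)|].
  - move=> d S a phi ma mphi; apply: emeasurable_funM; first exact: measurable_cst.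
    exact: (@mfR 1 _ _ a phi ma mphi).
  - move=> z; apply/andP; split; last exact: (fib_le z C0 CT).
    by apply: mule_ge0; [rewrite lee_fin|exact: fibR_ge0].
have H2 : (C%:E * iint n (fibR 1) <= iint n (fibL 1) + iint n (fibL (-1)))%E.
  by apply: (le_trans H1); apply: leeDl; exact: iint_ge0.
exact: (eq_ind_r (fun x => (C%:E * x <= HL)%E)
  (eq_ind_r (fun y => (C%:E * iint n (fibR 1) <= y)%E) H2 HLE) HRE).
Qed.

Let A (r : R) : set R := `[- r, r]%classic.

Let boxE r (z : nat -> R) : \prod_(i < n) (\1_(A r) (z i) : R) = `[< forall i : 'I_n, `|z i| <= r >]%:R.
Proof.
have AE t : \1_(A r) t = (`|t| <= r)%R%:R :> R.
  rewrite indicE; congr (nat_of_bool _)%:R; rewrite ler_norml.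
  by apply/idP/idP => [/set_mem|ub]; [rewrite /A/= in_itv|rewrite mem_set// /A/= in_itv].
case: asboolP => [zr|/existsNP[i /negP zi]].
  by rewrite big1// => i _; rewrite AE zr.
apply/eqP; rewrite prodf_seq_eq0; apply/hasP; exists i; first exact: mem_index_enum.
by rewrite AE (negbTE zi) eqxx.
Qed.

Let cyl_box K r : cyl_measurable (fun _ : unit => fun z : nat -> R =>
  (K * \prod_(i < n) \1_(A r) (z i))%:E).
Proof.
move=> d S a phi ma mphi; apply/measurable_EFinP; apply: measurable_funM => //.
apply: measurable_prod => i _.
have m1 : measurable_fun setT (\1_(A r : set (measurableTypeR R)) :
    measurableTypeR R -> R) by apply: measurable_indic; exact: measurable_itv.
exact: (measurableT_comp m1 (mphi i)).
Qed.

Let mu_A r : 0 < r -> mu (A r) = (r + r)%:E.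
Proof.
move=> r0; rewrite /A lebesgue_measure_itv/= lte_fin (@lt_trans _ _ 0) ?oppr_lt0//.
by rewrite -EFinB opprK.
Qed.

(** The bound in [box_log] is at most 1, so base points over the cube have quasi-norm within a
    factor $e$ of [Rr]. *)
Let c_bound (z : nat -> R) : (forall i : 'I_n, `|z i| <= delta) ->
  expR (- Q * ln Rr - Q) <= qn (base z) `^ (- Q) <= expR (- Q * ln Rr + Q).
Proof.
move=> zd; have c0 : 0 < qn (base z) by apply: ray_norm_gt0.
have Q0 : 0 <= Q by apply: sumr_ge0 => i _; exact/ltW.
have Lz := box_log zd.
have {Lz} : `|ln (Rr / qn (base z))| <= 1.
  apply: (le_trans Lz); have /andP[t0 t1] := thV; have sm1 : sm <= 1.
    by rewrite /sm expR_le1 oppr_le0 addr_ge0// ltW.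
  by rewrite -[leRHS]mulr1 ler_pM ?subr_ge0 ?(ltW t1) ?(ltW sm0)// gerBl ltW.
rewrite ln_div ?posrE// ler_norml => /andP[L1 L2].
rewrite /powR gt_eqF// !ler_expR; apply/andP; split; nra.
Qed.

(** Needed for the strict inequality in the optimality claim, which would fail for a positive
    candidate constant if both norms were infinite. *)
Lemma test_fun_fin : (HR < +oo)%E.
Proof.
have TR0 : 0 <= TR by rewrite !(mulr_ge0, addr_ge0) ?powR_ge0 ?(ltW M0).
pose K := nm * expR (- Q * ln Rr + Q) * TR.
have K0 : 0 <= K.
  by rewrite /K; apply: mulr_ge0 => //; apply: mulr_ge0; [exact: ltW nm0|exact: expR_ge0].
apply: (eq_ind_r (fun x => (x < +oo)%E) _ HRE).
apply: (@le_lt_trans _ _ (iint n (fun z => (K * \prod_(i < n) \1_(A delta) (z i))%:E))).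
  apply: le_iint; [exact: (@mfR 1)|exact: cyl_box|].
  move=> z; rewrite fibR_ge0/= fibRE boxE; case: asboolP => [zd|/k_out->]; last first.
    by rewrite mul0e mulr0.
  rewrite mulr1; apply: (@le_trans _ _ ((k z)%:E * TR%:E)%E).
    by apply: lee_wpmul2l; rewrite ?lee_fin ?le_TR.
  rewrite -EFinM lee_fin /K ler_wpM2r// /k.
  have /andP[_ cb] := c_bound zd; have /andP[b0 b1] := bumps_bound z.
  rewrite -[leRHS]mulr1 ler_pM ?mulr_ge0 ?powR_ge0 ?(ltW nm0)//.
    by rewrite ler_pM2l.
  have <- : 1 `^ p = 1 :> R by rewrite powR1.
  by apply: ge0_ler_powR; rewrite ?nnegrE ?(ltW p0).
rewrite iint_box//; last exact: measurable_itv.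
by rewrite mu_A// -EFin_expe -EFinM ltry.
Qed.

Lemma test_fun_pos : (0 < HL)%E.
Proof.
have TL0 : 0 < TL by rewrite mulr_gt0 ?powR_gt0 ?addr_gt0.
pose K := nm * expR (- Q * ln Rr - Q) * TL.
have K0 : 0 < K.
  by rewrite /K; apply: mulr_gt0 => //; apply: mulr_gt0; [exact: nm0|exact: expR_gt0].
have d2 : 0 < delta / 2 by rewrite divr_gt0.
apply: (eq_ind_r (fun x => (0 < x)%E) _ HLE).
apply: (@lt_le_trans _ _ (iint n (fibL 1))); last by apply: leeDl; exact: iint_ge0.
apply: (@lt_le_trans _ _ (iint n (fun z => (K * \prod_(i < n) \1_(A (delta / 2)) (z i))%:E))).
  rewrite iint_box ?(ltW K0)//; last exact: measurable_itv.
  by rewrite mu_A// -EFin_expe -EFinM lte_fin mulr_gt0// exprn_gt0// addr_gt0.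
apply: le_iint; [exact: cyl_box|exact: (@mfL 1)|].
move=> z; rewrite boxE; case: asboolP => [zd|_]; last by rewrite mulr0 lexx fibL_ge0.
rewrite mulr1 lee_fin (ltW K0)/= fibLE.
(* On the cube of half the size the bumps are 1, so the factor [k z] is bounded below by a positive
   constant. *)
have zd' (i : 'I_n) : `|z i| <= delta by rewrite (le_trans (zd i))// ler_pdivrMr//; lra.
apply: (@le_trans _ _ ((k z)%:E * TL%:E)%E); last first.
  by apply: lee_wpmul2l; rewrite ?lee_fin ?TL_le.
have bz : bumps z = 1 by rewrite /bumps big1// => i _; rewrite bump_eq1.
have /andP[cb _] := c_bound zd'.
by rewrite -EFinM lee_fin /K /k bz powR1 mulr1 ler_pM2r// ler_pM2l.
Qed.

End test_function.

(** * Roots of integrals, choice of parameters and conclusion *)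

Lemma poweR_invM {R : realType} (p K : R) (b : \bar R) : 0 < p -> 0 <= K -> (0 <= b)%E ->
  (((K `^ p)%:E * b) `^ p^-1)%E = (K%:E * b `^ p^-1)%E.
Proof.
move=> p0 K0 b0; rewrite poweRM ?lee_fin ?powR_ge0// poweR_EFin -powRrM mulfV ?gt_eqF//.
by rewrite powRr1.
Qed.

Lemma le_poweR_inv {R : realType} (p : R) (a b : \bar R) : 0 < p -> (0 <= a)%E -> (a <= b)%E ->
  (a `^ p^-1 <= b `^ p^-1)%E.
Proof.
move=> p0 a0 ab; apply: gt0_ler_poweR => //; first by rewrite invr_ge0 ltW.
  by rewrite in_itv/= a0 leey.
by rewrite in_itv/= (le_trans a0 ab) leey.
Qed.

(** Continuity of $\log|x|$ at the point of the last axis with last coordinate 1, where the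
    quasi-norm is positive. It supplies the narrow cone. *)
Lemma ln_ratio_near {R : realType} (n : nat) (qn : 'rV[R]_n.+1 -> R) (e : R) :
  continuous qn -> (forall x, 0 <= qn x) -> (forall x, qn x = 0 <-> x = 0) -> 0 < e ->
  exists2 delta, 0 < delta & forall z : nat -> R, (forall i : 'I_n, `|z i| <= delta) ->
    `|ln (qn (\row_i upd n 1 (fun=> 0) i) / qn (\row_i upd n 1 z i))| <= e.
Proof.
move=> cqn qn_ge0 qn_eq0 e0; set x0 := \row_i upd n 1 (fun=> 0) i.
have c0 (z : nat -> R) : 0 < qn (\row_i upd n 1 z i).
  by apply: ray_norm_gt0 => //; exact: oner_neq0.
have cl : {for x0, continuous (fun x => ln (qn x))}.
  by apply: (@continuous_comp _ _ _ qn (@ln R)); [exact: cqn|exact/continuous_ln/c0].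
have /cvgrPdist_le/(_ e e0) := cl.
rewrite -nbhs_ballE => -[d /= d0 H]; exists (d / 2); first by rewrite divr_gt0.
have qx0 : 0 < qn x0 by exact: c0.
move=> z zd; rewrite ln_div ?posrE ?qx0 ?c0//; apply: H; split=> // i j.
rewrite /ball/= !mxE /upd; case: ifPn => jn; first by rewrite subrr normr0.
have jlt : (j < n)%N by rewrite ltn_neqAle jn -ltnS ltn_ord.
rewrite sub0r normrN (le_lt_trans (zd (Ordinal jlt)))// ltr_pdivrMr//; lra.
Qed.

(** Put $c = (C\alpha)^p < 1$. The choice $K = 2/(1+c)$ satisfies $K > 1$ and $cK < 1$, and
    $\theta^{p+2\gamma} = K$. After division by $2\theta^{-\gamma}$ the claim reads $cKM + X \le M$,
    where [X] is the cost of the transitions, and this holds for large [M]. *)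
Lemma test_parameters {R : realType} (p g al B C : R) : 1 < p -> 1 < g -> 0 < al -> 0 <= C ->
  C * al < 1 -> exists th M : R, [/\ 1 < th, 0 < M &
    C `^ p * (th `^ (p + g) * (al `^ p * (M + M) + (al + B) `^ p * 2)) <=
    th `^ (- g) * (M + M)].
Proof.
move=> p1 g1 al0 C0 Cal.
have p0 : 0 < p by exact: lt_trans p1.
pose c := C `^ p * al `^ p; pose q := p + g + g; pose K := 2 / (1 + c).
have c_ge0 : 0 <= c by rewrite mulr_ge0 ?powR_ge0.
have c1 : c < 1.
  rewrite /c -powRM ?(ltW al0)//.
  have <- : 1 `^ p = 1 :> R by rewrite powR1.
  by apply: gt0_ltr_powR; rewrite ?nnegrE ?mulr_ge0// ltW.
have q0 : 0 < q by rewrite /q; lra.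
have K1 : 1 < K by rewrite /K ltr_pdivlMr; lra.
have K0 : 0 < K by exact: lt_trans K1.
have cK : 0 < 1 - c * K.
  rewrite (_ : 1 - c * K = (1 - c) / (1 + c)); first by rewrite divr_gt0; lra.
  by rewrite /K; field; rewrite gt_eqF//; lra.
pose D := (al + B) `^ p; have D0 : 0 <= D by exact: powR_ge0.
pose X := C `^ p * K * D; have X0 : 0 <= X.
  by apply: mulr_ge0 => //; apply: mulr_ge0; [exact: powR_ge0|exact: ltW].
pose th := K `^ q^-1; pose M := X / (1 - c * K) + 1.
have th1 : 1 < th.
  have <- : 1 `^ q^-1 = 1 :> R by rewrite powR1.
  by apply: gt0_ltr_powR; rewrite ?invr_gt0 ?nnegrE ?ler01 ?(ltW K0).
have thn0 : th != 0 by rewrite gt_eqF// (lt_trans _ th1).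
exists th, M; split=> //; first by rewrite ltr_wpDl// divr_ge0// ltW.
have -> : th `^ (p + g) = th `^ (- g) * K.
  rewrite (_ : K = th `^ q); last by rewrite /th -powRrM mulVf ?gt_eqF// powRr1// ltW.
  by rewrite -powRD; [congr (_ `^ _); rewrite /q; ring|rewrite thn0 implybT].
have -> : C `^ p * (th `^ (- g) * K * (al `^ p * (M + M) + (al + B) `^ p * 2)) =
  th `^ (- g) * (c * K * (M + M) + X * 2) by rewrite /X /c /D; ring.
apply: ler_wpM2l; first exact: powR_ge0.
have : X <= (1 - c * K) * M.
  rewrite /M mulrDr mulr1 mulrCA mulfV ?gt_eqF// mulr1 lerDl; exact: ltW.
lra.
Qed.

Unset Implicit Arguments.
Theorem theorem5p1 (R : realType) (N : nat) (nu : 'I_N -> R)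
    (mul : 'rV[R]_N -> 'rV[R]_N -> 'rV[R]_N) (inv : 'rV[R]_N -> 'rV[R]_N)
    (qn : 'rV[R]_N -> R) (gamma p : R) :
  (0 < N)%N ->
  homogeneous_group nu mul inv ->
  homogeneous_quasi_norm nu inv qn ->
  1 < gamma -> Num.max 1 (gamma - 1) < p ->
  let Q := hom_dim nu in
  let lhs (f : 'rV[R]_N -> R) (Rr : R) :=
    Lp_norm p (fun x => (f x - fR nu qn f Rr x) /
       (powR (qn x) (Q / p) * powR `|ln (Rr / qn x)| (gamma / p))) in
  let rhs (f : 'rV[R]_N -> R) (Rr : R) :=
    Lp_norm p (fun x => radial nu qn f x /
       (powR (qn x) ((Q - p) / p) * powR `|ln (Rr / qn x)| ((gamma - p) / p))) in
  (forall f Rr, Cc_inf_punct f -> 0 < Rr ->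
     (lhs f Rr <= (p / (gamma - 1))%:E * rhs f Rr)%E) /\
  (forall C : R, C < p / (gamma - 1) ->
     exists f Rr, [/\ Cc_inf_punct f, 0 < Rr & (C%:E * rhs f Rr < lhs f Rr)%E]).
Proof.
case: N nu mul inv qn => // n nu mul inv qn _ [nu0 _ _ _ _].
move=> [cqn qn_ge0 qn_eq0 _ qn_dil] g1; rewrite gt_max => /andP[p1 gp] Q lhs rhs.
have p0 : 0 < p by exact: lt_trans p1.
have pn0 : p != 0 by rewrite gt_eqF.
have pg0 : 0 < p / (gamma - 1) by rewrite divr_gt0// subr_gt0.
have int0 (h : 'rV[R]_n.+1 -> R) : (0 <= haar_int (fun x => (`|h x| `^ p)%:E))%E.
  by apply: iint_ge0 => x; rewrite lee_fin powR_ge0.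
have hardy f Rr : smooth f -> 0 < Rr -> (lhs f Rr <= (p / (gamma - 1))%:E * rhs f Rr)%E.
  move=> sf Rr0.
  have H := hardy_haar_int nu0 cqn qn_ge0 qn_eq0 qn_dil p1 g1 gp sf Rr0.
  have H1 := le_poweR_inv p0 (int0 _) H.
  exact: (eq_ind _ (fun y => (lhs f Rr <= y)%E) H1 _ (poweR_invM p0 (ltW pg0) (int0 _))).
split=> [f Rr [sf _]|C Clt]; first exact: hardy.
pose al := (gamma - 1) / p.
have al0 : 0 < al by rewrite divr_gt0// subr_gt0.
have alE : al * p = gamma - 1 by rewrite /al divfK.
(* A constant strictly between [C] and the claimed optimum: the test function gives a non-strict
   bound for [C'], which is strict for [C]. The maximum with 0 covers negative [C], since [C'] is
   raised to the power [p]. *)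
pose C' := (Num.max C 0 + p / (gamma - 1)) / 2.
have mC : Num.max C 0 < p / (gamma - 1) by rewrite gt_max Clt.
have [mC0 mCC] : 0 <= Num.max C 0 /\ C <= Num.max C 0 by rewrite !le_max !lexx orbT.
have C'0 : 0 <= C' by rewrite /C'; lra.
have CC' : C < C' by rewrite /C'; lra.
have C'al : C' * al < 1.
  have : C' < p / (gamma - 1) by rewrite /C'; lra.
  by rewrite ltr_pdivlMr ?subr_gt0// /al mulrA ltr_pdivrMr// mul1r.
have [pl [dpl [B [pls pld [_ dplB] plb [pl1 pl0 dpli dplo]]]]] := @plateau_exists R.
have [th [M [th1 M0 CT]]] := test_parameters B p1 g1 al0 C'0 C'al.
(* With this radius the orbit of the last axis satisfies $\log(R/|x|) = \mathrm{slog}\,u$ exactly,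
   and the neighbouring orbits approximately. *)
pose Rr := qn (\row_i upd n 1 (fun=> 0) i).
have Rr0 : 0 < Rr by apply: ray_norm_gt0 => //; exact: oner_neq0.
have e0 : 0 < (1 - th^-1) * expR (- (M + 1)).
  by rewrite mulr_gt0 ?expR_gt0// subr_gt0 invf_lt1// (lt_trans _ th1).
have [delta d0 box] := ln_ratio_near cqn qn_ge0 qn_eq0 e0.
pose f := test_fun nu al pl M delta.
have fC : Cc_inf_punct f by exact: (Cc_inf_test_fun al nu0 pls pl1 pl0 M d0).
exists f, Rr; split=> //.
have := test_fun_le nu0 cqn qn_ge0 qn_eq0 qn_dil p1 g1 al0 alE pls pld dplB plb pl1 pl0 dpli dplo
  M0 th1 d0 Rr0 box (powR_ge0 _ _) CT.
have := test_fun_fin nu0 cqn qn_ge0 qn_eq0 qn_dil p1 g1 al0 alE pls pld dplB plb pl1 pl0 dpli dplo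
  M0 th1 d0 Rr0 box.
have := test_fun_pos nu0 cqn qn_ge0 qn_eq0 qn_dil p1 g1 alE pls pld plb pl1 pl0 M0 th1 d0 Rr0 box.
rewrite -/f => L0 Rfin RL.
have lhs0 : (0 < lhs f Rr)%E by exact: poweR_gt0 L0.
have rhsfin : (rhs f Rr < +oo)%E by exact: poweR_lty Rfin.
have C'le : (C'%:E * rhs f Rr <= lhs f Rr)%E.
  have H0 := mule_ge0 (_ : (0 <= (C' `^ p)%:E)%E) (int0 (hardy_rhs nu qn p gamma f Rr)).
  have H1 := le_poweR_inv p0 (H0 ltac:(by rewrite lee_fin powR_ge0)) RL.
  exact: (eq_ind _ (fun y => (y <= lhs f Rr)%E) H1 _ (poweR_invM p0 C'0 (int0 _))).
(* The inequality already proved shows that the right norm is positive, because the left one is;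
   hence replacing [C'] by the smaller [C] is a strict loss. *)
have := hardy f Rr fC.1 Rr0; have rhs_ge0 : (0 <= rhs f Rr)%E by exact: poweR_ge0.
move: (lhs f Rr) (rhs f Rr) lhs0 rhsfin C'le rhs_ge0 => l [r| |]// l0 _ C'le r0 ub.
apply: lt_le_trans C'le; rewrite -!EFinM lte_fin ltr_pM2r//.
move: (lt_le_trans l0 ub); rewrite -EFinM lte_fin.
by rewrite pmulr_rgt0.
Qed.
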